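(* Let $T:[0,1)\to[0,1)$ be a mixing staircase transformation, let $x_0\in(0,1)$ be the point separating its non-spacer part $[0,x_0)$ from its spacer part $[x_0,1)$, and let $p>q>0$ be rationally independent. Let $P$ be the $L$-shaped polygon under the graph of the roof function $f$, where $f=p$ on $[0,x_0)$ and $f=q$ on $[x_0,1)$; explicitly, $P$ has vertices $(0,0),(1,0),(1,q),(x_0,q),(x_0,p),(0,p)$. Glue the vertical edges of $P$ by translation to the opposite vertical edges: $\{0\}\times[0,q]$ with $\{1\}\times[0,q]$, and $\{0\}\times[q,p]$ with $\{x_0\}\times[q,p]$. Glue the horizontal edges according to $T$: the point $(x,0)$ is identified with $(T(x),\epsilon(T(x)))$, where $\epsilon(T(x))=f(T(x))\in\{p,q\}$ is the height of the roof above $T(x)$. Let $S$ be the resulting translation surface (of finite area and infinite genus). Then the vertical translation flow $\phi_t$ on $S$ is mixing.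
   Context: Staircase transformations (rank-one cutting and stacking). Fix a cutting sequence of positive integers $(r_n)_{n\ge1}$ and an initial interval $J=[0,a)$ (the non-spacer interval), which forms the column $C_0$ with $h_0=1$ level. Given column $C_{n-1}$, consisting of $h_{n-1}$ disjoint intervals (levels) of equal length stacked on top of one another, cut it vertically into $r_n$ subcolumns of equal width; on top of the $i$-th subcolumn ($1\le i\le r_n$, left to right) place $i-1$ new intervals (''spacers'') of the same width, taken consecutively from $[a,\infty)$ immediately to the right of the previously used spacer material; then stack the $(i+1)$-th subcolumn (with its spacers) on top of the $i$-th one for $1\le i\le r_n-1$. This gives column $C_n$ of height $h_n=r_nh_{n-1}+\sum_{i=1}^{r_n}(i-1)$. The map $T_n$ sends each level of $C_n$ other than the top one by translation onto the level directly above it; $T$ is the pointwise limit of the $T_n$. It is assumed that $a$ is chosen so that the total length of $J$ together with all spacers is $1$, so $T$ is defined a.e. on $[0,1)$, preserves Lebesgue measure, $[0,a)$ is the non-spacer part and $[a,1)$ the spacer part. $T$ is a mixing staircase transformation if it is mixing with respect to Lebesgue measure, i.e. $\lambda(T^{-n}A\cap B)\to\lambda(A)\lambda(B)$ for all measurable $A,B$. A flow $\phi_t$ preserving a finite measure $\mu$ is mixing if $\nu(\phi_{-t}A\cap B)\to\nu(A)\nu(B)$ as $t\to\infty$ for all measurable $A,B$, where $\nu=\mu/\mu(\text{total space})$; here $\mu$ is the area measure on $S$. *)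

(* Defs.v *)
From HB Require Import structures.
From mathcomp Require Import all_boot all_order all_algebra.
From mathcomp Require Import all_classical all_reals all_analysis.
Set Implicit Arguments. Unset Strict Implicit. Unset Printing Implicit Defensive.
Import Order.TTheory GRing.Theory Num.Theory.
Import numFieldNormedType.Exports.
Local Open Scope classical_set_scope.
Local Open Scope ring_scope.

(* r : nat -> nat is the cutting sequence; only r n.+1 (n >= 0), i.e.     *)
(* r_1, r_2, ... , is used.  a is the length of the initial interval       *)
(* J = [0,a).  A level is represented by its left endpoint; all levels of *)
(* column C_n have the same width [stair_width r a n].                    *)
Section Staircase.
Variable R : realType.
Variables (r : nat -> nat) (a : R).

Fixpoint stair_width (n : nat) : R :=
  if n is m.+1 then stair_width m / (r m.+1)%:R else a.

Definition stair_nspacers (n : nat) : nat := (\sum_(i < r n) i)%N.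

(* left end of the unused spacer material before stage n.+1 *)
Fixpoint stair_spstart (n : nat) : R :=
  if n is m.+1 then stair_spstart m + (stair_nspacers m.+1)%:R * stair_width m.+1
  else a.

(* left endpoints of the levels of C_n, listed from bottom to top.  At    *)
(* stage n.+1 the j-th subcolumn (j = 0 .. r_{n+1}-1, left to right) is   *)
(* followed by j spacers, taken consecutively (in the order in which they *)
(* are placed) from [stair_spstart n, oo).                                *)
Fixpoint stair_column (n : nat) : seq R :=
  if n is m.+1 then
    let w := stair_width m.+1 in
    flatten [seq [seq c + j%:R * w | c <- stair_column m] ++
                 [seq stair_spstart m + ((\sum_(i < j) i)%N + k)%:R * w
                 | k <- iota 0 j]
            | j <- iota 0 (r m.+1)]
  else [:: 0].

Definition stair_height (n : nat) : nat := size (stair_column n).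

(* index of the level of C_n containing x (= height if none) *)
Definition stair_level (n : nat) (x : R) : nat :=
  find (fun c => (c <= x) && (x < c + stair_width n)) (stair_column n).

(* T_n : maps each non-top level of C_n by translation onto the level     *)
(* directly above it (identity elsewhere; this value is irrelevant).     *)
Definition stair_Tn (n : nat) (x : R) : R :=
  let k := stair_level n x in
  let c := stair_column n in
  if (k.+1 < size c)%N then x - nth 0 c k + nth 0 c k.+1 else x.

Definition stair_Tn_inv (n : nat) (x : R) : R :=
  let k := stair_level n x in
  let c := stair_column n in
  if (0 < k < size c)%N then x - nth 0 c k + nth 0 c k.-1 else x.

Definition stair_T (x : R) : R := limn (fun n => stair_Tn n x).
Definition stair_T_inv (x : R) : R := limn (fun n => stair_Tn_inv n x).

End Staircase.

(* admissible staircase data: r_n >= 1, a > 0, and total length of J     *)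
(* together with all spacers equal to 1.                                  *)
Definition stair_admissible (R : realType) (r : nat -> nat) (a : R) : Prop :=
  (forall n, (0 < r n.+1)%N) /\ 0 < a /\
  (stair_spstart r a n @[n --> \oo] --> (1 : R)).

Definition mixing_map (R : realType) (T : R -> R) : Prop :=
  forall A B : set R, measurable A -> measurable B ->
    A `<=` `[0, 1[ -> B `<=` `[0, 1[ ->
    (lebesgue_measure ((iter n T) @^-1` A `&` B)) @[n --> \oo] -->
      (lebesgue_measure A * lebesgue_measure B)%E.

Section Surface.
Variable R : realType.
Variables (T_inv : R -> R) (x0 p q : R).

Definition roof (x : R) : R := if x < x0 then p else q.

(* the polygon P (up to its boundary, a null set); points of the top     *)
(* edges are identified with points of the bottom edge                   *)
Definition polygon : set (R * R) :=
  [set z | 0 <= z.1 < 1 /\ 0 <= z.2 < roof z.1].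

(* Vertical (upward) unit-speed motion: move up; on reaching the top      *)
(* point (x, f x), continue from the glued point (T^{-1} x, 0) of the     *)
(* bottom edge, since (x',0) ~ (T x', f (T x')).  k is a fuel bound on   *)
(* the number of crossings of the horizontal edges.                      *)
Fixpoint vflow_fuel (k : nat) (x y t : R) : R * R :=
  if y + t < roof x then (x, y + t)
  else if k is k'.+1 then vflow_fuel k' (T_inv x) 0 (t - (roof x - y))
  else (x, y + t).

(* phi_t for t >= 0: at most floor(t/q)+1 crossings occur, so fuel       *)
(* floor(t/q)+2 suffices.                                                *)
Definition vflow (t : R) (z : R * R) : R * R :=
  vflow_fuel (Num.truncn (t / q)).+2 z.1 z.2 t.

End Surface.

Definition leb2 {R : realType} := (@lebesgue_measure R \x @lebesgue_measure R)%E.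

Definition mixing_flow (R : realType) (phi : R -> R * R -> R * R)
  (X : set (R * R)) : Prop :=
  let nu := fun E : set (R * R) => fine (@leb2 R E) / fine (@leb2 R X) in
  forall A B : set (R * R), measurable A -> measurable B ->
    A `<=` X -> B `<=` X ->
    nu (phi t @^-1` A `&` B) @[t --> +oo] --> nu A * nu B.

(* Main.v *)
(** In the coordinate "minus the distance to the top of the column C_n", the
    vertical flow over C_n is the translation by t.  It is thus a rank-one flow:
    the tower over C_n, of height H_n (the sum of the roofs of its levels), is
    cut into r_{n+1} copies and the i-th copy is followed by a spacer of height
    i q.  Mixing of T only serves to show that r_n tends to infinity along the
    stages with r_n > 1; finite area gives r_{n+1} = o(H_n).

    For H_n <= t < H_{n+1}, time t carries copy i of the tower close to copy
    i + K, with a displacement that varies by q K l when i varies by l.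
    Averaging over i (van der Corput) bounds the correlations at time t by
    averages of a function along progressions of step q d.  These are small
    because the copies of a piece of an early tower inside a late one are
    uniformly distributed modulo q d.  Indeed, at a frequency theta each stage
    gains a factor by van der Corput if theta q is not a multiple of 2 pi;
    otherwise the exponential sum at a stage is a geometric progression in
    theta H_n and the product over the stages telescopes, since H_0 and q are
    incommensurable.  When K takes few values, i is shifted by large steps, so
    that q K l becomes comparable to the height of an earlier tower.

    Finite unions of rectangles over levels approximate the boxes, and the
    limit extends to all Borel sets by Dynkin systems, in each variable. *)

Require Import Defs.
From HB Require Import structures.
From mathcomp Require Import all_boot all_order all_algebra.
From mathcomp Require Import all_classical all_reals all_analysis.
From mathcomp Require Import measurable_realfun.
From mathcomp Require Import ring lra zify.
Import Order.TTheory GRing.Theory Num.Theory.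
Import numFieldNormedType.Exports.
Local Open Scope classical_set_scope.
Local Open Scope ring_scope.
Set Implicit Arguments.
Unset Strict Implicit.
Unset Printing Implicit Defensive.

(** Equidistribution modulo q d is uniform in the position but not in d, whereas at time t the
    relevant d is K, of the order of t / H_n, hence unbounded. This obstacle dictates the two
    regimes. The integral of an absolute average is bounded through its square, which expands into
    autocorrelations at the times q K d with 0 < d < L, L fixed. If many consecutive K occur, for
    each d these times form a long progression of bounded step q d; if few occur, a rescaled step
    brings each time into a range where decay is known.

    Correlations are unnormalised: at stage n they are compared with D_n, the number of copies of
    the initial tower C_m, since levels have width w_m / D_n. Here m is the column to which the sets
    are adapted. A set is compared with the whole region over C_m rather than with a constant, so
    that only functions of mean zero enter the towers. Rational independence enters through H_0
    alone: the bottom level of C_m has roof p, so H_0 is a positive multiple of p plus a multiple of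
    q. *)

Section BoundedFunctions.
Variable R : realType.
Implicit Types f g : R -> R.
Notation mu := (@lebesgue_measure R).

(** A class closed under sums, products and shifts on which every integral is finite; integrability
    side conditions reduce to membership in it. *)
Definition nice f := [/\ measurable_fun setT f, exists M, forall x, `|f x| <= M
  & exists K, forall x, f x != 0 -> `|x| <= K].

Definition Int f : R := (\int[mu]_x f x)%R.

(** A real-valued conditional rather than a set indicator: inequalities between such functions split
    by cases into linear arithmetic. *)
Definition cell (a b x : R) : R := if a <= x < b then 1 else 0.

Lemma niceP f M a b : measurable_fun setT f -> (forall x, `|f x| <= M) ->
  (forall x, f x != 0 -> a <= x < b) -> nice f.
Proof.
move=> mf fM fab; split=> //; first by exists M.
exists (`|a| + `|b|) => x /fab /andP[ax xb].
rewrite ler_norml; apply/andP; split.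
  by have := ler_norm (- a); have := normr_ge0 b; rewrite normrN; lra.
by have := ler_norm b; have := normr_ge0 a; lra.
Qed.

Lemma nice_integrable f : nice f -> mu.-integrable setT (EFin \o f).
Proof.
move=> [mf [M fM] [K fK]].
have mK : measurable (`[- K, K]%classic : set R) by exact: measurable_itv.
have fi : mu.-integrable `[- K, K]%classic (EFin \o f).
  apply: measurable_bounded_integrable => //.
  - by have /= -> := lebesgue_measure_itv (R := R) `[- K, K]; case: ifP => // _; rewrite ltry.
  - exact: measurable_funS mf.
  - exists M; split; first exact: num_real.
    by move=> N MN x _ /=; rewrite (le_trans (fM x))// ltW.
have := (integrable_mkcond (mu := mu) (EFin \o f) mK).1 fi.
congr integrable; apply/funext => x; rewrite /patch /=.
case: ifPn => //; rewrite notin_setE /= in_itv /= -ler_norml => /negP h.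
by have [->//|/fK] := eqVneq (f x) 0; rewrite (negbTE h).
Qed.

Lemma nice0 : nice (fun=> 0).
Proof.
split; [exact: measurable_cst|by exists 0 => x; rewrite normr0|].
by exists 0 => x; rewrite eqxx.
Qed.

Lemma niceD f g : nice f -> nice g -> nice (fun x => f x + g x).
Proof.
move=> [mf [M fM] [K fK]] [mg [N gN] [L gL]]; split.
- exact: measurable_funD.
- by exists (M + N) => x; rewrite (le_trans (ler_normD _ _))// lerD.
- exists (Num.max K L) => x; have [fx0|/fK fx _] := eqVneq (f x) 0; last first.
    by rewrite le_max fx.
  by rewrite fx0 add0r => /gL gx; rewrite le_max gx orbT.
Qed.

Lemma nice_bndM f g N : nice f -> measurable_fun setT g ->
  (forall x, `|g x| <= N) -> nice (fun x => f x * g x).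
Proof.
move=> [mf [M fM] [K fK]] mg gN; split; first exact: measurable_funM.
  exists (M * N) => x; rewrite normrM ler_pM//.
by exists K => x fg; apply: fK; apply: contraNneq fg => ->; rewrite mul0r.
Qed.

Lemma niceM f g : nice f -> nice g -> nice (fun x => f x * g x).
Proof. by move=> nf [mg [N gN] _]; apply: nice_bndM mg gN. Qed.

Lemma niceZ a f : nice f -> nice (fun x => a * f x).
Proof.
move=> nf; have := @nice_bndM f (fun=> a) `|a| nf (measurable_cst _).
by move=> /(_ (fun=> lexx _)); congr nice; apply/funext => x; rewrite mulrC.
Qed.

Lemma nice_sum (I : Type) (s : seq I) (P : pred I) (F : I -> R -> R) :
  (forall i, nice (F i)) -> nice (fun x => \sum_(i <- s | P i) F i x).
Proof.
move=> nF; elim: s => [|i s IHs].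
  by under eq_fun do rewrite big_nil; exact: nice0.
under eq_fun do rewrite big_cons; case: (P i) => //; exact: niceD.
Qed.

Lemma nice_norm f : nice f -> nice (fun x => `|f x|).
Proof.
move=> [mf [M fM] [K fK]]; split.
- exact: measurableT_comp.
- by exists M => x; rewrite normr_id.
- by exists K => x; rewrite normr_eq0; exact: fK.
Qed.

Lemma nice_shift f s : nice f -> nice (fun x => f (x + s)).
Proof.
move=> [mf [M fM] [K fK]]; split.
- by apply: (measurableT_comp mf) => //; exact: measurable_funD.
- by exists M => x.
- exists (K + `|s|) => x /fK h; have := ler_normB (x + s) s.
  by rewrite addrK => /le_trans; apply; rewrite lerD2r.
Qed.

Lemma nice_ind (a b : R) : nice (cell a b).
Proof.
apply: (@niceP _ 1 a b).
- have -> : cell a b = \1_(`[a, b[%classic : set R) :> (R -> R).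
    by apply/funext => x; rewrite /cell indicE mem_setE in_itv /=; case: ifP.
  by apply: measurable_indic; exact: measurable_itv.
- by move=> x; rewrite /cell; case: (_ && _); rewrite ?normr1 ?normr0.
- by move=> x; rewrite /cell; case: (_ && _); rewrite ?eqxx.
Qed.

Lemma IntD f g : nice f -> nice g -> Int (fun x => f x + g x) = Int f + Int g.
Proof. by move=> nf ng; rewrite /Int RintegralD//; exact: nice_integrable. Qed.

Lemma IntZ a f : nice f -> Int (fun x => a * f x) = a * Int f.
Proof. by move=> nf; rewrite /Int RintegralZl//; exact: nice_integrable. Qed.

Lemma Int_sum (I : Type) (s : seq I) (P : pred I) (F : I -> R -> R) :
  (forall i, nice (F i)) ->
  Int (fun x => \sum_(i <- s | P i) F i x) = \sum_(i <- s | P i) Int (F i).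
Proof.
move=> nF; elim: s => [|i s IHs].
  by under eq_fun do rewrite big_nil; rewrite big_nil /Int Rintegral_cst// mul0r.
under eq_fun do rewrite big_cons; rewrite big_cons; case: (P i) => //.
by rewrite IntD ?IHs//; exact: nice_sum.
Qed.

Lemma ler_Int f g : nice f -> nice g -> (forall x, f x <= g x) -> Int f <= Int g.
Proof.
by move=> nf ng fg; apply: le_Rintegral => //; exact: nice_integrable.
Qed.

Lemma Int_ge0 f : (forall x, 0 <= f x) -> 0 <= Int f.
Proof. by move=> f0; exact: Rintegral_ge0. Qed.

Lemma ler_norm_Int f : nice f -> `|Int f| <= Int (fun x => `|f x|).
Proof. by move=> nf; apply: le_normr_Rintegral => //; exact: nice_integrable. Qed.

Lemma Int_ind (a b : R) : a <= b -> Int (cell a b) = b - a.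
Proof.
move=> ab; rewrite /Int /Rintegral.
under eq_integral.
  move=> x _; rewrite (_ : cell a b x = \1_(`[a, b[%classic : set R) x); last first.
    by rewrite /cell indicE mem_setE in_itv /=; case: ifP.
  over.
rewrite integral_indic//= setIT lebesgue_measure_itv/= lte_fin.
by case: ltgtP ab => //= -> _; rewrite subrr.
Qed.

(** The image measure under a translation gives half-open intervals their length, and Lebesgue
    measure is unique with that property. *)
Lemma lebesgue_measure_translate (s : R) (A : set R) : measurable A ->
  mu ((fun x => x + s) @^-1` A) = mu A.
Proof.
have ms : measurable_fun (setT : set (measurableTypeR R))
  ((fun x => x + s) : R -> measurableTypeR R) by exact: measurable_funD.
move=> mA; apply/esym.
apply: (lebesgue_measure_unique (mu := pushforward mu ((fun x => x + s) : R -> measurableTypeR R))) => //.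
move=> X [[a b]] _ <-; rewrite /pushforward.
transitivity (mu (`](a - s), (b - s)]%classic : set R)); last first.
  by congr (mu _); apply/seteqP; split=> x /=; rewrite !in_itv/= ltrBlDr lerBrDr.
rewrite !lebesgue_measure_itv /= !lte_fin ltrD2r -!EFinB.
by case: ifP => // _; congr (_%:E); ring.
Qed.

Lemma Int_shift f s : nice f -> Int (fun x => f (x + s)) = Int f.
Proof.
move=> nf; rewrite /Int /Rintegral; congr fine.
pose tr : R -> measurableTypeR R := fun x => x + s.
have ms : measurable_fun (setT : set (measurableTypeR R)) tr by exact: measurable_funD.
have [mf _ _] := nf.
transitivity (\int[pushforward mu tr]_y (f y)%:E)%E.
  rewrite integral_pushforward//; first exact/measurable_EFinP.
  exact: nice_integrable (nice_shift s nf).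
apply: eq_measure_integral => A mA _; exact: lebesgue_measure_translate.
Qed.

Lemma ler_Int_bound f M a b : nice f -> a <= b -> 0 <= M ->
  (forall x, f x <= M * cell a b x) -> Int f <= M * (b - a).
Proof.
move=> nf ab M0 fM; rewrite -Int_ind// -IntZ; last exact: nice_ind.
by apply: ler_Int => //; apply: niceZ; exact: nice_ind.
Qed.

End BoundedFunctions.

(** * Rank-one towers with arithmetic spacers *)

Section Towers.
Variable R : realType.
Implicit Types (F G : R -> R).

(* The tower of height [h] is cut into copies; copy [i] is pushed down by   *)
(* [offset q h i] since the copies above it carry 0, 1, ..., i-1 spacers.    *)
Definition offset (q h : R) (i : nat) : R := i%:R * h + q * 'C(i, 2)%:R.

Fixpoint height (rho : nat -> nat) (q h0 : R) (n : nat) : R :=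
  if n is m.+1 then offset q (height rho q h0 m) (rho m) else h0.

Definition copies (rho : nat -> nat) (n : nat) : R := \prod_(k < n) (rho k)%:R.

(** All that the decay argument needs from the staircase. [cuts_small] and [mass_bound] carry the
    finiteness of the area, [cuts_infty] the mixing of T, [incommensurable] the rational
    independence of the two roof heights. *)
Record tower := Tower {
  cuts : nat -> nat;
  spacer : R;
  base : R;
  mass : R;
  cuts_ge2 : forall n, (2 <= cuts n)%N;
  cuts_infty : forall m, exists n0, forall n, (n0 <= n)%N -> (m <= cuts n)%N;
  cuts_small : forall e, 0 < e ->
    exists n0, forall n, (n0 <= n)%N -> (cuts n)%:R <= e * height cuts spacer base n;
  spacer_gt0 : 0 < spacer;
  base_gt0 : 0 < base;
  mass_bound : forall n,
    height cuts spacer base n <= mass * copies cuts n;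
  incommensurable : forall (j : nat) (c : int), (0 < j)%N ->
    j%:R * base <> c%:~R * spacer }.

Variable X : tower.
Notation rho := (cuts X).
Notation q := (spacer X).
Definition th (n : nat) : R := height rho q (base X) n.
Definition td (n : nat) : R := copies rho n.
Notation H := th.
Notation D := td.
Definition bo (n i : nat) : R := offset q (H n) i.

(* [W a k F] copies a function living on tower [a] to all its copies inside  *)
(* tower [a + k].                                                            *)
Fixpoint W (a k : nat) F : R -> R :=
  if k is k'.+1 then
    fun y => \sum_(i < rho (a + k')) W a k' F (y + bo (a + k') i)
  else F.

Lemma H0E : H 0 = base X. Proof. by []. Qed.
Lemma HSE n : H n.+1 = bo n (rho n). Proof. by []. Qed.

Lemma boS n i : bo n i.+1 = bo n i + H n + q * i%:R.
Proof. by rewrite /bo /offset binS bin1 natrD -natr1; ring. Qed.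

Lemma bin2_add (i k : nat) : 'C(i + k, 2) = ('C(i, 2) + i * k + 'C(k, 2))%N.
Proof.
elim: k => [|k IHk]; first by rewrite addn0 muln0 !addn0.
by rewrite addnS !binS !bin1 IHk; lia.
Qed.

(** The mixed term [q * (k%:R * i%:R)] is the mechanism of mixing: the time needed to pass over [k]
    copies grows with the starting copy [i] by steps of [q * k]. *)
Lemma bo_add n i k :
  bo n (i + k) = bo n i + k%:R * H n + q * (k%:R * i%:R) + q * 'C(k, 2)%:R.
Proof. by rewrite /bo /offset bin2_add !natrD natrM; ring. Qed.

Lemma H_gt0 n : 0 < H n.
Proof.
elim: n => [|n IHn]; first exact: base_gt0.
rewrite HSE /bo /offset ltr_wpDr ?mulr_ge0 ?ler0n ?(ltW (spacer_gt0 X))//.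
by rewrite mulr_gt0// ltr0n (leq_trans _ (cuts_ge2 X n)).
Qed.

Lemma le_bo n i : i%:R * H n <= bo n i.
Proof. by rewrite /bo /offset lerDl mulr_ge0// ltW// spacer_gt0. Qed.

Lemma bo_ge0 n i : 0 <= bo n i.
Proof. by apply: le_trans (le_bo n i); rewrite mulr_ge0// ltW// H_gt0. Qed.

Lemma le_HS n : (rho n)%:R * H n <= H n.+1.
Proof. exact: le_bo. Qed.

Lemma HS_ge n : 2 * H n <= H n.+1.
Proof.
by apply: le_trans (le_HS n); rewrite ler_pM2r ?H_gt0// ler_nat cuts_ge2.
Qed.

Lemma H_le m n : (m <= n)%N -> H m <= H n.
Proof.
move=> /subnK <-; elim: (n - m)%N => //= k IHk.
by apply: le_trans IHk _; have := HS_ge (k + m); have := H_gt0 (k + m); lra.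
Qed.

Lemma DS n : D n.+1 = D n * (rho n)%:R.
Proof. by rewrite /td /copies big_ord_recr. Qed.

Lemma D0 : D 0 = 1. Proof. by rewrite /td /copies big_ord0. Qed.

Lemma rho_gt0 n : 0 < (rho n)%:R :> R.
Proof. by rewrite ltr0n (leq_trans _ (cuts_ge2 X n)). Qed.

Lemma D_gt0 n : 0 < D n.
Proof. by elim: n => [|n IHn]; rewrite ?D0 ?DS ?mulr_gt0 ?rho_gt0. Qed.

Lemma D_le_H n : D n * base X <= H n.
Proof.
elim: n => [|n IHn]; first by rewrite D0 mul1r.
rewrite DS mulrAC mulrC; apply: le_trans (le_HS n).
by rewrite ler_pM2l ?rho_gt0.
Qed.

Lemma H_mass n : H n <= mass X * D n.
Proof. exact: mass_bound. Qed.

Lemma mass_gt0 : 0 < mass X.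
Proof.
have := H_mass 0; rewrite D0 mulr1.
by apply: lt_le_trans; exact: H_gt0.
Qed.

Lemma eq_W a k F G : F =1 G -> W a k F =1 W a k G.
Proof. by move=> FG; elim: k => //= k IHk y; apply: eq_bigr => i _. Qed.

Lemma W_shift a k F s y : W a k (fun x => F (x + s)) y = W a k F (y + s).
Proof.
elim: k y => //= k IHk y; apply: eq_bigr => i _; rewrite IHk; congr W.
by rewrite addrAC.
Qed.

Lemma W_D a k F G y : W a k (fun x => F x + G x) y = W a k F y + W a k G y.
Proof.
elim: k y => //= k IHk y; rewrite -big_split/=; apply: eq_bigr => i _; exact: IHk.
Qed.

Lemma W_Z a k c F y : W a k (fun x => c * F x) y = c * W a k F y.
Proof. by elim: k y => //= k IHk y; rewrite mulr_sumr; apply: eq_bigr. Qed.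

Lemma W_sum (I : Type) (s : seq I) (P : pred I) a k (F : I -> R -> R) y :
  W a k (fun x => \sum_(i <- s | P i) F i x) y = \sum_(i <- s | P i) W a k (F i) y.
Proof.
elim: s => [|i s IHs].
  rewrite big_nil -[RHS](mul0r (W a k (fun=> 0) y)) -W_Z.
  by apply: eq_W => x; rewrite big_nil mul0r.
rewrite big_cons -IHs; case: ifP => Pi; rewrite -?W_D;
  by apply: eq_W => x; rewrite big_cons Pi.
Qed.

Lemma W_le a k F G : (forall x, F x <= G x) -> forall y, W a k F y <= W a k G y.
Proof. by move=> FG; elim: k => //= k IHk y; exact: ler_sum. Qed.

Lemma W_norm a k F y : `|W a k F y| <= W a k (fun x => `|F x|) y.
Proof.
elim: k y => //= k IHk y; apply: le_trans (ler_norm_sum _ _ _) _; exact: ler_sum.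
Qed.

Lemma W_comp a k l F y : W a (k + l) F y = W (a + k) l (W a k F) y.
Proof.
elim: l y => [|l IHl] y; first by rewrite addn0.
by rewrite addnS /= addnA; apply: eq_bigr => i _; exact: IHl.
Qed.

Lemma W0_cst n c y : W 0 n (fun=> c) y = c * D n.
Proof.
elim: n y => [|n IHn] y; first by rewrite D0 mulr1.
rewrite /= add0n (eq_bigr (fun=> c * D n)) => [|i _]; last exact: IHn.
by rewrite sumr_const card_ord DS mulrA mulr_natr.
Qed.

Lemma nice_W a k F : nice F -> nice (W a k F).
Proof.
move=> nF; elim: k => //= k IHk; apply: nice_sum => i; exact: nice_shift.
Qed.

Lemma cell_ge0 (u v x : R) : 0 <= cell u v x. Proof. by rewrite /cell; case: ifP. Qed.

Lemma sum_cell_le1 n N y :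
  \sum_(i < N) cell (- H n) 0 (y + bo n i) <= cell (- bo n N) 0 y.
Proof.
elim: N => [|N IHN]; first by rewrite big_ord0 cell_ge0.
rewrite big_ord_recr /=; apply: le_trans (lerD IHN (lexx _)) _.
have := H_gt0 n; have := bo_ge0 n N; have : 0 <= q * N%:R.
  by rewrite mulr_ge0// ltW// spacer_gt0.
rewrite /cell boS => ? ? ?.
have [h1|h1] := boolP (- bo n N <= y < 0); have [h2|h2] := boolP (- H n <= _ < 0).
- by exfalso; lra.
- by rewrite addr0 ifT//; lra.
- by rewrite add0r ifT//; lra.
- by rewrite addr0; case: ifP.
Qed.

Lemma W_cell_le a k y : W a k (cell (- H a) 0) y <= cell (- H (a + k)) 0 y.
Proof.
elim: k y => [|k IHk] y; first by rewrite addn0.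
rewrite addnS /= HSE; apply: le_trans (sum_cell_le1 _ _ _).
by apply: ler_sum => i _; exact: IHk.
Qed.

Lemma cell_le1 (u v x : R) : cell u v x <= 1.
Proof. by rewrite /cell; case: ifP. Qed.

(** The copies of a tower are disjoint, so copying a function supported on it does not increase its
    supremum. *)
Lemma W_bounded a k F M : (forall x, `|F x| <= M * cell (- H a) 0 x) ->
  0 <= M -> forall y, `|W a k F y| <= M * cell (- H (a + k)) 0 y.
Proof.
move=> FM M0 y; apply: le_trans (W_norm _ _ _ _) _.
apply: le_trans (W_le _ _ FM _) _; rewrite W_Z ler_wpM2l//; exact: W_cell_le.
Qed.

(* Distinct copies of tower [a] are at distance at least [H a].              *)
Lemma W_cell_count a k u v y : u <= v -> W a k (cell u v) y <= (v - u) / H a + 1.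
Proof.
move=> uv; have Ha := H_gt0 a.
pose m := (Num.truncn ((v - u) / H a)).+1.
have vum : v - u < m%:R * H a.
  by rewrite -ltr_pdivrMr// /m truncnS_gt.
have mle : m%:R <= (v - u) / H a + 1.
  by rewrite /m -natr1 lerD2r truncn_le// divr_ge0 ?subr_ge0// ltW.
apply: le_trans mle.
have : forall x, cell u v x <= \sum_(j < m) cell (- H a) 0 (x + (- u - j.+1%:R * H a)).
  move=> x; rewrite {1}/cell; case: ifPn => [/andP[ux xv]|_]; last first.
    by apply: sumr_ge0 => j _; exact: cell_ge0.
  have xu0 : 0 <= (x - u) / H a by rewrite divr_ge0 ?subr_ge0// ltW.
  have jm : (Num.truncn ((x - u) / H a) < m)%N.
    by rewrite ltnS le_truncn// ler_pM2r ?invr_gt0// lerD2r ltW.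
  rewrite (bigD1 (Ordinal jm))//= {1}/cell ifT.
    by rewrite lerDl; apply: sumr_ge0 => j _; exact: cell_ge0.
  have := truncn_itv xu0; rewrite -natr1 lter_pdivlMr// lter_pdivrMr//.
  by move=> /andP[]; lra.
move=> /(W_le a k)/(_ y)/le_trans; apply; rewrite W_sum.
rewrite -[leRHS]/(m%:R); apply: (@le_trans _ _ (\sum_(j < m) 1)).
  apply: ler_sum => j _; rewrite W_shift.
  exact: le_trans (W_cell_le _ _ _) (cell_le1 _ _ _).
by rewrite sumr_const card_ord.
Qed.

End Towers.

(** * Uniform distribution of the copies modulo multiples of the spacer *)

Section Trigonometry.
Variable R : realType.
Implicit Types x u t : R.

Lemma cos_sin1 u : cos u = 1 -> sin u = 0.
Proof. by move=> cu; apply: cos1sin0; rewrite cu normr1. Qed.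

Lemma cos_periodN u x n : cos u = 1 -> cos (x + n%:R * u) = cos x.
Proof.
move=> cu; have su := cos_sin1 cu; elim: n => [|n IHn].
  by rewrite mul0r addr0.
by rewrite -natr1 mulrDl mul1r addrA cosD cu su mulr1 mulr0 subr0.
Qed.

Lemma sin_periodN u x n : cos u = 1 -> sin (x + n%:R * u) = sin x.
Proof.
move=> cu; have su := cos_sin1 cu; elim: n => [|n IHn].
  by rewrite mul0r addr0.
by rewrite -natr1 mulrDl mul1r addrA sinD cu su mulr1 mulr0 addr0.
Qed.

Lemma cos_2pi : cos (2 * pi) = 1 :> R.
Proof. by rewrite mulr_natl cos2pi. Qed.

Lemma cos_period2pi x (c : int) : cos (x + c%:~R * (2 * pi)) = cos x.
Proof.
case: c => n; first by rewrite -pmulrn cos_periodN// cos_2pi.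
rewrite -[in RHS](subrK (n.+1%:R * (2 * pi)) x) cos_periodN ?cos_2pi//.
by congr cos; rewrite NegzE mulrNz mulNr.
Qed.

Lemma cos_eq1 x : cos x = 1 -> exists c : int, x = c%:~R * (2 * pi).
Proof.
move=> cx1; have p0 := @pi_gt0 R; have pp : 0 < 2 * pi :> R by lra.
exists (Num.floor (x / (2 * pi))); set c := Num.floor _.
have := floor_itv (x / (2 * pi)); rewrite -/c intrD1 => /andP[].
rewrite ler_pdivlMr// ltr_pdivrMr// => h1 h2.
have : cos (x - c%:~R * (2 * pi)) = 1.
  by rewrite -mulNr -mulrNz cos_period2pi.
set y := x - _ => cy; suff y_eq0 : y = 0 by apply/eqP; rewrite -subr_eq0 -/y y_eq0.
have y0 : 0 <= y by rewrite /y; lra.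
have y2 : y < 2 * pi by rewrite /y; lra.
have [yp|yp] := lerP y pi.
  by apply: (@cos_inj R); rewrite ?in_itv/= ?y0 ?yp ?lexx ?cos0//; lra.
suff : 2 * pi - y = 0 by lra.
apply: (@cos_inj R); rewrite ?in_itv/= ?cos0 ?lexx; [apply/andP; lra|lra|].
by rewrite -cosN -[RHS]cy -(cos_period2pi y (- 1)) mulrN1z; congr cos; ring.
Qed.

Lemma cos_dist (d x : R) : 0 < d -> d <= x -> x <= 2 * pi - d -> cos x <= cos d.
Proof.
move=> d0 dx xd; have p0 := @pi_gt0 R.
have le a : d <= a -> a <= pi -> cos a <= cos d.
  move=> da ap; have [->//|dna] := eqVneq d a.
  by apply/ltW; rewrite ltr_cos ?in_itv/= ?lt_neqAle ?dna//; lra.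
have [xp|xp] := lerP x pi; first exact: le.
rewrite (_ : cos x = cos (2 * pi - x)); first by apply: le; lra.
by rewrite -cosN -[LHS](cos_period2pi _ 1) mulr1z; congr cos; ring.
Qed.

(** The geometric sum of e^{ijx} in real form: [2 - 2 * cos x] is the squared modulus of 1 -
    e^{ix}. *)
Lemma geometric_cos x n :
  ((\sum_(i < n) cos (i%:R * x)) ^+ 2 + (\sum_(i < n) sin (i%:R * x)) ^+ 2) *
    (2 - 2 * cos x) = 2 - 2 * cos (n%:R * x).
Proof.
set C := \sum_(i < n) cos _; set S := \sum_(i < n) sin _.
(* Real and imaginary parts of (1 - e^{ix}) times the sum, which telescopes to 1 - e^{inx}. *)
have [hC hS] : (1 - cos x) * C + sin x * S = 1 - cos (n%:R * x) /\
               (1 - cos x) * S - sin x * C = - sin (n%:R * x).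
  rewrite {}/C {}/S; elim: n => [|n [IHC IHS]].
    by rewrite !big_ord0 mul0r cos0 sin0; split; ring.
  have -> : n.+1%:R * x = n%:R * x + x by rewrite -natr1; ring.
  by rewrite !big_ord_recr/= cosD sinD; split; lra.
have t1 := cos2Dsin2 x; have t2 := cos2Dsin2 (n%:R * x).
have -> : 2 - 2 * cos x = (1 - cos x) ^+ 2 + sin x ^+ 2 by lra.
have -> : 2 - 2 * cos (n%:R * x) = (1 - cos (n%:R * x)) ^+ 2 + (- sin (n%:R * x)) ^+ 2.
  by rewrite sqrrN; lra.
by rewrite -hC -hS; ring.
Qed.

Lemma norm2_sum_cos n (x : 'I_n -> R) :
  (\sum_i cos (x i)) ^+ 2 + (\sum_i sin (x i)) ^+ 2 =
  \sum_i \sum_j cos (x i - x j).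
Proof.
rewrite !expr2 !big_distrlr/= -big_split/=; apply: eq_bigr => i _.
by rewrite -big_split/=; apply: eq_bigr => j _; rewrite cosB.
Qed.

Lemma sqr_sum_le n (a : 'I_n -> R) : (\sum_i a i) ^+ 2 <= n%:R * \sum_i a i ^+ 2.
Proof.
case: n a => [|n] a; first by rewrite !big_ord0 expr0n mulr0.
set S := \sum_i a i; set Q := \sum_i a i ^+ 2; pose m := S / n.+1%:R.
have : 0 <= \sum_i (a i - m) ^+ 2 by apply: sumr_ge0 => i _; exact: sqr_ge0.
have -> : \sum_i (a i - m) ^+ 2 = Q - 2 * m * S + n.+1%:R * m ^+ 2.
  have <- : \sum_(i < n.+1) m ^+ 2 = n.+1%:R * m ^+ 2.
    by rewrite sumr_const card_ord mulr_natl.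
  rewrite /Q /S mulr_sumr -sumrB -big_split/=.
  by apply: eq_bigr => i _; ring.
have n0 : n.+1%:R != 0 :> R by rewrite pnatr_eq0.
rewrite (_ : _ + _ = Q - S ^+ 2 / n.+1%:R); last by rewrite /m; field.
by rewrite subr_ge0 ler_pdivrMr ?ltr0n// mulrC.
Qed.

(* Van der Corput with a single shift: a phase whose increments are an       *)
(* arithmetic progression of step [u], [cos u <> 1], cannot stay aligned.    *)
Lemma norm2_sum_increments n (x : nat -> R) (phi u : R) :
  cos u != 1 -> (forall i, x i.+1 - x i = phi + i%:R * u) ->
  4 * ((\sum_(i < n) cos (x i)) ^+ 2 + (\sum_(i < n) sin (x i)) ^+ 2) <=
    5/2 * n%:R ^+ 2 + n%:R * (5/2 + 10 / (2 - 2 * cos u)) + 40.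
Proof.
move=> cu dx; set P := \sum_(i < n) cos _; set Q := \sum_(i < n) sin _.
have cu1 := cos_le1 u; have du : 0 < 2 - 2 * cos u.
  by move: cu; rewrite neq_lt => /orP[]; lra.
(* [U] and [V] are the two coordinates of the sum of e^{i x_k} + e^{i x_{k+1}}, which is twice the
   original sum up to two boundary terms. *)
pose U := \sum_(i < n) (cos (x i) + cos (x i.+1)).
pose V := \sum_(i < n) (sin (x i) + sin (x i.+1)).
have tele (f : nat -> R) k : \sum_(i < k) f i.+1 = \sum_(i < k) f i + (f k - f 0).
  elim: k => [|m IHm]; first by rewrite !big_ord0; ring.
  by rewrite !big_ord_recr/= IHm; ring.
have UE : U = 2 * P + (cos (x n) - cos (x 0)).
  by rewrite /U big_split/= (tele (fun i => cos (x i))) -/P; ring.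
have VE : V = 2 * Q + (sin (x n) - sin (x 0)).
  by rewrite /V big_split/= (tele (fun i => sin (x i))) -/Q; ring.
(* Each pair of neighbours has squared modulus 2 + 2 cos of the increment. The increments being in
   progression, [T] is the projection of a geometric sum of ratio e^{iu}, hence bounded. *)
pose T := \sum_(i < n) cos (x i.+1 - x i).
have UVT : U ^+ 2 + V ^+ 2 <= n%:R * (2 * n%:R + 2 * T).
  apply: le_trans (lerD (sqr_sum_le _) (sqr_sum_le _)) _.
  have -> : 2 * n%:R = \sum_(i < n) 2 :> R by rewrite sumr_const card_ord mulr_natr.
  rewrite -mulrDr ler_wpM2l// /T mulr_sumr -!big_split/=; apply: ler_sum => i _.
  rewrite cosB; have := cos2Dsin2 (x i); have := cos2Dsin2 (x i.+1); nra.
have TT : T ^+ 2 <= 4 / (2 - 2 * cos u).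
  rewrite ler_pdivlMr//.
  pose C := \sum_(i < n) cos (i%:R * u); pose S := \sum_(i < n) sin (i%:R * u).
  have TE : T = cos phi * C - sin phi * S.
    rewrite /T /C /S !mulr_sumr -sumrB; apply: eq_bigr => i _.
    by rewrite dx cosD.
  have := geometric_cos u n; rewrite -/C -/S.
  have : T ^+ 2 <= C ^+ 2 + S ^+ 2.
    rewrite TE -[leRHS]mul1r -(cos2Dsin2 phi) -subr_ge0.
    rewrite (_ : _ - _ = (sin phi * C + cos phi * S) ^+ 2); first exact: sqr_ge0.
    by ring.
  move=> h1 h2; apply: le_trans (_ : _ <= (C ^+ 2 + S ^+ 2) * (2 - 2 * cos u)) _.
    by rewrite ler_pM2r.
  by rewrite h2; have := cos_geN1 (n%:R * u); lra.
have TT' : 2 * T <= 1 + 4 / (2 - 2 * cos u).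
  by apply: le_trans (lerD (lexx _) TT); have := sqr_ge0 (T - 1); lra.
have e1 : (cos (x n) - cos (x 0)) ^+ 2 <= 4.
  by have := cos_le1 (x n); have := cos_le1 (x 0); have := cos_geN1 (x n);
     have := cos_geN1 (x 0); nra.
have e2 : (sin (x n) - sin (x 0)) ^+ 2 <= 4.
  by have := sin_le1 (x n); have := sin_le1 (x 0); have := sin_geN1 (x n);
     have := sin_geN1 (x 0); nra.
(* From (a - c)^2 <= 5/4 a^2 + 5 c^2. The weight 5/4 makes the leading coefficient 5/2 < 3, which is
   what yields the factor 3/4 at non-resonant frequencies. *)
have sq (a b c : R) : a = 2 * b + c -> c ^+ 2 <= 4 -> 4 * b ^+ 2 <= 5/4 * a ^+ 2 + 20.
  by move=> -> c4; have := sqr_ge0 (b + 5/2 * c); nra.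
have h1 := sq _ _ _ UE e1; have h2 := sq _ _ _ VE e2.
have n0 : 0 <= n%:R :> R by [].
apply: le_trans (_ : _ <= 5/4 * (U ^+ 2 + V ^+ 2) + 40) _; first lra.
rewrite lerD2r; apply: le_trans (_ : _ <= 5/4 * (n%:R * (2 * n%:R + 2 * T))) _.
  by lra.
apply: le_trans (_ : _ <= 5/4 * (n%:R * (2 * n%:R + (1 + 4 / (2 - 2 * cos u))))) _.
  by rewrite ler_pM2l// ler_wpM2l// lerD2l.
have : 0 <= 4 / (2 - 2 * cos u) by rewrite divr_ge0// ltW.
rewrite (_ : 10 / _ = 5/2 * (4 / (2 - 2 * cos u))); last by field; lra.
by set z := 4 / _ => z0; nra.
Qed.

Lemma expr34_small (e : R) : 0 < e -> exists m, (3/4) ^+ m <= e.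
Proof.
move=> e0; have h m : (3/4) ^+ m <= 3 / (m%:R + 3) :> R.
  elim: m => [|m IHm]; first by rewrite expr0 add0r divff.
  rewrite exprS; have m0 : 0 <= m%:R :> R by [].
  apply: le_trans (_ : _ <= 3/4 * (3 / (m%:R + 3))) _; first by rewrite ler_pM2l//; lra.
  rewrite -natr1 ler_pdivlMr; last lra.
  by rewrite mulrA mulrAC ler_pdivrMr; lra.
exists (Num.truncn (3 / e)).+1; apply: le_trans (h _) _.
have := truncnS_gt (3 / e); rewrite ltr_pdivrMr// => h3.
by rewrite ler_pdivrMr ?ltr_wpDl//; nra.
Qed.

End Trigonometry.

(** * Exponential sums over the copies of a tower *)

Section FourierDecay.
Variables (R : realType) (X : tower R).
Notation rho := (cuts X).
Notation q := (spacer X).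
Notation H := (th X).
Notation D := (td X).

(** Squared modulus of the exponential sum of the offsets at frequency [w]: the factor contributed
    by stage [n] to the squared amplitude of a copied wave. *)
Definition spread (w : R) (n : nat) : R :=
  (\sum_(i < rho n) cos (w * bo X n i)) ^+ 2 +
  (\sum_(i < rho n) sin (w * bo X n i)) ^+ 2.

Lemma spread_ge0 w n : 0 <= spread w n.
Proof. by rewrite /spread addr_ge0// sqr_ge0. Qed.

Lemma spread_le w n : spread w n <= (rho n)%:R ^+ 2.
Proof.
rewrite /spread norm2_sum_cos; apply: (@le_trans _ _ (\sum_(i < rho n) \sum_(j < rho n) 1)).
  by apply: ler_sum => i _; apply: ler_sum => j _; exact: cos_le1.
by rewrite !(sumr_const, card_ord) expr2 mulr_natr.
Qed.

(** Copying multiplies the wave e^{iwx} by one complex number, the product over the stages of their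
    exponential sums; [A] and [B] are its coordinates. *)
Lemma W_cos w n : exists A B, A ^+ 2 + B ^+ 2 = \prod_(k < n) spread w k /\
  forall y phi, W X 0 n (fun x => cos (w * x + phi)) y =
    A * cos (w * y + phi) + B * sin (w * y + phi).
Proof.
elim: n => [|n [A [B [AB WE]]]].
  exists 1, 0; rewrite big_ord0; split; first by rewrite expr0n/= addr0 expr1n.
  by move=> y phi /=; rewrite mul0r addr0 mul1r.
pose C := \sum_(i < rho n) cos (w * bo X n i).
pose S := \sum_(i < rho n) sin (w * bo X n i).
exists (A * C + B * S), (B * C - A * S); split.
  by rewrite big_ord_recr/= -AB /spread -/C -/S; ring.
move=> y phi /=; rewrite add0n.
transitivity (\sum_(i < rho n)
   ((A * cos (w * y + phi) + B * sin (w * y + phi)) * cos (w * bo X n i) +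
    (B * cos (w * y + phi) - A * sin (w * y + phi)) * sin (w * bo X n i))).
  apply: eq_bigr => i _; rewrite WE.
  rewrite (_ : w * (y + _) + phi = (w * y + phi) + w * bo X n i); last by ring.
  by rewrite (cosD (w * y + phi)) (sinD (w * y + phi)); ring.
by rewrite big_split/= -!mulr_sumr -/C -/S; ring.
Qed.

Lemma W_cos_le w n y phi :
  (W X 0 n (fun x => cos (w * x + phi)) y) ^+ 2 <= \prod_(k < n) spread w k.
Proof.
have [A [B [<- ->]]] := W_cos w n.
rewrite -[leRHS]mulr1 -(cos2Dsin2 (w * y + phi)) -subr_ge0.
rewrite (_ : _ - _ = (A * sin (w * y + phi) - B * cos (w * y + phi)) ^+ 2).
  exact: sqr_ge0.
by ring.
Qed.

(** At resonance the spacers do not change the phase: the sum at stage k is geometric in w H_k and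
    H_{k+1} has the phase of r_k H_k. Each quotient thus cancels with the next one. *)
Lemma prod_spread_resonant w n : cos (w * q) = 1 ->
  \prod_(k < n) spread w k * (2 - 2 * cos (w * H 0)) = 2 - 2 * cos (w * H n).
Proof.
move=> cq; have boE k i : w * bo X k i = i%:R * (w * H k) + 'C(i, 2)%:R * (w * q).
  by rewrite /bo /offset; set c := 'C(i, 2)%:R; ring.
elim: n => [|n IHn]; first by rewrite big_ord0 mul1r.
rewrite big_ord_recr/= mulrAC IHn mulrC.
rewrite -[w * H n.+1]/(w * bo X n (rho n)) boE cos_periodN// -geometric_cos.
congr (_ * _); rewrite /spread; congr (_ ^+ 2 + _ ^+ 2); apply: eq_bigr => i _.
  by rewrite boE cos_periodN.
by rewrite boE sin_periodN.
Qed.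

Lemma td_ge n : n.+1%:R <= D n.
Proof.
elim: n => [|n IHn]; first by rewrite D0.
have : 2 <= (rho n)%:R :> R by rewrite ler_nat cuts_ge2.
have n0 : 0 <= n%:R :> R by [].
rewrite DS; move: IHn; rewrite -!natr1; nra.
Qed.

(** The phases of consecutive offsets differ by an arithmetic progression of step [w * q]. For many
    cuts the lower-order terms fit between the proportion 5/8 and 3/4. *)
Lemma spread_nonresonant w : cos (w * q) != 1 ->
  exists n0, forall n, (n0 <= n)%N -> spread w n <= 3/4 * (rho n)%:R ^+ 2.
Proof.
move=> cq; set K := 5/2 + 10 / (2 - 2 * cos (w * q)).
have [n0 hn0] := cuts_infty X (Num.truncn (2 * K + 80)).+1.
exists n0 => n /hn0 Kn.
have rK : 2 * K + 80 <= (rho n)%:R.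
  by apply: ltW; apply: lt_le_trans (truncnS_gt _) _; rewrite ler_nat.
have dx i : w * bo X n i.+1 - w * bo X n i = w * H n + i%:R * (w * q).
  by rewrite boS; ring.
have := norm2_sum_increments (rho n) cq dx; rewrite -/(spread w n) -/K.
have : 1 <= (rho n)%:R :> R by rewrite ler1n (leq_trans _ (cuts_ge2 X n)).
set r := (rho n)%:R in rK *; set s := spread w n; move=> r1.
nra.
Qed.

(** These are the nontrivial frequencies of the circle of length [q * d]. Without resonance the late
    factors 3/4 accumulate; at resonance the product stays bounded while [D n] tends to infinity. *)
Lemma fourier_decay (d j : nat) e : (0 < d)%N -> (0 < j)%N -> 0 < e ->
  exists n0, forall n, (n0 <= n)%N -> forall y phi,
    `|W X 0 n (fun x => cos (2 * pi * j%:R / (q * d%:R) * x + phi)) y| <= e * D n.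
Proof.
move=> d0 j0 e0; set w := 2 * pi * j%:R / (q * d%:R).
suff [n0 hn0] : exists n0, forall n, (n0 <= n)%N ->
    \prod_(k < n) spread w k <= (e * D n) ^+ 2.
  exists n0 => n /hn0 h y phi; rewrite -ler_sqr ?nnegrE ?mulr_ge0 ?(ltW e0)//.
    by rewrite real_normK ?num_real//; apply: le_trans (W_cos_le _ _ _ _) h.
  exact: ltW (D_gt0 X n).
have [cq|cq] := eqVneq (cos (w * q)) 1; last first.
  have [n1 hn1] := spread_nonresonant cq.
  have e2 : 0 < e ^+ 2 by rewrite exprn_gt0.
  have [m hm] := expr34_small e2.
  exists (n1 + m)%N => n; rewrite -{1}(subnKC (leq_addr m n1)) => nn.
  have -> : n = (n1 + (n - n1))%N by rewrite subnKC// (leq_trans _ nn)// leq_addr.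
  set l := (n - n1)%N; have ml : (m <= l)%N by rewrite /l; lia.
  have : \prod_(k < n1 + l) spread w k <= (3/4) ^+ l * D (n1 + l) ^+ 2.
    elim: l {ml} => [|l IHl].
      rewrite addn0 expr0 mul1r; elim: n1 {hn1 nn} => [|k IHk].
        by rewrite big_ord0 D0 expr1n.
      rewrite big_ord_recr/= DS exprMn ler_pM ?spread_le ?spread_ge0//.
      by apply: prodr_ge0 => i _; exact: spread_ge0.
    rewrite addnS big_ord_recr/= DS (exprMn _ (D _)) exprSr mulrACA ler_pM//.
    - by apply: prodr_ge0 => i _; exact: spread_ge0.
    - exact: spread_ge0.
    - by apply: hn1; rewrite leq_addr.
  move=> /le_trans; apply; rewrite (exprMn _ e) ler_wpM2r ?sqr_ge0//.
  apply: le_trans hm; rewrite -(subnK ml) exprD -[leRHS]mul1r ler_wpM2r//.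
  by rewrite exprn_ile1//; lra.
(* Otherwise [j] times the base height would equal an integer multiple of [q * d], against
   incommensurability. *)
have cH : cos (w * H 0) != 1.
  apply/eqP => /cos_eq1[c]; rewrite /w => hc.
  have q0 := spacer_gt0 X; have p0 := @pi_gt0 R.
  have dR : 0 < d%:R :> R by rewrite ltr0n.
  apply: (@incommensurable _ X j (c * d%:Z) j0); rewrite intrM -pmulrn.
  have : 2 * pi * (j%:R * base X - c%:~R * d%:R * q) = 0.
    have : (2 * pi * j%:R / (q * d%:R) * H 0) * (q * d%:R) = c%:~R * (2 * pi) * (q * d%:R).
      by rewrite hc.
    rewrite H0E (_ : _ * _ * (q * _) = 2 * pi * j%:R * base X); last first.
      by field; rewrite !gt_eqF.
    move=> h; apply: etrans (_ : 2 * pi * j%:R * base X - c%:~R * (2 * pi) * (q * d%:R) = 0).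
      by ring.
    by rewrite h subrr.
  move/eqP; rewrite !mulf_eq0 pnatr_eq0/= (gt_eqF p0)/= subr_eq0 => /eqP.
  by [].
have dl : 0 < 2 - 2 * cos (w * H 0).
  by have := cos_le1 (w * H 0); move: cH; rewrite neq_lt => /orP[]; lra.
set dlt := 2 - _ in dl; pose K := 4 / dlt / e ^+ 2.
exists (Num.truncn K) => n nK.
have KD : K <= D n.
  apply: le_trans (td_ge n); apply: ltW; apply: lt_le_trans (truncnS_gt _) _.
  by rewrite ler_nat.
have D1 : 1 <= D n by apply: le_trans (td_ge n); rewrite ler1n.
have := prod_spread_resonant n cq; rewrite -/dlt => hp.
have hp4 : \prod_(k < n) spread w k <= 4 / dlt.
  by rewrite ler_pdivlMr// hp; have := cos_geN1 (w * H n); lra.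
apply: le_trans hp4 _; rewrite exprMn.
rewrite (_ : 4 / dlt = e ^+ 2 * K); last by rewrite /K; field; rewrite !gt_eqF.
rewrite ler_pM2l ?exprn_gt0//; apply: le_trans KD _; rewrite expr2.
by rewrite ler_peMr// ltW// D_gt0.
Qed.

End FourierDecay.

(** * Fejér kernels as periodic majorants of intervals *)

Section FejerKernel.
Variable R : realType.
Implicit Types u v x : R.

(** The Fejér kernel scaled to have value 1 at 0 (for [m] positive), so that its translates by
    multiples of 2 pi / m form a partition of unity. *)
Definition fejer (m : nat) u : R :=
  ((\sum_(j < m) cos (j%:R * u)) ^+ 2 + (\sum_(j < m) sin (j%:R * u)) ^+ 2)
  / m%:R ^+ 2.

Lemma fejer_ge0 m u : 0 <= fejer m u.
Proof. by rewrite /fejer divr_ge0 ?sqr_ge0// addr_ge0// sqr_ge0. Qed.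

Lemma fejerE m u : fejer m u =
  (\sum_(j < m) \sum_(k < m) cos ((j%:R - k%:R) * u)) / m%:R ^+ 2.
Proof.
rewrite /fejer norm2_sum_cos; congr (_ / _).
by apply: eq_bigr => j _; apply: eq_bigr => k _; rewrite mulrBl.
Qed.

Lemma fejer_tail m u : fejer m u * (2 - 2 * cos u) <= 4 / m%:R ^+ 2.
Proof.
rewrite /fejer mulrAC ler_wpM2r ?invr_ge0 ?sqr_ge0// geometric_cos.
by have := cos_geN1 (m%:R * u); lra.
Qed.

Lemma sum_cos_progression m A v : cos v != 1 -> cos (m%:R * v) = 1 ->
  \sum_(c < m) cos (A + c%:R * v) = 0.
Proof.
move=> cv cmv; have := geometric_cos v m; rewrite cmv.
set C := \sum_(i < m) _; set S := \sum_(i < m) _ => h.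
have : C ^+ 2 + S ^+ 2 = 0.
  apply/eqP; move/eqP: h; rewrite mulr1 subrr mulf_eq0 => /orP[//|].
  by move=> h; exfalso; move/eqP: cv; apply; move/eqP: h; lra.
move=> /eqP; rewrite paddr_eq0 ?sqr_ge0// !sqrf_eq0 => /andP[/eqP C0 /eqP S0].
transitivity (cos A * C - sin A * S); last by rewrite C0 S0; ring.
by rewrite /C /S !mulr_sumr -sumrB; apply: eq_bigr => i _; rewrite cosD.
Qed.

Lemma cos_fraction_neq1 (m j k : nat) : (j < m)%N -> (k < m)%N -> j != k ->
  cos (- ((j%:R - k%:R) * (2 * pi / m%:R))) != 1 :> R.
Proof.
move=> jm km jk; rewrite cosN; apply/eqP => /cos_eq1[c].
have m0 : 0 < m%:R :> R by rewrite ltr0n (leq_ltn_trans _ jm).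
have p0 := @pi_gt0 R.
move=> h; have : j%:R - k%:R = c%:~R * m%:R :> R.
  apply: (@mulIf _ (2 * pi / m%:R)); first by rewrite gt_eqF// divr_gt0//; lra.
  by rewrite h; field; rewrite gt_eqF.
rewrite !pmulrn -intrM -intrB => /intr_inj; clear h; move: jm km jk; clear.
move=> jm km jk h; have /eqP := jk; case: c h => [[|c]|c]; nia.
Qed.

(** Off the diagonal, the sum over the translates runs over a complete set of powers of a root of
    unity other than 1 and vanishes. *)
Lemma sum_fejer m u : (0 < m)%N ->
  \sum_(c < m) fejer m (u - c%:R * (2 * pi / m%:R)) = 1.
Proof.
move=> m0; have mR : m%:R != 0 :> R by rewrite pnatr_eq0 -lt0n.
under eq_bigr do rewrite fejerE; rewrite -mulr_suml exchange_big/=.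
under eq_bigr => j _ do rewrite exchange_big/=.
rewrite (eq_bigr (fun=> m%:R)) => [|j _]; last first.
  rewrite (bigD1 j)//= [X in _ + X]big1 ?addr0 => [|k kj].
    rewrite (eq_bigr (fun=> 1)) ?sumr_const ?card_ord// => c _.
    by rewrite subrr mul0r cos0.
  under eq_bigr do rewrite mulrBr.
  rewrite (eq_bigr (fun c : 'I_m => cos ((j%:R - k%:R) * u +
      c%:R * - ((j%:R - k%:R) * (2 * pi / m%:R))))) => [|c _]; last by congr cos; ring.
  rewrite sum_cos_progression//; first by rewrite cos_fraction_neq1// eq_sym.
  rewrite (_ : _ * _ = 0 + (k%:Z - j%:Z)%:~R * (2 * pi)).
    by rewrite cos_period2pi cos0.
  by rewrite intrB -!pmulrn; field.
by rewrite sumr_const card_ord -[_ *+ _]mulr_natr -expr2 divff// sqrf_eq0.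
Qed.

Lemma count_le m (z : R) : 0 <= z -> \sum_(i < m | i%:R <= z) 1 <= z + 1.
Proof.
move=> z0; elim: m => [|m IHm]; first by rewrite big_ord0; lra.
rewrite big_mkcond big_ord_recr/= -big_mkcond/=; case: ifPn => [mz|_].
  rewrite lerD2r; apply: le_trans mz; rewrite big_mkcond/=.
  rewrite -[m%:R]/(m%:R : R) -[X in _ <= X%:R]card_ord -sumr_const.
  by apply: ler_sum => i _; case: ifP.
by rewrite addr0.
Qed.

(** Of the partition of unity by [m] kernels on the circle of length [La], only those centred in the
    interval enlarged by [de] on both sides are kept. At a point of the interval each discarded one
    is small by the tail estimate, whence the additive constant. *)
Lemma fejer_majorant (m : nat) (al be de La x : R) :
  (0 < m)%N -> 0 < de -> de <= La / 4 -> be - al <= La ->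
  cell al be x <=
    \sum_(i < m | i%:R <= m%:R * ((be - al + 2 * de) / La))
       fejer m (2 * pi * (x - (al - de + i%:R * (La / m%:R))) / La) +
    4 / (m%:R * (2 - 2 * cos (2 * pi * de / La))).
Proof.
move=> m0 de0 deL abL; have p0 := @pi_gt0 R.
have La0 : 0 < La by lra.
have mR : 0 < m%:R :> R by rewrite ltr0n.
set d := 2 * pi * de / La; set eta := 2 - 2 * cos d.
have dE : d * La = 2 * pi * de by rewrite /d; field; rewrite gt_eqF.
have d0 : 0 < d by rewrite /d divr_gt0// mulr_gt0//; lra.
have dpi : d < pi by rewrite /d ltr_pdivrMr//; nra.
have eta0 : 0 < eta.
  suff : cos d < 1 by rewrite /eta; lra.
  by rewrite -cos0 ltr_cos// in_itv/= ?lexx ltW//= ltW.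
have P0 : 0 <= \sum_(i < m | i%:R <= m%:R * ((be - al + 2 * de) / La))
       fejer m (2 * pi * (x - (al - de + i%:R * (La / m%:R))) / La).
  by apply: sumr_ge0 => i _; exact: fejer_ge0.
have e0 : 0 <= 4 / (m%:R * eta) by rewrite divr_ge0// mulr_ge0// ltW.
rewrite /cell; case: ifPn => [/andP[ax xb]|_]; last exact: addr_ge0.
rewrite -[leLHS](sum_fejer (2 * pi * (x - (al - de)) / La) m0).
rewrite (bigID (fun i : 'I_m => i%:R <= m%:R * ((be - al + 2 * de) / La)))/=.
apply: lerD.
  apply: ler_sum => i _; rewrite le_eqVlt; apply/orP; left; apply/eqP.
  by congr fejer; field; rewrite !gt_eqF.
apply: (@le_trans _ _ (\sum_(i < m) (4 / m%:R ^+ 2 / eta))); last first.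
  rewrite sumr_const card_ord -[leLHS]mulr_natr le_eqVlt; apply/orP; left; apply/eqP.
  by field; rewrite !gt_eqF.
rewrite big_mkcond/=; apply: ler_sum => i _; case: ifPn => [|_]; last first.
  by rewrite divr_ge0 ?divr_ge0 ?sqr_ge0// ltW.
rewrite -ltNge => hi; rewrite ler_pdivlMr//; set u := 2 * pi * _ / La - _.
apply: le_trans (fejer_tail m u).
rewrite ler_wpM2l ?fejer_ge0// /eta lerD2l lerN2 ler_pM2l//.
have im : i%:R < m%:R :> R by rewrite ltr_nat.
rewrite -(cosN u).
have uE : - u * (La * m%:R) = 2 * pi * (i%:R * La - m%:R * (x - al + de)).
  by rewrite /u; field; rewrite !gt_eqF.
have hi' : m%:R * (be - al + 2 * de) < i%:R * La.
  by move: hi; rewrite mulrA ltr_pdivrMr.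
have Lm : 0 < La * m%:R by rewrite mulr_gt0.
(* A discarded centre is at distance at least [de] from [x] on both sides of the circle. *)
apply: cos_dist => //.
  rewrite -(ler_pM2r Lm) uE mulrA dE -!mulrA ler_pM2l// ler_pM2l//.
  have : m%:R * (x - al) <= m%:R * (be - al) by rewrite ler_pM2l//; lra.
  by lra.
have dE' : (2 * pi - d) * (La * m%:R) = 2 * pi * (m%:R * La - de * m%:R).
  by rewrite mulrBl [d * (_ * _)]mulrA dE; ring.
rewrite -(ler_pM2r Lm) uE dE'.
rewrite ler_pM2l; last lra.
have : i%:R * La <= m%:R * La by rewrite ler_pM2r// ltW.
have : 0 <= m%:R * (x - al) by rewrite mulr_ge0//; lra.
by lra.
Qed.

End FejerKernel.

(** * Uniform distribution along progressions *)

Section Equidistribution.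
Variables (R : realType) (X : tower R).
Notation rho := (cuts X).
Notation q := (spacer X).
Notation H := (th X).
Notation D := (td X).

Lemma fourier_decay_upto (d m : nat) e : (0 < d)%N -> 0 < e ->
  exists n0, forall n, (n0 <= n)%N -> forall j, (0 < j < m)%N -> forall y phi,
    `|W X 0 n (fun x => cos (2 * pi * j%:R / (q * d%:R) * x + phi)) y| <= e * D n.
Proof.
move=> d0 e0; elim: m => [|m [n1 IHm]]; first by exists 0%N => n _ j; rewrite ltn0 andbF.
have [->|m0] := posnP m.
  by exists 0%N => n _ [|j]; rewrite ?ltnS ?ltn0 ?andbF.
have [n2 h2] := fourier_decay X d0 m0 e0.
exists (maxn n1 n2) => n; rewrite geq_max => /andP[nn1 nn2] j /andP[j0].
rewrite ltnS leq_eqVlt => /orP[/eqP->|jm] y phi; first exact: h2.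
by apply: IHm => //; rewrite j0.
Qed.

(** Only the diagonal terms, of frequency zero, survive copying; they contribute [D n / m]. *)
Lemma W_fejer (d m : nat) e : (0 < d)%N -> (0 < m)%N -> 0 < e ->
  exists n0, forall n, (n0 <= n)%N -> forall y c,
    W X 0 n (fun x => fejer m (2 * pi * (x - c) / (q * d%:R))) y <= D n * (m%:R^-1 + e).
Proof.
move=> d0 m0 e0; have [n0 hn0] := fourier_decay_upto m d0 e0.
exists n0 => n /hn0 h y c.
have mR : 0 < m%:R :> R by rewrite ltr0n.
have -> : W X 0 n (fun x => fejer m (2 * pi * (x - c) / (q * d%:R))) y =
  (m%:R ^+ 2)^-1 * \sum_(j < m) \sum_(k < m)
    W X 0 n (fun x => cos ((j%:R - k%:R) * (2 * pi * (x - c) / (q * d%:R)))) y.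
  rewrite (eq_bigr (fun j : 'I_m => W X 0 n (fun x => \sum_(k < m)
    cos ((j%:R - k%:R) * (2 * pi * (x - c) / (q * d%:R)))) y)); last first.
    by move=> j _; rewrite W_sum.
  by rewrite -W_sum -W_Z; apply: eq_W => x; rewrite fejerE mulrC.
have Dn := D_gt0 X n.
apply: (@le_trans _ _ ((m%:R ^+ 2)^-1 *
    \sum_(j < m) \sum_(k < m) (D n * ((j == k)%:R + e)))).
  rewrite ler_pM2l ?invr_gt0 ?exprn_gt0//.
  apply: ler_sum => j _; apply: ler_sum => k _.
  have [<-|jk] := eqVneq j k.
    rewrite (@eq_W _ _ _ _ _ (fun=> 1)); last by move=> x; rewrite subrr mul0r cos0.
    by rewrite W0_cst mul1r ler_pMr// lerDl ltW.
  rewrite add0r [D n * e]mulrC; apply: le_trans (ler_norm _) _.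
  wlog kj : j k jk / (k < j)%N.
    move=> wl; have := jk; rewrite neq_ltn => /orP[jk'|kj']; last exact: wl.
    rewrite (@eq_W _ _ _ _ _ (fun x => cos ((k%:R - j%:R) * (2 * pi * (x - c) / (q * d%:R))))).
      by apply: wl => //; rewrite eq_sym.
    by move=> x; rewrite -cosN; congr cos; ring.
  rewrite (@eq_W _ _ _ _ _ (fun x => cos (2 * pi * (j - k)%N%:R / (q * d%:R) * x +
    (- (2 * pi * (j - k)%N%:R / (q * d%:R) * c)))) ).
    by apply: h; rewrite subn_gt0 kj (leq_ltn_trans (leq_subr _ _)).
  by move=> x; rewrite natrB ?(ltnW kj)//; congr cos; ring.
rewrite (eq_bigr (fun=> D n * (1 + m%:R * e))) => [|j _]; last first.
  rewrite -mulr_sumr big_split/= sumr_const card_ord [in RHS]mulr_natl.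
  congr (_ * (_ + _)).
  by rewrite (bigD1 j)//= eqxx big1 ?addr0// => k /negbTE; rewrite eq_sym => ->.
rewrite sumr_const card_ord -[_ *+ _]mulr_natr le_eqVlt; apply/orP; left; apply/eqP.
by field; rewrite gt_eqF.
Qed.

(** Majorants suffice: a lower bound for an interval comes from a majorant of the complementary arc
    of the circle. *)
Lemma cell_majorant (d : nat) (al be e : R) : (0 < d)%N -> 0 < e -> al <= be ->
  be - al <= q * d%:R ->
  exists (P : R -> R) n0, [/\ forall x, 0 <= P x, forall x, cell al be x <= P x,
    forall x (l : nat), P (x + l%:R * (q * d%:R)) = P x &
    forall n, (n0 <= n)%N -> forall y,
      W X 0 n P y <= D n * ((be - al) / (q * d%:R) + e)].
Proof.
move=> d0 e0 ab abL; set La := q * d%:R in abL *.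
have q0 := spacer_gt0 X; have p0 := @pi_gt0 R.
have La0 : 0 < La by rewrite mulr_gt0// ltr0n.
(* The tolerance is spent in four quarters: the enlargement by [de], the rounding in the count of
   kernels, the additive constant, and the Fourier errors. The bound 1/4 is the smallness of [de]
   required by the majorant. *)
pose de := La * Num.min (e / 8) (1/4).
have mn0 : 0 < Num.min (e / 8) (1/4) by rewrite lt_min; apply/andP; split; lra.
have de0 : 0 < de by rewrite mulr_gt0.
have deL : de <= La / 4.
  have : Num.min (e / 8) (1/4) <= 1/4 by rewrite ge_min lexx orbT.
  by rewrite /de; nra.
have dee : 2 * de / La <= e / 4.
  have : Num.min (e / 8) (1/4) <= e / 8 by rewrite ge_min lexx.
  by rewrite /de ler_pdivrMr//; nra.
set eta := 2 - 2 * cos (2 * pi * de / La).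
have eta0 : 0 < eta.
  suff : cos (2 * pi * de / La) < 1 by rewrite /eta; lra.
  have h0 : 0 < 2 * pi * de / La by rewrite divr_gt0// mulr_gt0//; lra.
  have h1 : 2 * pi * de / La <= pi by rewrite ler_pdivrMr//; nra.
  move: h0 h1; set u := 2 * pi * de / La => h0 h1.
  by rewrite -cos0 ltr_cos// in_itv/= ?lexx ?h1 ltW//= ltW.
pose m := (Num.truncn (Num.max (4 / e) (16 / (e * eta)))).+1.
have mR : 0 < m%:R :> R by rewrite ltr0n.
have mx : Num.max (4 / e) (16 / (e * eta)) < m%:R by exact: truncnS_gt.
have m1 : m%:R^-1 <= e / 4.
  rewrite -(ler_pM2l mR) mulfV ?gt_eqF//.
  have : 4 / e < m%:R by apply: le_lt_trans mx; rewrite le_max lexx.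
  by rewrite ltr_pdivrMr//; lra.
have m2 : 4 / (m%:R * eta) <= e / 4.
  rewrite ler_pdivrMr ?mulr_gt0//.
  have : 16 / (e * eta) < m%:R by apply: le_lt_trans mx; rewrite le_max lexx orbT.
  by rewrite ltr_pdivrMr ?mulr_gt0//; lra.
pose sel (i : 'I_m) := i%:R <= m%:R * ((be - al + 2 * de) / La).
(* At most [m] kernels are kept, so this error on each of them leaves a quarter of [e]. *)
have e10 : 0 < e / (4 * m%:R) by rewrite divr_gt0// mulr_gt0//; lra.
have [n0 hn0] := W_fejer d0 (ltn0Sn _ : (0 < m)%N) e10.
exists (fun x => \sum_(i < m | sel i)
       fejer m (2 * pi * (x - (al - de + i%:R * (La / m%:R))) / La) + 4 / (m%:R * eta)).
exists n0; split.
- move=> x; apply: addr_ge0; first by apply: sumr_ge0 => i _; exact: fejer_ge0.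
  by rewrite divr_ge0// mulr_ge0// ltW.
- by move=> x; apply: fejer_majorant.
- move=> x l; congr (_ + _); apply: eq_bigr => i _; rewrite !fejerE; congr (_ / _).
  apply: eq_bigr => j _; apply: eq_bigr => k _.
  rewrite -[RHS](cos_period2pi _ ((j%:Z - k%:Z) * l%:Z)) intrM intrB -!pmulrn.
  by congr cos; rewrite -/La; field; rewrite !gt_eqF.
- move=> n /hn0 h y; have Dn := D_gt0 X n.
  rewrite W_D W0_cst W_sum.
  apply: (@le_trans _ _ (\sum_(i < m | sel i) (D n * (m%:R^-1 + e / (4 * m%:R))) +
     4 / (m%:R * eta) * D n)).
    by rewrite lerD2r; apply: ler_sum => i _; exact: h.
  rewrite (eq_bigr (fun i => D n * (m%:R^-1 + e / (4 * m%:R)) * 1)) => [|i _]; last first.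
    by rewrite mulr1.
  rewrite -mulr_sumr -mulrA [_ * D n]mulrC -mulrDr ler_pM2l//.
  set z := m%:R * ((be - al + 2 * de) / La).
  have z0 : 0 <= z by rewrite mulr_ge0 ?divr_ge0 ?ltW//; lra.
  have c1 := count_le m z0.
  have c2 : \sum_(i < m | sel i) 1 <= m%:R :> R.
    rewrite big_mkcond/= -[X in _ <= X%:R]card_ord -sumr_const.
    by apply: ler_sum => i _; case: ifP.
  rewrite -/sel in c1; set c := \sum_(i < m | _) 1 in c1 c2 *.
  have -> : (m%:R^-1 + e / (4 * m%:R)) * c = m%:R^-1 * c + e / 4 * (m%:R^-1 * c).
    by field; rewrite gt_eqF.
  have k1 : m%:R^-1 * c <= (be - al) / La + 2 * de / La + m%:R^-1.
    rewrite -(ler_pM2l mR) mulVKf ?gt_eqF//; apply: le_trans c1 _.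
    by rewrite le_eqVlt /z; apply/orP; left; apply/eqP; field; rewrite !gt_eqF.
  have k2 : m%:R^-1 * c <= 1 by rewrite -(ler_pM2l mR) mulVKf ?gt_eqF// mulr1.
  have : e / 4 * (m%:R^-1 * c) <= e / 4 by rewrite ler_piMr//; lra.
  by lra.
Qed.

Lemma bo_le n i j : (i <= j)%N -> bo X n i <= bo X n j.
Proof.
move=> /subnK <-; elim: (j - i)%N => //= k IHk; rewrite addSn.
apply: le_trans IHk _; rewrite boS -addrA lerDl addr_ge0 ?(ltW (H_gt0 X n))//.
by rewrite mulr_ge0 ?(ltW (spacer_gt0 X)).
Qed.

(** All copies of tower [a] in tower [a + k] have offsets between 0 and [H (a + k) - H a], so a
    comparison on that window is enough. The lower bound for intervals holds only there. *)
Lemma W_le_local a k (F G : R -> R) y :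
  (forall x, y <= x <= y + (H (a + k) - H a) -> F x <= G x) ->
  W X a k F y <= W X a k G y.
Proof.
elim: k y => [|k IHk] y FG; first by apply: FG; rewrite addn0 subrr addr0 lexx.
apply: ler_sum => i _; apply: IHk => x /andP[yx xy]; apply: FG.
have b0 := bo_ge0 X (a + k) i; apply/andP; split; first lra.
have : bo X (a + k) i + H (a + k) <= H (a + k).+1.
  apply: le_trans (bo_le _ (ltn_ord i)); rewrite boS lerDl.
  by rewrite mulr_ge0 ?(ltW (spacer_gt0 X)).
by rewrite addnS; lra.
Qed.

(* [UE F v]: along any progression of step [q * d] crossing tower [n], the   *)
(* sum of the copies of [F] is as if these were uniform modulo [q * d].      *)
Definition UE (F : R -> R) (v : R) := forall d e, (0 < d)%N -> 0 < e ->
  exists n0, forall n, (n0 <= n)%N -> forall (L : nat) y,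
    - (L%:R * (q * d%:R)) <= y -> y <= - H n ->
    `|\sum_(l < L) W X 0 n F (y + l%:R * (q * d%:R)) - D n * (v / (q * d%:R))| <= e * D n.

Lemma UE_ext F G v : F =1 G -> UE F v -> UE G v.
Proof.
move=> FG UF d e d0 e0; have [n0 h] := UF d e d0 e0; exists n0 => n /h {}h L y h1 h2.
have := h L y h1 h2; congr (`|_ - _| <= _); apply: eq_bigr => l _; exact: eq_W.
Qed.

Lemma UE0 : UE (fun=> 0) 0.
Proof.
move=> d e d0 e0; exists 0%N => n _ L y _ _.
rewrite big1 ?mul0r ?mulr0 ?subrr ?normr0 ?mulr_ge0 ?(ltW e0) ?(ltW (D_gt0 X n))//.
by move=> l _; rewrite W0_cst mul0r.
Qed.

Lemma UE_D F G v w : UE F v -> UE G w -> UE (fun x => F x + G x) (v + w).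
Proof.
move=> UF UG d e d0 e0; have e2 : 0 < e / 2 by lra.
have [n1 h1] := UF d _ d0 e2; have [n2 h2] := UG d _ d0 e2.
exists (maxn n1 n2) => n; rewrite geq_max => /andP[/h1 k1 /h2 k2] L y yL yH.
under eq_bigr do rewrite W_D; rewrite big_split/=.
have := k1 L y yL yH; have := k2 L y yL yH.
set A := \sum_(i < L) W X 0 n F _; set B := \sum_(i < L) W X 0 n G _ => hB hA.
rewrite (_ : _ - _ = (A - D n * (v / (q * d%:R))) + (B - D n * (w / (q * d%:R)))); last by ring.
by apply: le_trans (ler_normD _ _) _; lra.
Qed.

Lemma UE_Z c F v : UE F v -> UE (fun x => c * F x) (c * v).
Proof.
move=> UF d e d0 e0; have c1 : 0 < `|c| + 1 by rewrite ltr_wpDl.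
have [n1 h1] := UF d _ d0 (divr_gt0 e0 c1).
exists n1 => n /h1 k1 L y yL yH; under eq_bigr do rewrite W_Z; rewrite -mulr_sumr.
have := k1 L y yL yH; set A := \sum_(i < L) W X 0 n F _ => hA.
rewrite (_ : _ - _ = c * (A - D n * (v / (q * d%:R)))); last by ring.
rewrite normrM; apply: le_trans (ler_wpM2l (normr_ge0 c) hA) _.
rewrite mulrA mulrA ler_pM2r ?D_gt0// ler_pdivrMr// mulrC ler_pM2l//; lra.
Qed.

Lemma UE_sum (I : Type) (s : seq I) (F : I -> R -> R) v :
  (forall i, UE (F i) (v i)) ->
  UE (fun x => \sum_(i <- s) F i x) (\sum_(i <- s) v i).
Proof.
move=> UF; elim: s => [|i s IHs].
  by rewrite big_nil; apply: UE_ext UE0 => x; rewrite big_nil.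
rewrite big_cons; apply: UE_ext (UE_D (UF i) IHs) => x; by rewrite big_cons.
Qed.

(** An interval no longer than [q] is met at most once by a progression of step [q * d], so the sum
    along the progression is the indicator of an arc modulo [q * d] as long as the progression
    covers the tower. *)
Lemma UE_cell al be : - H 0 <= al -> al < be -> be <= 0 -> be - al <= q ->
  UE (cell al be) (be - al).
Proof.
move=> Hal ab be0 abq d e d0 e0; set La := q * d%:R.
have q0 := spacer_gt0 X.
have d1 : 1 <= d%:R :> R by rewrite ler1n.
have La0 : 0 < La by rewrite mulr_gt0// ltr0n.
have qL : q <= La by rewrite ler_peMr// ltW.
have abL : be - al <= La by apply: le_trans qL.
have [P [n1 [P0 cP Pper hP]]] := cell_majorant d0 e0 (ltW ab) abL.
have be1 : be <= al + La by lra.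
have be2 : al + La - be <= La by lra.
(* [Q] majorizes the complementary arc, so [1 - Q] minorizes the sum along the progression. *)
have [Q [n2 [Q0 cQ Qper hQ]]] := cell_majorant d0 e0 be1 be2.
rewrite -/La in Pper hP Qper hQ.
exists (maxn n1 n2) => n; rewrite geq_max => /andP[/hP kP /hQ kQ] L y yL yH.
have Dn := D_gt0 X n.
have -> : \sum_(l < L) W X 0 n (cell al be) (y + l%:R * La) =
    W X 0 n (fun x => \sum_(l < L) cell al be (x + l%:R * La)) y.
  by rewrite W_sum; apply: eq_bigr => l _; rewrite W_shift.
have hit (l : nat) x : al <= x + l%:R * La < be -> (l < L)%N ->
    1 <= \sum_(l < L) cell al be (x + l%:R * La).
  move=> hl lL; rewrite (bigD1 (Ordinal lL))//= {1}/cell hl lerDl.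
  by apply: sumr_ge0 => i _; exact: cell_ge0.
rewrite ler_distl; apply/andP; split.
  apply: (@le_trans _ _ (W X 0 n (fun x => 1 + (-1) * Q x) y)).
    rewrite W_D W_Z W0_cst; have := kQ y.
    rewrite (_ : (al + La - be) / La = 1 - (be - al) / La); last first.
      by field; rewrite gt_eqF.
    set z := (be - al) / La; lra.
  apply: W_le_local => x; rewrite add0n => /andP[yx xy].
  (* Index of the last point not beyond [al]. The next point falls in the interval or in the
     complementary arc, unless it is exactly [al + La], in which case the point of index [k] is [al]
     itself. *)
  set k := Num.truncn ((al - x) / La).
  have xal : 0 <= (al - x) / La by rewrite divr_ge0//; lra.
  have := truncn_itv xal; rewrite -/k -natr1 ler_pdivlMr// ltr_pdivrMr//.
  rewrite (mulrDl k%:R) mul1r => /andP[k1 k2].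
  have lt (l : nat) : x + l%:R * La < be -> (l < L)%N.
    move=> h; rewrite ltnNge; apply/negP => Ll.
    have : L%:R * La <= l%:R * La by rewrite ler_pM2r// ler_nat.
    by lra.
  have [xb|xb] := ltP (x + k.+1%:R * La) be.
    have : 1 <= \sum_(l < L) cell al be (x + l%:R * La).
      apply: (hit k.+1) (lt _ xb); rewrite xb andbT.
      by rewrite -natr1 mulrDl mul1r; lra.
    by have := Q0 x; lra.
  have S0 : 0 <= \sum_(l < L) cell al be (x + l%:R * La).
    by apply: sumr_ge0 => i _; exact: cell_ge0.
  have [xa|xa] := ltP (x + k.+1%:R * La) (al + La).
    suff : 1 <= Q x by lra.
    by rewrite -(Qper _ k.+1); apply: le_trans (cQ _); rewrite /cell xb xa.
  have xE : x + k%:R * La = al by move: xa; rewrite -natr1 mulrDl mul1r; lra.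
  have xkb : x + k%:R * La < be by rewrite xE.
  have : 1 <= \sum_(l < L) cell al be (x + l%:R * La).
    by apply: (hit k) (lt _ xkb); rewrite xE lexx.
  by have := Q0 x; lra.
apply: le_trans (_ : _ <= W X 0 n P y) _; last first.
  by have := kP y; set z := (be - al) / La; lra.
apply: W_le => x.
have [/existsP[l hl]|/existsPn h] := boolP [exists l : 'I_L, al <= x + l%:R * La < be].
  rewrite (bigD1 l)//= big1 ?addr0 => [|k kl].
    by rewrite -(Pper x l); exact: cP.
  rewrite /cell; case: ifP => // hk; exfalso.
  move: kl; rewrite neq_ltn => /orP[] kl.
    have : k.+1%:R * La <= l%:R * La by rewrite ler_pM2r// ler_nat.
    by rewrite -natr1 mulrDl mul1r; lra.
  have : l.+1%:R * La <= k%:R * La by rewrite ler_pM2r// ler_nat.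
  by rewrite -natr1 mulrDl mul1r; lra.
by rewrite big1 => [//|l _]; rewrite /cell (negbTE (h l)).
Qed.

Lemma count_progression (n : nat) (u v s x : R) : u <= v -> 0 < s ->
  \sum_(i < n) cell u v (x + i%:R * s) <= (v - u) / s + 1.
Proof.
move=> uv s0; have vs : 0 <= (v - u) / s by rewrite divr_ge0 ?subr_ge0// ltW.
have step (m : nat) z : \sum_(i < m.+1) cell u v (z + i%:R * s) =
    cell u v z + \sum_(i < m) cell u v ((z + s) + i%:R * s).
  rewrite big_ord_recl mul0r addr0; congr (_ + _); apply: eq_bigr => i _.
  by congr cell; rewrite /bump/= natrD mulrDl mul1r addrA.
have above (m : nat) z : v <= z -> \sum_(i < m) cell u v (z + i%:R * s) = 0.
  move=> vz; apply: big1 => i _; rewrite /cell; case: ifPn => // /andP[_].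
  have : 0 <= i%:R * s by rewrite mulr_ge0// ltW.
  by lra.
have inside (m : nat) z : u <= z -> z < v ->
    \sum_(i < m) cell u v (z + i%:R * s) <= (v - z) / s + 1.
  elim: m z => [|m IHm] z uz zv.
    by rewrite big_ord0 addr_ge0// divr_ge0 ?subr_ge0// ltW.
  rewrite step /cell uz zv /= -/(cell _ _).
  have [vz|vz] := leP v (z + s).
    by rewrite (above m _ vz) addr0 lerDr divr_ge0 ?subr_ge0// ltW.
  apply: le_trans (lerD (lexx 1) (IHm _ _ vz)) _; first lra.
  rewrite (_ : (v - (z + s)) / s = (v - z) / s - 1); last by field; rewrite gt_eqF.
  by lra.
elim: n x => [|n IHn] x; first by rewrite big_ord0; lra.
have [xu|ux] := ltP x u.
  by rewrite step {1}/cell [u <= x]leNgt xu/= add0r.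
have [vx|xv] := leP v x; first by rewrite above//; lra.
apply: le_trans (inside _ _ ux xv) _.
by rewrite lerD2r ler_pM2r ?invr_gt0//; lra.
Qed.

(* The pieces of a progression of step [q * d] inside the successive copies  *)
(* of a fixed tower are all equidistributed.                                 *)
Lemma uniform_averages F : (forall x, `|F x| <= cell (- H 0) 0 x) -> UE F 0 ->
  forall d e, (0 < d)%N -> 0 < e ->
  exists n1 L0, forall n L, (n1 <= n)%N -> (L0 <= L)%N -> forall y,
    `|\sum_(l < L) W X 0 n F (y + l%:R * (q * d%:R))| <= e * L%:R.
Proof.
move=> F1 UF d e d0 e0; set La := q * d%:R.
have La0 : 0 < La by rewrite mulr_gt0 ?spacer_gt0// ltr0n.
have H0 := H_gt0 X 0.
have La2 : 0 < 2 * La by lra.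
(* About L La / H_a copies of tower [a] are crossed, each with error e' D_a; since D_a H_0 <= H_a,
   this choice makes their total at most e L / 2. *)
have e1 : 0 < e * H 0 / (2 * La) by apply: divr_gt0 => //; exact: mulr_gt0.
have [a ha] := UF d _ d0 e1; have {}ha := ha a (leqnn a).
set e' := e * H 0 / (2 * La) in e1 ha.
have Ha := H_gt0 X a; have Da := D_gt0 X a.
pose B := H a / La + 1; pose C := 2 * (e' * D a) + 4 * B.
have B0 : 0 < B by rewrite ltr_wpDl// divr_ge0// ltW.
have eD : 0 < e' * D a by rewrite mulr_gt0.
have C0 : 0 < C by rewrite /C; lra.
exists a, (Num.truncn (2 * C / e)).+1 => n L an LL y.
have CL : C <= e / 2 * L%:R.
  have : 2 * C / e < L%:R.
    by apply: lt_le_trans (truncnS_gt _) _; rewrite ler_nat.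
  by rewrite ltr_pdivrMr//; lra.
pose h x := \sum_(l < L) W X 0 a F (x + l%:R * La).
(* [h] is the contribution of one copy of the fixed tower [a]; tower [n] merely superposes copies of
   it. *)
have -> : \sum_(l < L) W X 0 n F (y + l%:R * La) = W X a (n - a) h y.
  rewrite /h W_sum; apply: eq_bigr => l _; rewrite W_shift.
  by have := W_comp X 0 a (n - a) F (y + l%:R * La); rewrite add0n subnKC.
have WF x : `|W X 0 a F x| <= cell (- H a) 0 x.
  have h1 z : `|F z| <= 1 * cell (- H 0) 0 z by rewrite mul1r.
  by have := W_bounded a h1 ler01 x; rewrite add0n mul1r.
have hB x : `|h x| <= B.
  apply: le_trans (ler_norm_sum _ _ _) _.
  apply: le_trans (ler_sum _ (fun i _ => WF _)) _.
  apply: le_trans (count_progression _ _ _ La0) _; first lra.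
  by rewrite /B; lra.
have LLa0 : 0 <= L%:R * La by rewrite mulr_ge0// ltW.
(* A copy fully crossed by the progression has the equidistribution error. A copy containing an end
   of the progression has only the crude bound [B], but there are boundedly many of these. *)
have hle x : `|h x| <= e' * D a * cell (- (L%:R * La) - H a) 0 x +
   (B * cell (- (L%:R * La) - H a) (- (L%:R * La)) x + B * cell (- H a) 0 x).
  have [x1|x1] := ltP x (- (L%:R * La) - H a).
    rewrite /h big1 ?normr0 => [|l _].
      by do 2?apply: addr_ge0; apply: mulr_ge0; rewrite ?cell_ge0// ltW.
    apply/eqP; rewrite -normr_le0; apply: le_trans (WF _) _; rewrite /cell.
    have lL : l%:R * La <= L%:R * La by rewrite ler_pM2r// ler_nat ltnW.
    by rewrite ifF//; apply/negP => /andP[]; lra.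
  have [x2|x2] := leP 0 x.
    rewrite /h big1 ?normr0 => [|l _].
      by do 2?apply: addr_ge0; apply: mulr_ge0; rewrite ?cell_ge0// ltW.
    apply/eqP; rewrite -normr_le0; apply: le_trans (WF _) _; rewrite /cell.
    have lL : 0 <= l%:R * La by rewrite mulr_ge0// ltW.
    by rewrite ifF//; apply/negP => /andP[]; lra.
  rewrite /cell x1 x2/= mulr1.
  have [x3|x3] := ltP x (- (L%:R * La)).
    apply: le_trans (hB x) _; rewrite mulr1; case: ifP => _; lra.
  rewrite mulr0 add0r; have [x4|x4] := leP (- H a) x.
    by apply: le_trans (hB x) _; rewrite mulr1; lra.
  rewrite mulr0 addr0; have := ha L x x3 (ltW x4).
  by rewrite mul0r mulr0 subr0.
apply: le_trans (W_norm _ _ _ _ _) _; apply: le_trans (W_le _ _ _ hle _) _.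
rewrite !W_D !W_Z.
have c1 : W X a (n - a) (cell (- (L%:R * La) - H a) 0) y <= L%:R * La / H a + 2.
  apply: le_trans (W_cell_count _ _ _ _ _) _; first lra.
  rewrite (_ : (0 - _) / _ = L%:R * La / H a + 1); first lra.
  by field; rewrite gt_eqF.
have c2 : W X a (n - a) (cell (- (L%:R * La) - H a) (- (L%:R * La))) y <= 2.
  apply: le_trans (W_cell_count _ _ _ _ _) _; first lra.
  rewrite (_ : - (L%:R * La) - (- (L%:R * La) - H a) = H a); last by ring.
  by rewrite divff ?gt_eqF//; lra.
have c3 : W X a (n - a) (cell (- H a) 0) y <= 2.
  apply: le_trans (W_cell_count _ _ _ _ _) _; first lra.
  by rewrite sub0r opprK divff ?gt_eqF//; lra.
have k1 : e' * D a * (L%:R * La / H a) <= e / 2 * L%:R.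
  have DH := D_le_H X a; rewrite -H0E in DH.
  rewrite (_ : _ * _ = e / 2 * L%:R * (D a * H 0 / H a)); last first.
    by rewrite /e'; field; rewrite !gt_eqF.
  rewrite ler_piMr ?mulr_ge0//; first by lra.
  by rewrite ler_pdivrMr// mul1r.
have g1 := ler_wpM2l (ltW eD) c1.
have g2 := ler_wpM2l (ltW B0) c2; have g3 := ler_wpM2l (ltW B0) c3.
move: CL; rewrite /C; set aa := W X a _ _ _ in c1 g1 *; set bb := W X a _ _ _ in c2 g2 *.
set cc := W X a _ _ _ in c3 g3 *; lra.
Qed.

End Equidistribution.

(** * Decay of correlations of towers *)

Section Correlations.
Variables (R : realType) (X : tower R).
Notation rho := (cuts X).
Notation q := (spacer X).
Notation H := (th X).
Notation D := (td X).
Variables F G : R -> R.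
Hypotheses (nF : nice F) (nG : nice G).
Hypotheses (F1 : forall x, `|F x| <= cell (- H 0) 0 x)
           (G1 : forall x, `|G x| <= cell (- H 0) 0 x).
Local Notation f := (fun n => W X 0 n F).
Local Notation g := (fun n => W X 0 n G).

(** Not divided by the number of copies: the size to compare with is [D n]. *)
Definition corr (n : nat) (s : R) : R :=
  Int (fun y => W X 0 n G y * W X 0 n F (y + s)).

Lemma W_cell_bound (E : R -> R) : (forall x, `|E x| <= cell (- H 0) 0 x) ->
  forall n x, `|W X 0 n E x| <= cell (- H n) 0 x.
Proof.
move=> E1 n x; have h1 z : `|E z| <= 1 * cell (- H 0) 0 z by rewrite mul1r.
by have := W_bounded n h1 ler01 x; rewrite add0n mul1r.
Qed.

Lemma corr_nice n s : nice (fun y => g n y * f n (y + s)).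
Proof. by apply: niceM; [exact: nice_W|apply: nice_shift; exact: nice_W]. Qed.

Lemma corr_shift n s u :
  corr n s = Int (fun y => g n (y + u) * f n (y + (s + u))).
Proof.
rewrite /corr -(Int_shift u (corr_nice n s)); congr Int; apply/funext => y.
by congr (_ * W _ _ _ _ _); ring.
Qed.

Lemma corr_le n s a b : a <= b ->
  (forall y, cell (- H n) 0 y * cell (- H n) 0 (y + s) <= cell a b y) ->
  `|corr n s| <= b - a.
Proof.
move=> ab h; apply: le_trans (ler_norm_Int (corr_nice n s)) _.
rewrite -[leRHS]mul1r; apply: ler_Int_bound => //; first exact: nice_norm (corr_nice _ _).
move=> y; rewrite mul1r; apply: le_trans (h y); rewrite normrM ler_pM//.
  exact: W_cell_bound.
exact: W_cell_bound.
Qed.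

Lemma corr_eq0 n s : H n <= `|s| -> corr n s = 0.
Proof.
move=> Hs; apply/eqP; rewrite -normr_le0 -(subrr 0); apply: corr_le => // y.
rewrite /cell; have := H_gt0 X n; move: Hs; rewrite ler_normr.
case: ifPn => [/andP[y1 y2]|_ _ _]; last by rewrite mul0r; case: ifP.
move=> h h2; rewrite ifF ?mulr0; first by case: ifP.
by apply/negP => /andP[y3 y4]; case/orP: h; lra.
Qed.

Lemma corr_le_H n s : `|corr n s| <= H n.
Proof.
have Hn := H_gt0 X n; have -> : H n = 0 - (- H n) by ring.
apply: corr_le => [|y]; first lra.
by rewrite ler_piMr ?cell_ge0 ?cell_le1.
Qed.

Lemma corr_le_overlap n s : - H n <= s -> s <= 0 -> `|corr n s| <= H n + s.
Proof.
move=> Hs s0; have -> : H n + s = 0 - (- H n - s) by ring.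
apply: corr_le => [|y]; first lra.
rewrite /cell; case: ifPn => [/andP[y1 y2]|_]; last by rewrite mul0r; case: ifP.
rewrite mul1r; case: ifPn => [/andP[y3 y4]|_]; last by case: ifP.
by rewrite ifT//; apply/andP; split; lra.
Qed.

Lemma corrS n s : corr n.+1 s =
  \sum_(i' < rho n) \sum_(i < rho n) corr n (s + bo X n i - bo X n i').
Proof.
rewrite /corr.
transitivity (Int (fun y => \sum_(i' < rho n) \sum_(i < rho n)
   (g n (y + bo X n i') * f n (y + (s + bo X n i - bo X n i' + bo X n i'))))).
  congr Int; apply/funext => y /=; rewrite add0n mulr_suml; apply: eq_bigr => i' _.
  by rewrite mulr_sumr; apply: eq_bigr => i _; congr (_ * W _ _ _ _ _); ring.
have nn (i i' : 'I_(rho n)) :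
  nice (fun y => g n (y + bo X n i') * f n (y + (s + bo X n i - bo X n i' + bo X n i'))).
  by apply: niceM; apply: nice_shift; exact: nice_W.
rewrite Int_sum => [|i']; last exact: nice_sum.
apply: eq_bigr => i' _; rewrite Int_sum//; apply: eq_bigr => i _.
by rewrite -corr_shift.
Qed.

(** The shifted copies are disjoint, so the sum is a single integral over a set of length [H n]; the
    bound is independent of [M], which keeps boundary terms cheap. *)
Lemma sum_corr_below n s M : \sum_(j < M) `|corr n (s - bo X n j)| <= H n.
Proof.
have nn j : nice (fun y => `|g n (y + bo X n j) * f n (y + s)|).
  by apply: nice_norm; apply: niceM; apply: nice_shift; exact: nice_W.
apply: (@le_trans _ _ (\sum_(j < M) Int (fun y => `|g n (y + bo X n j) * f n (y + s)|))).
  apply: ler_sum => j _; rewrite (corr_shift n _ (bo X n j)) subrK.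
  by apply: ler_norm_Int; apply: niceM; apply: nice_shift; exact: nice_W.
rewrite -Int_sum => [|j]; last exact: nn.
have Hn := H_gt0 X n; rewrite (_ : H n = 1 * (- s - (- H n - s))); last by ring.
apply: ler_Int_bound => //; [by apply: nice_sum => j; exact: nn|lra|move=> y].
rewrite mul1r; apply: (@le_trans _ _ (\sum_(j < M) cell (- H n) 0 (y + bo X n j) *
    cell (- H n) 0 (y + s))).
  rewrite -mulr_suml; under eq_bigr do rewrite normrM; rewrite -mulr_suml.
  apply: ler_pM; rewrite ?sumr_ge0//; last exact: W_cell_bound.
  by apply: ler_sum => j _; exact: W_cell_bound.
rewrite -mulr_suml; apply: (@le_trans _ _ (1 * cell (- H n) 0 (y + s))).
  rewrite ler_wpM2r ?cell_ge0//; apply: le_trans (sum_cell_le1 _ _ _ _) _.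
  exact: cell_le1.
rewrite mul1r /cell; case: ifPn => [/andP[h1 h2]|_]; last by case: ifP.
by rewrite ifT//; apply/andP; split; lra.
Qed.

Lemma sum_corr_above n s M : \sum_(j < M) `|corr n (s + bo X n j)| <= H n.
Proof.
have nn j : nice (fun y => `|g n y * f n (y + (s + bo X n j))|).
  by apply: nice_norm; apply: niceM; [|apply: nice_shift]; exact: nice_W.
apply: (@le_trans _ _ (\sum_(j < M) Int (fun y => `|g n y * f n (y + (s + bo X n j))|))).
  apply: ler_sum => j _; apply: ler_norm_Int; exact: corr_nice.
rewrite -Int_sum => [|j]; last exact: nn.
have Hn := H_gt0 X n; rewrite (_ : H n = 1 * (0 - (- H n))); last by ring.
apply: ler_Int_bound => //; [by apply: nice_sum => j; exact: nn|lra|move=> y].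
rewrite mul1r; apply: (@le_trans _ _ (\sum_(j < M) cell (- H n) 0 y *
    cell (- H n) 0 ((y + s) + bo X n j))).
  apply: ler_sum => j _; rewrite normrM; apply: ler_pM => //; first exact: W_cell_bound.
  by rewrite addrA; exact: W_cell_bound.
rewrite -mulr_sumr ler_piMr ?cell_ge0//; apply: le_trans (sum_cell_le1 _ _ _ _) _.
exact: cell_le1.
Qed.

Lemma sum_triangle (V : zmodType) (h : nat -> nat -> V) N :
  \sum_(i' < N) \sum_(i < i') h i i' =
  \sum_(k < N) \sum_(i < N - k.+1) h i (i + k.+1)%N.
Proof.
elim: N => [|N IHN]; first by rewrite !big_ord0.
rewrite big_ord_recr/= IHN [RHS]big_ord_recr/= subnn big_ord0 addr0.
rewrite [X in _ + X](reindex_inj rev_ord_inj)/= -big_split/=.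
apply: eq_bigr => k _; have kN := ltn_ord k.
rewrite (_ : (N.+1 - k.+1)%N = (N - k.+1).+1); last by lia.
by rewrite big_ord_recr/=; congr (_ + h _ _); lia.
Qed.

Definition gap n i K : R := bo X n (i + K) - bo X n i.

Lemma gapE n i K : gap n i K = K%:R * H n + q * (K%:R * i%:R) + q * 'C(K, 2)%:R.
Proof. by rewrite /gap bo_add; ring. Qed.

Lemma le_gap n i K : K%:R * H n <= gap n i K.
Proof.
by rewrite gapE -addrA lerDl addr_ge0// mulr_ge0// ltW// spacer_gt0.
Qed.

(** For nonnegative [t] the pairs of copies in the wrong order are too far apart to interact. The
    diagonal gives the first term, and the other pairs are grouped by their index difference. *)
Lemma corrS_gaps n t : 0 <= t -> corr n.+1 t = (rho n)%:R * corr n t +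
  \sum_(k < rho n) \sum_(i < rho n - k.+1) corr n (t - gap n i k.+1).
Proof.
move=> t0; rewrite corrS -(sum_triangle (fun i i' => corr n (t - (bo X n i' - bo X n i)))).
have -> : (rho n)%:R * corr n t = \sum_(i' < rho n) corr n t.
  by rewrite sumr_const card_ord mulr_natl.
rewrite -big_split/=.
apply: eq_bigr => i' _.
rewrite (bigID (fun i : 'I_(rho n) => (i < i')%N))/= addrC; congr (_ + _).
  rewrite (bigD1 i') ?ltnn//= big1 ?addr0 ?addrK// => i /andP[ii' ni].
  have lti : (i' < i)%N by rewrite ltn_neqAle leqNgt ii' andbT eq_sym.
  apply: corr_eq0; have : H n <= bo X n i - bo X n i'.
    have := le_gap n i' (i - i'); rewrite /gap subnKC ?(ltnW lti)//.
    apply: le_trans; rewrite ler_peMl ?ler1n ?subn_gt0// ltW// H_gt0//.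
  by have := H_gt0 X n; move=> h1 h2; rewrite ger0_norm; lra.
rewrite -(big_mkord (fun i => (i < i')%N) (fun i => corr n (t + bo X n i - bo X n i'))).
rewrite -(big_mkord xpredT (fun i => corr n (t - (bo X n i' - bo X n i)))).
rewrite [RHS](big_nat_widen _ _ (rho n)) ?(ltnW (ltn_ord i'))//.
by apply: eq_bigr => i _; congr corr; ring.
Qed.

(** A time below [H n] reaches the neighbouring copy only, and overlaps it on a length at most
    [t]. *)
Lemma tail_bound n t : 0 <= t -> t <= H n ->
  `|corr n.+1 t - (rho n)%:R * corr n t| <= (rho n)%:R * t.
Proof.
move=> t0 tH; rewrite corrS_gaps// addrC addKr; have Hn := H_gt0 X n.
have r0 : (0 < rho n)%N by rewrite (leq_trans _ (cuts_ge2 X n)).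
rewrite (bigD1 (Ordinal r0))//= [X in _ + X]big1 ?addr0 => [|k kn0]; last first.
  apply: big1 => i _; apply: corr_eq0; have := le_gap n i k.+1.
  have : 2 * H n <= k.+1%:R * H n.
    by rewrite ler_pM2r// ler_nat ltnS lt0n; exact: kn0.
  move=> h1 h2; rewrite ler0_norm; lra.
apply: le_trans (ler_norm_sum _ _ _) _.
apply: (@le_trans _ _ (\sum_(i < rho n - 1) t)); last first.
  by rewrite sumr_const card_ord -[t *+ _]mulr_natl ler_wpM2r// ler_nat leq_subr.
apply: ler_sum => i _; have := le_gap n i 1; rewrite mul1r => hg.
have [hs|hs] := leP (- H n) (t - gap n i 1).
  by apply: le_trans (corr_le_overlap hs _) _; lra.
by rewrite corr_eq0 ?normr0//; rewrite ler0_norm; lra.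
Qed.

Definition average (n L d : nat) (z : R) : R :=
  \sum_(l < L) W X 0 n F (z - l%:R * (q * d%:R)).

Lemma average_nice n L d : nice (average n L d).
Proof. by apply: nice_sum => l; apply: nice_shift; exact: nice_W. Qed.

Lemma corr_gap_shift n t K i m :
  t - gap n (i + m) K = t - gap n i K - m%:R * (q * K%:R).
Proof. by rewrite !gapE natrD; ring. Qed.

Lemma sum_shift_le (N m M : nat) (a : nat -> R) : (m <= M)%N ->
  `|\sum_(i < N) a i - \sum_(i < N) a (i + m)%N| <=
    \sum_(i < M) `|a i| + \sum_(i < M) `|a (N + i)%N|.
Proof.
move=> mM.
have -> : \sum_(i < N) a i - \sum_(i < N) a (i + m)%N =
    \sum_(i < m) a i - \sum_(i < m) a (N + i)%N.
  apply/eqP; rewrite subr_eq addrAC eq_sym subr_eq; apply/eqP.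
  transitivity (\sum_(i < m + N) a i).
    rewrite big_split_ord/=; congr (_ + _).
    by apply: eq_bigr => i _; rewrite addnC.
  by rewrite addnC big_split_ord/=.
apply: le_trans (ler_normB _ _) _.
have le (b : nat -> R) : `|\sum_(i < m) b i| <= \sum_(i < M) `|b i|.
  apply: le_trans (ler_norm_sum _ _ _) _; rewrite -(subnKC mM) big_split_ord/= lerDl.
  by apply: sumr_ge0.
by apply: lerD; [exact: le|exact: (le (fun i => a (N + i)%N))].
Qed.

(* Averaging over the subcolumn index [i] along a progression of step [p]:   *)
(* moving from [i] to [i + p] shifts the time by [q * K * p].                *)
Lemma averaging n t K p L N cnt : (0 < L)%N -> 0 <= cnt ->
  (forall z, \sum_(i < N) cell (- H n) 0 (z - (t - gap n i K)) <= cnt) ->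
  `|\sum_(i < N) corr n (t - gap n i K)| <=
   (\sum_(i < p * L) `|corr n (t - gap n i K)| +
    \sum_(i < p * L) `|corr n (t - gap n (N + i) K)|) +
   cnt / L%:R * Int (fun z => `|average n L (K * p) z|).
Proof.
move=> L0 cnt0 hcnt; pose a i := corr n (t - gap n i K).
have LR : 0 < L%:R :> R by rewrite ltr0n.
have nA : nice (fun z => `|average n L (K * p) z|) by apply: nice_norm; exact: average_nice.
set E := _ + \sum_(i < p * L) _.
(* The sum over [i] is replaced by the mean of its translates by [p * l]; only terms near the two
   ends change. *)
have h1 : `|L%:R * \sum_(i < N) a i - \sum_(l < L) \sum_(i < N) a (i + p * l)%N| <= L%:R * E.
  have -> : L%:R * \sum_(i < N) a i = \sum_(l < L) \sum_(i < N) a i.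
    by rewrite sumr_const card_ord mulr_natl.
  rewrite -sumrB; apply: le_trans (ler_norm_sum _ _ _) _.
  apply: (@le_trans _ _ (\sum_(l < L) E)); last by rewrite sumr_const card_ord mulr_natl.
  by apply: ler_sum => l _; apply: sum_shift_le; rewrite leq_mul2l ltnW ?orbT.
have ng i : nice (fun y => g n y * average n L (K * p) (y + (t - gap n i K))).
  by apply: niceM; [exact: nice_W|apply: nice_shift; exact: average_nice].
have nc i : nice (fun z => cell (- H n) 0 (z - (t - gap n i K)) * `|average n L (K * p) z|).
  by apply: niceM => //; apply: nice_shift; exact: nice_ind.
(* For fixed [i], the translates add up to one correlation with [average]. The window of integration
   depends on [i], and [cnt] bounds how many windows overlap. *)
have h2 : `|\sum_(l < L) \sum_(i < N) a (i + p * l)%N| <=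
    cnt * Int (fun z => `|average n L (K * p) z|).
  rewrite exchange_big/=; apply: le_trans (ler_norm_sum _ _ _) _.
  apply: (@le_trans _ _ (\sum_(i < N)
     Int (fun z => cell (- H n) 0 (z - (t - gap n i K)) * `|average n L (K * p) z|))).
    apply: ler_sum => i _.
    have -> : \sum_(l < L) a (i + p * l)%N =
        Int (fun y => g n y * average n L (K * p) (y + (t - gap n i K))).
      transitivity (Int (fun y => \sum_(l < L)
         g n y * f n (y + (t - gap n (i + p * l) K)))).
        by rewrite Int_sum// => l; exact: corr_nice.
      congr Int; apply/funext => y; rewrite mulr_sumr; apply: eq_bigr => l _.
      by rewrite corr_gap_shift; congr (_ * W _ _ _ _ _); rewrite !natrM; ring.
    apply: le_trans (ler_norm_Int (ng i)) _.
    rewrite -(Int_shift (t - gap n i K) (nc i)).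
    apply: ler_Int => [||y]; [exact: nice_norm (ng i)|exact: nice_shift (nc i)|].
    rewrite addrK normrM ler_wpM2r//; exact: W_cell_bound.
  rewrite -Int_sum// -IntZ//; apply: ler_Int => [||z]; [exact: nice_sum|exact: niceZ|].
  by rewrite -mulr_suml ler_wpM2r//; exact: hcnt.
rewrite -(ler_pM2l LR) mulrDr.
have -> : L%:R * (cnt / L%:R * Int (fun z => `|average n L (K * p) z|)) =
  cnt * Int (fun z => `|average n L (K * p) z|) by field; rewrite gt_eqF.
rewrite -[L%:R in leLHS]ger0_norm ?(ltW LR)// -normrM.
rewrite -[L%:R * _](subrK (\sum_(l < L) \sum_(i < N) a (i + p * l)%N)).
by apply: le_trans (ler_normD _ _) _; apply: lerD.
Qed.

(** For a fixed starting copy, different index differences lead to different copies, so the sum over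
    all of them costs one tower height. *)
Lemma boundary_lower n t N M m (P : pred nat) :
  \sum_(k < M | P k) \sum_(i < m) `|corr n (t - gap n i (N + k))| <= m%:R * H n.
Proof.
have -> : m%:R * H n = \sum_(i < m) H n by rewrite sumr_const card_ord mulr_natl.
rewrite exchange_big/=.
apply: ler_sum => i _; apply: le_trans (sum_corr_below n (t + bo X n i) (i + N + M)).
rewrite [leRHS]big_split_ord/= big_mkcond/=; apply: ler_wpDl; first exact: sumr_ge0.
apply: ler_sum => k _; case: ifP => // _.
by rewrite le_eqVlt; apply/orP; left; apply/eqP; congr `|corr _ _|; rewrite /gap addnA; ring.
Qed.

Lemma boundary_upper n t N m (P : pred nat) :
  \sum_(k < N | P k) \sum_(i < m) `|corr n (t - gap n (N - k.+1 + i) k.+1)| <= m%:R * H n.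
Proof.
have -> : m%:R * H n = \sum_(i < m) H n by rewrite sumr_const card_ord mulr_natl.
rewrite exchange_big/=.
apply: ler_sum => i _; apply: le_trans (sum_corr_above n (t - bo X n (N + i)) (i + N)).
rewrite [leRHS]big_split_ord/= big_mkcond/=; apply: ler_wpDl; first exact: sumr_ge0.
rewrite [leRHS](reindex_inj rev_ord_inj)/=.
apply: ler_sum => k _; case: ifP => // _; have kN := ltn_ord k.
rewrite le_eqVlt; apply/orP; left; apply/eqP; congr `|corr _ _|; rewrite /gap.
rewrite (_ : (N - k.+1 + i + k.+1)%N = (N + i)%N); last by lia.
by rewrite (_ : (i + (N - k.+1))%N = (N - k.+1 + i)%N); [ring|lia].
Qed.

(** [P] selects the index differences that can contribute. The boundary cost does not involve their
    number, by disjointness of the copies. *)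
Lemma correlation_bound n t p L cnt (P : pred nat) : 0 <= t -> (0 < L)%N -> 0 <= cnt ->
  (forall k, (k < rho n)%N -> ~~ P k -> forall i, (i < rho n - k.+1)%N ->
     corr n (t - gap n i k.+1) = 0) ->
  (forall k, (k < rho n)%N -> P k ->
     forall z, \sum_(i < rho n - k.+1) cell (- H n) 0 (z - (t - gap n i k.+1)) <= cnt) ->
  `|corr n.+1 t - (rho n)%:R * corr n t| <= 2 * ((p * L)%:R * H n) +
    \sum_(k < rho n | P k) (cnt / L%:R * Int (fun z => `|average n L (k.+1 * p) z|)).
Proof.
move=> t0 L0 cnt0 hP hcnt; rewrite corrS_gaps// addrC addKr.
rewrite (bigID (fun k : 'I_(rho n) => P k))/= [X in _ + X]big1 ?addr0; last first.
  by move=> k nP; apply: big1 => i _; exact: hP.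
apply: le_trans (ler_norm_sum _ _ _) _.
apply: (@le_trans _ _ (\sum_(k < rho n | P k)
   ((\sum_(i < p * L) `|corr n (t - gap n i k.+1)| +
     \sum_(i < p * L) `|corr n (t - gap n (rho n - k.+1 + i) k.+1)|) +
    cnt / L%:R * Int (fun z => `|average n L (k.+1 * p) z|)))).
  by apply: ler_sum => k Pk; apply: averaging => //; exact: hcnt.
rewrite !big_split/= lerD2r mulr_natl mulr2n.
apply: lerD; last exact: boundary_upper.
exact: (boundary_lower n t 1).
Qed.

End Correlations.

(** * Times comparable with the height of a tower *)

Section MixingTimes.
Variables (R : realType) (X : tower R).
Notation rho := (cuts X).
Notation q := (spacer X).
Notation H := (th X).
Notation D := (td X).
Notation M := (mass X).

Definition ev (P : nat -> Prop) := exists n0, forall n, (n0 <= n)%N -> P n.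

Lemma evI P Q : ev P -> ev Q -> ev (fun n => P n /\ Q n).
Proof.
move=> [a ha] [b hb]; exists (maxn a b) => n; rewrite geq_max => /andP[an bn].
by split; [exact: ha|exact: hb].
Qed.

Lemma ev_pred P : ev P -> ev (fun n => P n.-1).
Proof. by move=> [a ha]; exists a.+1 => n an; apply: ha; lia. Qed.

Lemma ev_ge m : ev (fun n => m <= n)%N. Proof. by exists m. Qed.

Lemma ev_cuts (c : R) : ev (fun n => c <= (rho n)%:R).
Proof.
have [n0 h] := cuts_infty X (Num.truncn c).+1; exists n0 => n /h hn.
by apply/ltW/(lt_le_trans (truncnS_gt c)); rewrite ler_nat.
Qed.

Lemma ev_small (e : R) : 0 < e -> ev (fun n => (rho n)%:R <= e * H n).
Proof. exact: cuts_small. Qed.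

Lemma ev_height (c : R) : ev (fun n => c <= H n).
Proof.
exists (Num.truncn (c / base X)) => n hn; have b0 := base_gt0 X.
apply: le_trans (D_le_H X n); rewrite -ler_pdivrMr//.
apply: le_trans (td_ge X n); apply/ltW/(lt_le_trans (truncnS_gt _)).
by rewrite ler_nat.
Qed.

Lemma HS_le n : q * (rho n)%:R <= H n -> H n.+1 <= 2 * (rho n)%:R * H n.
Proof.
move=> h; rewrite -[H n.+1]/(bo X n (rho n)) /bo /offset.
have hb : ('C(rho n, 2))%:R <= (rho n)%:R * (rho n)%:R :> R.
  by rewrite -natrM ler_nat bin2; case: (rho n) => //= k; rewrite -divn2; nia.
have q0 := spacer_gt0 X; have r0 : 0 <= (rho n)%:R :> R by [].
nra.
Qed.

Lemma card_ord_lt (n m : nat) : (#|[pred k : 'I_n | (k < m)%N]| <= m)%N.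
Proof.
rewrite -sum1_card big_mkcond -(big_mkord xpredT (fun k => if (k < m)%N then 1 else 0)%N)/=.
suff -> : (\sum_(0 <= k < n) (if k < m then 1 else 0) = minn n m)%N by rewrite geq_minr.
elim: n => [|n IHn]; first by rewrite big_nil; lia.
by rewrite big_nat_recr//= IHn; case: ltnP; lia.
Qed.

Section ZeroMean.
Variable F : R -> R.
Hypotheses (nF : nice F) (F1 : forall x, `|F x| <= cell (- H 0) 0 x) (UF : UE X F 0).

Lemma average_le_L n L d z : `|average X F n L d z| <= L%:R.
Proof.
apply: le_trans (ler_norm_sum _ _ _) _; rewrite -[L in leRHS]card_ord -sumr_const.
apply: ler_sum => l _; apply: le_trans (W_cell_bound F1 _ _) _; exact: cell_le1.
Qed.

Lemma average_support n L d z c : (forall z, `|average X F n L d z| <= c) ->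
  `|average X F n L d z| <= c * cell (- H n) (L%:R * (q * d%:R)) z.
Proof.
move=> hc; have q0 := spacer_gt0 X; rewrite /cell; case: ifPn => hz.
  by rewrite mulr1.
rewrite mulr0 normr_le0 /average big1// => l _; apply/eqP; rewrite -normr_le0.
apply: le_trans (W_cell_bound F1 _ _) _; rewrite /cell ifF//; apply/negP => /andP[h1 h2].
move/negP: hz; apply; have h3 : 0 <= l%:R * (q * d%:R).
  by rewrite !mulr_ge0// ltW.
have h4 : l%:R * (q * d%:R) <= L%:R * (q * d%:R).
  by rewrite ler_wpM2r ?mulr_ge0 ?(ltW q0)// ler_nat ltnW.
by apply/andP; split; lra.
Qed.

Lemma Int_average n L d c : 0 <= c -> (forall z, `|average X F n L d z| <= c) ->
  Int (fun z => `|average X F n L d z|) <= c * (H n + L%:R * (q * d%:R)).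
Proof.
move=> c0 hc; have q0 := spacer_gt0 X; have Hn := H_gt0 X n.
have Lq : 0 <= L%:R * (q * d%:R) by rewrite !mulr_ge0// ltW.
rewrite (_ : H n + _ = L%:R * (q * d%:R) - (- H n)); last by ring.
apply: ler_Int_bound => //; [exact: nice_norm (average_nice _ nF _ _ _)|lra|].
by move=> z; exact: average_support.
Qed.

Lemma uniform_averages_upto m e : 0 < e -> exists n1 L0, forall n L, (n1 <= n)%N ->
  (L0 <= L)%N -> forall d, (0 < d < m)%N -> forall y,
    `|\sum_(l < L) W X 0 n F (y + l%:R * (q * d%:R))| <= e * L%:R.
Proof.
move=> e0; elim: m => [|m [n1 [L1 IHm]]].
  by exists 0%N, 0%N => n L _ _ d; rewrite ltn0 andbF.
have [->|m0] := posnP m.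
  by exists 0%N, 0%N => n L _ _ [|d]; rewrite ?ltnS ?ltn0 ?andbF.
have [n2 [L2 h2]] := uniform_averages F1 UF m0 e0.
exists (maxn n1 n2), (maxn L1 L2) => n L; rewrite !geq_max => /andP[nn1 nn2].
move=> /andP[LL1 LL2] d /andP[d0]; rewrite ltnS leq_eqVlt => /orP[/eqP->|dm] y.
  exact: h2.
by apply: IHm => //; rewrite d0.
Qed.

Lemma average_sup n L d c :
  (forall y, `|\sum_(l < L) W X 0 n F (y + l%:R * (q * d%:R))| <= c) ->
  forall z, `|average X F n L d z| <= c.
Proof.
move=> h z; apply: le_trans (h (z - (L%:R - 1) * (q * d%:R))).
rewrite le_eqVlt; apply/orP; left; apply/eqP; congr `|_|.
rewrite /average (reindex_inj rev_ord_inj)/=; apply: eq_bigr => l _.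
by congr W; rewrite natrB ?ltn_ord// -natr1; ring.
Qed.

Section Pair.
Variable G : R -> R.
Hypotheses (nG : nice G) (G1 : forall x, `|G x| <= cell (- H 0) 0 x).
Notation C := (corr X F G).

(** At most [B.+1] index differences reach such a time, so equidistribution for finitely many steps,
    with a common threshold, is enough. *)
Lemma bounded_times B e : 0 < e -> ev (fun n => forall t, 0 <= t -> t <= B%:R * H n ->
  `|C n.+1 t - (rho n)%:R * C n t| <= e * D n.+1).
Proof.
move=> e0; have M0 := mass_gt0 X; have q0 := spacer_gt0 X.
have B0 : 0 < B.+1%:R :> R by rewrite ltr0n.
(* Each of the [B.+1] differences contributes at most 2 r e' M D_n; together they use half of the
   tolerance, the boundary terms the other half. *)
have e1 : 0 < e / (4 * B.+1%:R * M) by rewrite divr_gt0// !mulr_gt0//; lra.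
have [n1 [L0 hn1]] := uniform_averages_upto B.+2 e1.
have [L [L1 LL0]] : exists L, (0 < L)%N /\ (L0 <= L)%N.
  by exists (maxn L0 1); rewrite leq_max orbT leq_maxl.
have LR : 0 < L%:R :> R by rewrite ltr0n.
have [n0 hn0] := evI (ev_ge n1) (evI (ev_cuts (4 * L%:R * M / e))
  (ev_height (L%:R * (q * B.+1%:R)))).
exists n0 => n /hn0[nn1 [hr hH]] t t0 tB.
have Hn := H_gt0 X n; have Dn := D_gt0 X n; have r0 := rho_gt0 X n.
have HM := H_mass X n.
set e' := e / _ in e1 hn1.
apply: le_trans (correlation_bound nF nG F1 G1 1 (P := fun k => (k <= B)%N)
  t0 L1 (ltW r0) _ _) _.
- move=> k kr; rewrite -ltnNge => Bk i ik; apply: (corr_eq0 nF nG F1 G1).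
  have := le_gap X n i k.+1.
  have : (B.+2)%:R * H n <= k.+1%:R * H n by rewrite ler_pM2r// ler_nat.
  rewrite -2!natr1 => h1 h2; rewrite ler0_norm; nra.
- move=> k kr kB z; apply: (@le_trans _ _ (\sum_(i < rho n - k.+1) 1)).
    by apply: ler_sum => i _; exact: cell_le1.
  by rewrite sumr_const card_ord ler_nat leq_subr.
rewrite mul1n.
have hk k : (k < B.+1)%N ->
    (rho n)%:R / L%:R * Int (fun z => `|average X F n L (k.+1 * 1) z|) <=
    (rho n)%:R * (e' * (2 * H n)).
  move=> kB; rewrite muln1 -mulrA ler_pM2l// mulrC ler_pdivrMr//.
  apply: le_trans (Int_average (c := e' * L%:R) _ _) _.
  - by rewrite mulr_ge0// ltW.
  - by apply: average_sup; apply: hn1.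
  have : L%:R * (q * k.+1%:R) <= L%:R * (q * B.+1%:R).
    by rewrite ler_pM2l// ler_pM2l// ler_nat.
  move=> h; rewrite (_ : e' * (2 * H n) * L%:R = e' * L%:R * (2 * H n)); last by ring.
  have eL : 0 < e' * L%:R by exact: mulr_gt0.
  rewrite ler_pM2l//; have {h} := le_trans h hH.
  by set z := L%:R * (_ * _) => zH; lra.
have hsum : \sum_(k < rho n | (k <= B)%N)
    ((rho n)%:R / L%:R * Int (fun z => `|average X F n L (k.+1 * 1) z|)) <=
    B.+1%:R * ((rho n)%:R * (e' * (2 * H n))).
  apply: (@le_trans _ _ (\sum_(k < rho n | (k < B.+1)%N) ((rho n)%:R * (e' * (2 * H n))))).
    by apply: ler_sum => k kB; exact: hk.
  rewrite sumr_const -[leLHS]mulr_natl ler_wpM2r//.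
    by do 2?[apply: mulr_ge0; rewrite ?ler0n ?(ltW e1)//]; lra.
  by rewrite ler_nat; apply: leq_trans (card_ord_lt _ _) _.
apply: le_trans (lerD (lexx _) hsum) _.
rewrite DS; have B1 : B.+1%:R * e' = e / (4 * M) by rewrite /e'; field; rewrite !gt_eqF.
have k1 : 2 * (L%:R * H n) <= e / 2 * (D n * (rho n)%:R).
  have : 4 * L%:R * M <= e * (rho n)%:R by move: hr; rewrite ler_pdivrMr// [e * _]mulrC.
  move=> h; have : 4 * L%:R * H n <= 4 * L%:R * (M * D n) by rewrite ler_wpM2l// mulr_ge0.
  move=> h'; have : 4 * L%:R * M * D n <= e * (rho n)%:R * D n by rewrite ler_pM2r.
  by lra.
have k2 : B.+1%:R * ((rho n)%:R * (e' * (2 * H n))) <= e / 2 * (D n * (rho n)%:R).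
  rewrite (_ : _ * _ = (B.+1%:R * e') * 2 * (rho n)%:R * H n); last by ring.
  rewrite B1; apply: (@le_trans _ _ (e / (4 * M) * 2 * (rho n)%:R * (M * D n))).
    have c0 : 0 <= e / (4 * M) by rewrite divr_ge0 ?(ltW e0)//; lra.
    by apply: ler_wpM2l => //; apply: mulr_ge0 => //; apply: mulr_ge0.
  by rewrite le_eqVlt; apply/orP; left; apply/eqP; field; rewrite gt_eqF.
by lra.
Qed.

(** Decay is obtained at stage [a.+1] and then propagated: each further stage adds an error
    proportional to [s], and these are geometrically summable relative to [D n]. *)
Lemma short_times B e : 0 < e -> ev (fun a => forall n s, (a < n)%N -> H a <= s ->
  s <= B%:R * H a -> `|C n s| <= e * D n).
Proof.
move=> e0; have M0 := mass_gt0 X; have e2 : 0 < e / 2 by lra.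
have [n0 hn0] := evI (bounded_times B e2) (evI (ev_cuts B%:R) (ev_cuts (4 * B%:R * M / e))).
exists n0 => a /hn0[h1 [hB hr]] n s an Hs sB.
have Ha := H_gt0 X a; have s0 : 0 <= s by lra.
have Da := D_gt0 X a; have ra := rho_gt0 X a.
have Ca : `|C a.+1 s| <= e / 2 * D a.+1.
  have := h1 s s0 sB; rewrite (corr_eq0 nF nG F1 G1 (n := a)) ?mulr0 ?subr0//.
  by rewrite ger0_norm.
have sH : s <= H a.+1.
  by apply: le_trans sB _; apply: le_trans (le_HS X a); rewrite ler_pM2r.
have Da1 := D_gt0 X a.+1.
pose E n := D n / D a.+1.
(* The term [- 1] makes the induction close: the new error r s is absorbed because every stage has r
   >= 2. *)
have hC : `|C n s| <= D n * (e / 2) + 2 * s * (E n - 1).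
  rewrite -(subnKC an); elim: (n - a.+1)%N => [|k IHk].
    by rewrite addn0 /E divff ?gt_eqF// subrr mulr0 addr0 mulrC.
  rewrite addnS; set m := (a.+1 + k)%N in IHk *.
  have sm : s <= H m by apply: le_trans sH _; apply: H_le; rewrite /m leq_addr.
  have := tail_bound nF nG F1 G1 s0 sm; have rm := rho_gt0 X m.
  have r2 : 2 <= (rho m)%:R :> R by rewrite ler_nat cuts_ge2.
  move=> ht; rewrite -[C m.+1 s](subrK ((rho m)%:R * C m s)).
  apply: le_trans (ler_normD _ _) _; rewrite normrM (ger0_norm (ltW rm)).
  have h3 := ler_wpM2l (ltW rm) IHk.
  apply: le_trans (lerD ht h3) _.
  have -> : E m.+1 = E m * (rho m)%:R by rewrite /E DS; ring.
  rewrite DS; have : 2 * s <= (rho m)%:R * s by rewrite ler_wpM2r.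
  by lra.
have En : D n * (2 * s / D a.+1) = 2 * s * E n by rewrite /E; ring.
have : 2 * s / D a.+1 <= e / 2.
  rewrite ler_pdivrMr// DS; have HM := H_mass X a.
  have h4 : 4 * B%:R * M * D a <= e * (rho a)%:R * D a.
    by rewrite ler_pM2r//; move: hr; rewrite ler_pdivrMr// [e * _]mulrC.
  have h5 : B%:R * H a <= B%:R * (M * D a) by rewrite ler_wpM2l.
  by lra.
move=> /(ler_wpM2l (ltW (D_gt0 X n))); rewrite En => h6.
by apply: le_trans hC _; lra.
Qed.

End Pair.
End ZeroMean.
End MixingTimes.

(** * Second moments of averages and the case of many index differences *)

Section LongRange.
Variables (R : realType) (X : tower R).
Notation rho := (cuts X).
Notation q := (spacer X).
Notation H := (th X).
Notation D := (td X).
Notation M := (mass X).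
Variables F G : R -> R.
Hypotheses (nF : nice F) (nG : nice G).
Hypotheses (F1 : forall x, `|F x| <= cell (- H 0) 0 x)
           (G1 : forall x, `|G x| <= cell (- H 0) 0 x).
Hypothesis UF : UE X F 0.
Notation C := (corr X F G).
Notation CF := (corr X F F).
Notation average := (average X F).

(** In natural numbers [l - l' + (l' - l)] is the distance of the indices; both orders give the same
    autocorrelation. *)
Lemma Int_average_sq n L d : Int (fun z => average n L d z ^+ 2) =
  \sum_(l < L) \sum_(l' < L) CF n ((l - l' + (l' - l))%N%:R * (q * d%:R)).
Proof.
pose f := W X 0 n F; pose u := q * d%:R.
have nf : nice f by exact: nice_W.
have nn (l l' : 'I_L) : nice (fun z => f (z - l%:R * u) * f (z - l'%:R * u)).
  by apply: niceM; exact: nice_shift.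
transitivity (Int (fun z => \sum_(l < L) \sum_(l' < L) f (z - l%:R * u) * f (z - l'%:R * u))).
  by congr Int; apply/funext => z; rewrite expr2 /average big_distrlr.
rewrite Int_sum => [|l]; last exact: nice_sum.
apply: eq_bigr => l _; rewrite Int_sum//; apply: eq_bigr => l' _.
have [ll'|l'l] := leqP l l'.
  rewrite (corr_shift X nF nF _ _ (- (l'%:R * u))) (_ : (l - l' + (l' - l))%N = (l' - l)%N); last by lia.
  congr Int; apply/funext => z; rewrite mulrC; congr (_ * f _).
  by rewrite natrB//; rewrite /u; ring.
rewrite (corr_shift X nF nF _ _ (- (l%:R * u))) (_ : (l - l' + (l' - l))%N = (l - l')%N); last by lia.
congr Int; apply/funext => z; congr (_ * f _).
by rewrite natrB 1?ltnW//; rewrite /u; ring.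
Qed.

Lemma sum_distance_le L (c : nat -> R) (C0 E : R) : 0 <= E -> c 0%N <= C0 ->
  (forall d, (0 < d < L)%N -> c d <= E) ->
  \sum_(l < L) \sum_(l' < L) c (l - l' + (l' - l))%N <= L%:R * C0 + L%:R ^+ 2 * E.
Proof.
move=> E0 c0 cE; rewrite (_ : _ + _ = \sum_(l < L) (C0 + L%:R * E)); last first.
  by rewrite sumr_const card_ord -[RHS]mulr_natl; ring.
apply: ler_sum => l _; rewrite (bigD1 l)//= subnn addn0; apply: lerD => //.
apply: (@le_trans _ _ (\sum_(l' < L) E)); last by rewrite sumr_const card_ord mulr_natl.
rewrite [leRHS](bigD1 l)//=; apply: ler_wpDl => //; apply: ler_sum => l' ll'.
by apply: cE; move: ll'; rewrite -val_eqE/= => ll'; have := ltn_ord l; have := ltn_ord l'; lia.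
Qed.

(** From |A| <= lam L / 2 + A^2 / (2 lam L) on the support, of length at most 2 H_n. The square,
    unlike the absolute value, expands into autocorrelations. *)
Lemma Int_average_amgm n L d (lam : R) : (0 < L)%N -> 0 < lam ->
  L%:R * (q * d%:R) <= H n ->
  Int (fun z => `|average n L d z|) <=
    lam * L%:R * H n + Int (fun z => average n L d z ^+ 2) / (2 * lam * L%:R).
Proof.
move=> L0 lam0 LH; have LR : 0 < L%:R :> R by rewrite ltr0n.
have q0 := spacer_gt0 X; have Hn := H_gt0 X n.
have Lq : 0 <= L%:R * (q * d%:R) by rewrite !mulr_ge0// ltW.
have lL : 0 < lam * L%:R by rewrite mulr_gt0.
have nA := average_nice X nF n L d.
have nA2 : nice (fun z => average n L d z ^+ 2).
  by have := niceM nA nA; congr nice; apply/funext => z; rewrite expr2.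
have nc : nice (cell (- H n) (L%:R * (q * d%:R))) by exact: nice_ind.
apply: (@le_trans _ _ (Int (fun z => lam * L%:R / 2 * cell (- H n) (L%:R * (q * d%:R)) z +
    (2 * lam * L%:R)^-1 * average n L d z ^+ 2))).
  apply: ler_Int => [||z]; [exact: nice_norm|by apply: niceD; exact: niceZ|].
  have := @average_support _ X F F1 n L d z _ (average_le_L F1 n L d).
  have ab (a : R) : 0 <= a -> a <= lam * L%:R / 2 + (2 * lam * L%:R)^-1 * a ^+ 2.
    move=> a0; rewrite -(ler_pM2l lL).
    have -> : lam * L%:R * (lam * L%:R / 2 + (2 * lam * L%:R)^-1 * a ^+ 2) =
       (lam * L%:R) ^+ 2 / 2 + a ^+ 2 / 2 by field; rewrite !gt_eqF.
    by have := sqr_ge0 (lam * L%:R - a); lra.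
  rewrite /cell; case: ifP => _ h.
    by rewrite mulr1 -(real_normK (num_real (average n L d z))); exact: ab.
  move: h; rewrite mulr0 normr_le0 => /eqP ->.
  by rewrite normr0 mulr0 add0r expr0n/= mulr0.
rewrite IntD; [|exact: niceZ|exact: niceZ]; rewrite !IntZ// Int_ind; last lra.
apply: lerD; last by rewrite mulrC.
have : L%:R * (q * d%:R) - - H n <= 2 * H n by lra.
by move=> /(ler_wpM2l (ltW lL)); lra.
Qed.

Section Time.
Variables (n : nat) (t : R).
Notation r := (rho n)%:R.
Definition tau : R := t / H n.
(** Relative lengthening by spacers: passing over K copies takes a time between K H_n and K (1 +
    kap) H_n. *)
Definition kap : R := 2 * q * r / H n.
(** The index differences K = k + 1 for which a gap within H_n of [t] is not excluded by these two
    bounds. *)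
Definition active (k : nat) : bool :=
  (k.+1%:R < tau + 1) && (tau - 1 < k.+1%:R * (1 + kap)).
Hypotheses (rH : 16 * q * r <= H n) (Ht : H n <= t) (tH : t < H n.+1).

Lemma tauE : t = tau * H n.
Proof. by rewrite /tau divfK// gt_eqF// H_gt0. Qed.

Lemma kapE : kap * H n = 2 * q * r.
Proof. by rewrite /kap divfK// gt_eqF// H_gt0. Qed.

Lemma kap_gt0 : 0 < kap.
Proof. by rewrite /kap divr_gt0 ?H_gt0// !mulr_gt0 ?rho_gt0 ?spacer_gt0. Qed.

Lemma kap_le : kap <= 1/8.
Proof. by move: rH; rewrite /kap ler_pdivrMr ?H_gt0//; lra. Qed.

Lemma tau_ge1 : 1 <= tau.
Proof. by rewrite /tau ler_pdivlMr ?H_gt0// mul1r. Qed.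

Lemma tau_le : tau <= 2 * r.
Proof.
rewrite /tau ler_pdivrMr ?H_gt0//; apply/ltW/(lt_le_trans tH); apply: HS_le.
have : 0 < q * r by rewrite mulr_gt0 ?rho_gt0 ?spacer_gt0.
by move: rH; lra.
Qed.

Lemma inactive k i : (k < rho n)%N -> ~~ active k -> (i < rho n - k.+1)%N ->
  C n (t - gap X n i k.+1) = 0.
Proof.
move=> kr; rewrite negb_and -!leNgt => na ir; apply: (corr_eq0 nF nG F1 G1).
have Hn := H_gt0 X n; have q0 := spacer_gt0 X; have tE := tauE; have kE := kapE.
case/orP: na => h.
  have := le_gap X n i k.+1; have := ler_wpM2r (ltW Hn) h; rewrite mulrDl mul1r -tE.
  by move=> h1 h2; rewrite ler0_norm; lra.
have iR : i%:R <= r :> R by rewrite ler_nat; lia.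
have kR : ('C(k.+1, 2))%:R <= k.+1%:R * r :> R.
  by rewrite -natrM ler_nat bin2 -divn2 /=; nia.
have := ler_wpM2r (ltW Hn) h; rewrite mulrBl mul1r -tE -mulrA mulrDl mul1r kE => h1.
have : gap X n i k.+1 <= k.+1%:R * (H n + 2 * q * r).
  rewrite gapE; have : k.+1%:R * i%:R <= k.+1%:R * r :> R by rewrite ler_wpM2l.
  move=> /(ler_wpM2l (ltW q0)) h2; have := ler_wpM2l (ltW q0) kR.
  rewrite mulrDr; set a := k.+1%:R; lra.
by move=> h2; rewrite ger0_norm; lra.
Qed.

Lemma active_ge k : 3 <= tau -> active k -> tau / 3 <= k.+1%:R.
Proof.
move=> t3 /andP[_ h]; have k0 := kap_le; have k1 := kap_gt0.
have : 0 < k.+1%:R :> R by [].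
nra.
Qed.

Lemma active_le k : active k -> k.+1%:R <= 2 * tau.
Proof. by move=> /andP[h _]; have := tau_ge1; lra. Qed.

(** The number of active differences is of order kap tau, which is therefore the parameter
    separating the two regimes. *)
Lemma active_window Q : kap * tau + 3 <= Q%:R ->
  exists K0, forall k, active k -> (K0 <= k.+1 < K0 + Q)%N.
Proof.
move=> hQ; have k0 := kap_le; have k1 := kap_gt0; have t1 := tau_ge1.
have z0 : 0 <= (tau - 1) / (1 + kap) by rewrite divr_ge0//; lra.
exists (Num.truncn ((tau - 1) / (1 + kap))) => k /andP[h1 h2].
have := truncn_itv z0; set K0 := Num.truncn _; rewrite -natr1.
rewrite ler_pdivlMr ?ltr_pdivrMr; [|lra|lra] => /andP[h3 h4].
rewrite -!(ltr_nat R) -(ler_nat R) natrD; apply/andP; split.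
  by rewrite -(@ler_pM2r _ (1 + kap)); lra.
have : K0%:R + 1 >= tau - 1 - kap * tau.
  have K00 : 0 <= K0%:R :> R by [].
  have : (tau - 1 - kap * tau) * (1 + kap) <= tau - 1 by nra.
  by move=> h5; rewrite -(@ler_pM2r _ (1 + kap)); lra.
by lra.
Qed.

(** As [i] varies the windows move by q K, at least q tau / 3. The extra 1 in the count is absorbed
    because q tau <= H_n. *)
Lemma active_count k z : 3 <= tau -> active k ->
  \sum_(i < rho n - k.+1) cell (- H n) 0 (z - (t - gap X n i k.+1)) <= 4 * H n / (q * tau).
Proof.
move=> t3 ak; have Hn := H_gt0 X n; have q0 := spacer_gt0 X.
have kk := active_ge t3 ak; have tr := tau_le.
have tq : 0 < q * tau by rewrite mulr_gt0//; lra.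
have K0 : 0 < k.+1%:R :> R by [].
have s0 : 0 < q * k.+1%:R by rewrite mulr_gt0.
rewrite (eq_bigr (fun i : 'I__ => cell (- H n) 0
   ((z - t + k.+1%:R * H n + q * 'C(k.+1, 2)%:R) + i%:R * (q * k.+1%:R)))); last first.
  by move=> i _; congr cell; rewrite gapE; ring.
apply: le_trans (count_progression _ _ _ s0) _; first lra.
rewrite sub0r opprK.
have : H n / (q * k.+1%:R) <= 3 * H n / (q * tau).
  rewrite ler_pdivrMr// mulrAC ler_pdivlMr//.
  have : q * tau <= 3 * (q * k.+1%:R).
    by have := ler_wpM2l (ltW q0) kk; lra.
  by move=> /(ler_wpM2l (ltW Hn)); lra.
have : 1 <= H n / (q * tau).
  rewrite ler_pdivlMr// mul1r; have := ler_wpM2l (ltW q0) tr.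
  have : 0 < q * r by rewrite mulr_gt0// rho_gt0.
  by move: rH; lra.
rewrite -!mulrA; set a := H n * (q * tau)^-1; set b := H n * (q * _)^-1; lra.
Qed.

End Time.

(** The signed sum is kept inside the integral, where it is a sum of copies along a progression and
    hence small; individual autocorrelations need not be. *)
Lemma sum_corr_progression n Q d c s :
  (forall y, `|\sum_(j < Q) W X 0 n F (y + j%:R * (q * d%:R))| <= c) ->
  \sum_(j < Q) CF n (s + j%:R * (q * d%:R)) <= c * H n.
Proof.
move=> hc; pose f := W X 0 n F; have nf : nice f by exact: nice_W.
have c0 : 0 <= c by apply: le_trans (hc 0).
have ns : nice (fun y => \sum_(j < Q) f (y + (s + j%:R * (q * d%:R)))).
  by apply: nice_sum => j; exact: nice_shift.
have -> : \sum_(j < Q) CF n (s + j%:R * (q * d%:R)) =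
    Int (fun y => f y * \sum_(j < Q) f (y + (s + j%:R * (q * d%:R)))).
  rewrite -Int_sum => [|j]; last exact: corr_nice.
  by congr Int; apply/funext => y; rewrite mulr_sumr.
have Hn := H_gt0 X n; have -> : c * H n = c * (0 - (- H n)) by rewrite sub0r opprK.
apply: ler_Int_bound => //; [exact: niceM|lra|move=> y].
apply: le_trans (ler_norm _) _; rewrite normrM mulrC ler_pM//.
  rewrite (eq_bigr (fun j : 'I__ => f ((y + s) + j%:R * (q * d%:R)))) ?hc// => j _.
  by rewrite addrA.
exact: W_cell_bound.
Qed.

Lemma sum_window (h : nat -> R) (P : pred nat) N K0 Q : (forall m, 0 <= h m) ->
  (forall k, P k -> (K0 <= k.+1 < K0 + Q)%N) ->
  \sum_(k < N | P k) h k.+1 <= \sum_(j < Q) h (K0 + j)%N.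
Proof.
move=> h0 hP; pose g m := if (K0 <= m < K0 + Q)%N then h m else 0.
have g0 m : 0 <= g m by rewrite /g; case: ifP.
apply: (@le_trans _ _ (\sum_(m < N.+1) g m)).
  rewrite big_ord_recl; apply: ler_wpDl => //; rewrite big_mkcond/=.
  apply: ler_sum => k _; case: ifP => // Pk.
  by rewrite /g /bump/= add1n hP.
apply: (@le_trans _ _ (\sum_(m < N.+1 + (K0 + Q)) g m)).
  by rewrite big_split_ord/= lerDl sumr_ge0.
rewrite addnC !big_split_ord/= big1 ?add0r => [|i _]; last first.
  by rewrite /g leqNgt ltn_ord.
rewrite [X in _ + X]big1 ?addr0 => [|i _]; last first.
  by rewrite /g ifF//; apply/negP => /andP[_]; lia.
by apply: ler_sum => j _; rewrite /g leq_addr ltn_add2l ltn_ord.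
Qed.

Lemma ev_spacers (c : R) : 0 < c -> ev (fun n => c * q * (rho n)%:R <= H n).
Proof.
move=> c0; have q0 := spacer_gt0 X.
have e0 : 0 < (c * q)^-1 by rewrite invr_gt0 mulr_gt0.
have [n0 h] := ev_small X e0; exists n0 => n /h; rewrite mulrC ler_pdivlMr ?mulr_gt0//.
by rewrite mulrC.
Qed.

(* Many values of [K]: averaging over [K] as well, each progression of times  *)
(* [q * K * d] is handled by equidistribution.                                *)
Lemma regime_long e : 0 < e -> exists Q0 : R, ev (fun n => forall t, H n <= t ->
  t < H n.+1 -> Q0 <= kap n * tau n t -> `|C n.+1 t| <= e * D n.+1).
Proof.
move=> e0; have M0 := mass_gt0 X; have q0 := spacer_gt0 X.
(* The final bound is 16 r M D_n times at most 2 lam, half of the tolerance. *)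
pose lam := e / (64 * M); have lam0 : 0 < lam by rewrite divr_gt0//; lra.
have lam2 : 0 < lam ^+ 2 by rewrite exprn_gt0.
have [L [L0 hL]] : exists L : nat, (0 < L)%N /\ 1 <= lam ^+ 2 * L%:R.
  exists (Num.truncn (lam ^+ 2)^-1).+1; split => //; rewrite -(@ler_pM2l _ (lam ^+ 2)^-1) ?invr_gt0//.
  by rewrite mulKf ?gt_eqF// mulr1; exact/ltW/truncnS_gt.
have LR : 0 < L%:R :> R by rewrite ltr0n.
have [n1 [L1 hn1]] := uniform_averages_upto F1 UF L lam2.
have LL : 0 < 16 * L%:R :> R by lra.
have lam20 : 0 < 2 * lam by lra.
have lL : 0 < 2 * lam * L%:R by rewrite mulr_gt0.
have lL2 : 0 < 2 * lam * L%:R ^+ 2 by rewrite mulr_gt0// exprn_gt0.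
(* The value 4 gives Q <= kap tau + 4 <= 2 kap tau, and [L1] makes the window of differences long
   enough for equidistribution. *)
exists (Num.max 4 L1%:R).
have [n0 hn0] := evI (ev_ge n1) (evI (ev_spacers LL) (ev_cuts X (4 * L%:R * M / e))).
exists n0 => n /hn0[nn1 [hq hr]] t Ht tH; rewrite ge_max => /andP[kt4 ktL].
have Hn := H_gt0 X n; have Dn := D_gt0 X n; have r0 := rho_gt0 X n.
have L1R : 1 <= L%:R :> R by rewrite ler1n.
have qr0 : 0 < q * (rho n)%:R by rewrite mulr_gt0.
have hq16 : 16 * q * (rho n)%:R <= H n by nra.
have hqL : L%:R * (q * (rho n)%:R) <= H n by nra.
have k8 := kap_le hq16; have k0 := kap_gt0 n; have t1 := tau_ge1 Ht.
have t3 : 3 <= tau n t by nra.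
set kp := kap n in kt4 ktL k8 k0; set ta := tau n t in kt4 ktL t1 t3.
pose Q := (Num.truncn (kp * ta + 3)).+1.
have Q1 : kp * ta + 3 <= Q%:R by exact/ltW/truncnS_gt.
have Q2 : Q%:R <= 2 * (kp * ta).
  by rewrite /Q -natr1; have := truncn_le (kp * ta + 3); rewrite (_ : 0 <= _ + 3); lra.
have LQ : (L1 <= Q)%N by rewrite -(ler_nat R); lra.
have [K0 hK0] := active_window hq16 Ht Q1.
have ta0 : 0 < ta by lra.
have qt0 : 0 < q * ta by rewrite mulr_gt0.
pose cnt := 4 * H n / (q * ta).
have cnt0 : 0 <= cnt by rewrite divr_ge0 ?ltW//; lra.
have t0 : 0 <= t by lra.
have hin k : (k < rho n)%N -> ~~ active n t k -> forall i, (i < rho n - k.+1)%N ->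
    C n (t - gap X n i k.+1) = 0 by move=> kr ak i; exact: inactive.
have hact k : (k < rho n)%N -> active n t k -> forall z,
    \sum_(i < rho n - k.+1) cell (- H n) 0 (z - (t - gap X n i k.+1)) <= cnt.
  by move=> _ ak z; exact: active_count.
have := correlation_bound nF nG F1 G1 1 t0 L0 cnt0 hin hact.
rewrite (corr_eq0 nF nG F1 G1 (n := n)) ?mulr0 ?subr0; last by rewrite ger0_norm.
move=> /le_trans; apply; rewrite mul1n.
pose S K := Int (fun z => average n L K z ^+ 2).
have S0 K : 0 <= S K by apply: Int_ge0 => z; exact: sqr_ge0.
have hA k : (k < rho n)%N -> cnt / L%:R * Int (fun z => `|average n L (k.+1 * 1) z|) <=
    cnt * lam * H n + cnt / (2 * lam * L%:R ^+ 2) * S k.+1.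
  move=> kr; rewrite muln1; have LH : L%:R * (q * k.+1%:R) <= H n.
    by apply: le_trans hqL; rewrite ler_pM2l// ler_pM2l// ler_nat.
  have cL : 0 <= cnt / L%:R by rewrite divr_ge0.
  have := ler_wpM2l cL (Int_average_amgm L0 lam0 LH).
  move=> /le_trans; apply; rewrite le_eqVlt; apply/orP; left; apply/eqP.
  by rewrite -/(S k.+1); field; rewrite !gt_eqF.
have hsum : \sum_(k < rho n | active n t k)
    (cnt / L%:R * Int (fun z => `|average n L (k.+1 * 1) z|)) <=
    cnt * lam * H n * Q%:R + cnt / (2 * lam * L%:R ^+ 2) * \sum_(j < Q) S (K0 + j)%N.
  apply: (@le_trans _ _ (\sum_(k < rho n | active n t k)
     (cnt * lam * H n + cnt / (2 * lam * L%:R ^+ 2) * S k.+1))).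
    by apply: ler_sum => k _; exact: hA.
  rewrite big_split/=; apply: lerD; last first.
    rewrite -mulr_sumr; apply: ler_wpM2l; last exact: sum_window.
    by rewrite divr_ge0// ltW.
  rewrite (eq_bigr (fun=> cnt * lam * H n * 1)) => [|k _]; last by rewrite mulr1.
  rewrite -mulr_sumr; apply: ler_wpM2l.
    by apply: mulr_ge0 (ltW Hn); exact: mulr_ge0 (ltW lam0).
  have := @sum_window (fun=> 1) _ (rho n) _ _ (fun _ => ler01) hK0.
  by rewrite [X in _ <= X -> _]sumr_const card_ord.
(* Summing over K before the pair of indices: for a fixed distance d < L the times q K d form a
   progression of step q d, with d bounded. *)
have hS : \sum_(j < Q) S (K0 + j)%N <= L%:R * (Q%:R * H n) + L%:R ^+ 2 * (lam ^+ 2 * Q%:R * H n).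
  pose c d := \sum_(j < Q) CF n (d%:R * (q * (K0 + j)%N%:R)).
  have -> : \sum_(j < Q) S (K0 + j)%N = \sum_(l < L) \sum_(l' < L) c (l - l' + (l' - l))%N.
    under eq_bigr do rewrite /S Int_average_sq; rewrite exchange_big/=.
    by apply: eq_bigr => l _; rewrite exchange_big.
  apply: sum_distance_le.
  - by apply: mulr_ge0 (ltW Hn); exact: mulr_ge0 (ltW lam2) (ler0n _ _).
  - rewrite /c; apply: (@le_trans _ _ (\sum_(j < Q) H n)).
      by apply: ler_sum => j _; apply: le_trans (ler_norm _) (corr_le_H nF nF F1 F1 _ _).
    by rewrite sumr_const card_ord mulr_natl.
  - move=> d dL; rewrite /c.
    rewrite (eq_bigr (fun j : 'I_Q => CF n (d%:R * q * K0%:R + j%:R * (q * d%:R)))); last first.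
      by move=> j _; congr corr; rewrite natrD; ring.
    by apply: sum_corr_progression => y; exact: hn1.
apply: le_trans (lerD (lexx _) hsum) _.
have cf0 : 0 <= cnt / (2 * lam * L%:R ^+ 2).
  by rewrite divr_ge0// ltW.
apply: le_trans (lerD (lexx _) (lerD (lexx _) (ler_wpM2l cf0 hS))) _.
(* The overlap 4 H_n / (q tau) and the number 2 kap tau of differences compensate, since kap H_n = 2
   q r. *)
have cQ : cnt * Q%:R <= 16 * (rho n)%:R.
  apply: (@le_trans _ _ (cnt * (2 * (kp * ta)))); first by rewrite ler_wpM2l.
  rewrite le_eqVlt; apply/orP; left; apply/eqP; rewrite /cnt.
  have := kapE n; rewrite -/kp => kE.
  rewrite (_ : _ * _ = 8 / q * (kp * H n)); last by field; rewrite !gt_eqF.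
  by rewrite kE; field; rewrite gt_eqF.
have -> : cnt * lam * H n * Q%:R + cnt / (2 * lam * L%:R ^+ 2) *
   (L%:R * (Q%:R * H n) + L%:R ^+ 2 * (lam ^+ 2 * Q%:R * H n)) =
   (cnt * Q%:R) * H n * (lam + lam / 2 + (2 * lam * L%:R)^-1).
  by field; rewrite !gt_eqF.
have l1 : (2 * lam * L%:R)^-1 <= lam / 2.
  rewrite -(ler_pM2l lL) mulfV ?gt_eqF//.
  by rewrite (_ : 2 * lam * L%:R * (lam / 2) = lam ^+ 2 * L%:R)//; field.
have HM := H_mass X n; have cQ0 : 0 <= cnt * Q%:R by rewrite mulr_ge0.
have m1 : cnt * Q%:R * H n * (lam + lam / 2 + (2 * lam * L%:R)^-1) <=
    16 * (rho n)%:R * (M * D n) * (2 * lam).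
  apply: ler_pM.
  - by rewrite mulr_ge0// ltW.
  - by rewrite addr_ge0 ?invr_ge0 ?(ltW lL)//; lra.
  - by rewrite ler_pM// ltW.
  - by lra.
have m2 : 16 * (rho n)%:R * (M * D n) * (2 * lam) = e / 2 * D n.+1.
  by rewrite DS /lam; field; rewrite gt_eqF.
have m3 : 2 * (L%:R * H n) <= e / 2 * D n.+1.
  have h1 : 4 * L%:R * M <= e * (rho n)%:R by move: hr; rewrite ler_pdivrMr// [e * _]mulrC.
  have h2 : 4 * L%:R * H n <= 4 * L%:R * (M * D n) by rewrite ler_wpM2l//; lra.
  have h3 : 4 * L%:R * M * D n <= e * (rho n)%:R * D n by rewrite ler_pM2r.
  by rewrite DS; lra.
lra.
Qed.

End LongRange.

(** * The case of few index differences, and decay at all times *)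

Section ShortRange.
Variables (R : realType) (X : tower R).
Notation rho := (cuts X).
Notation q := (spacer X).
Notation H := (th X).
Notation D := (td X).
Notation M := (mass X).
Variables F G : R -> R.
Hypotheses (nF : nice F) (nG : nice G).
Hypotheses (F1 : forall x, `|F x| <= cell (- H 0) 0 x)
           (G1 : forall x, `|G x| <= cell (- H 0) 0 x).
Hypothesis UF : UE X F 0.
Notation C := (corr X F G).
Notation CF := (corr X F F).
Notation average := (average X F).

Lemma scale_index (x : R) : H 0 <= x -> exists a, H a <= x /\ x < H a.+1.
Proof.
move=> hx; have [n0 hn0] := ev_height X (x + 1).
have ex : exists m, x < H m by exists n0; have := hn0 n0 (leqnn _); lra.
case: (ex_minnP ex) => m xm mmin; case: m xm mmin => [|a] xm mmin; first lra.
exists a; split=> //; rewrite leNgt; apply/negP => /mmin; by rewrite ltnn.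
Qed.

(* Few values of [K]: replacing the step 1 by a suitable multiple [ell], the  *)
(* times [q * K * ell * d] become comparable with the height of a tower.      *)
Lemma regime_short Q0 e : 0 < Q0 -> 0 < e -> exists B : nat, ev (fun n => forall t,
  B%:R * H n <= t -> t < H n.+1 -> kap X n * tau X n t <= Q0 -> `|C n.+1 t| <= e * D n.+1).
Proof.
move=> Q00 e0; have M0 := mass_gt0 X; have q0 := spacer_gt0 X.
have [Q hQ] : exists Q : nat, Q0 + 3 <= Q%:R.
  by exists (Num.truncn (Q0 + 3)).+1; exact/ltW/truncnS_gt.
have QR : 0 < Q%:R :> R by lra.
pose lam := e / (8 * Q%:R * M).
have lam0 : 0 < lam by rewrite divr_gt0// mulr_gt0//; lra.
have lam2 : 0 < lam ^+ 2 by rewrite exprn_gt0.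
have [L [L0 hL]] : exists L : nat, (0 < L)%N /\ 1 <= lam ^+ 2 * L%:R.
  exists (Num.truncn (lam ^+ 2)^-1).+1; split => //; rewrite -(@ler_pM2l _ (lam ^+ 2)^-1) ?invr_gt0//.
  by rewrite mulKf ?gt_eqF// mulr1; exact/ltW/truncnS_gt.
have LR : 0 < L%:R :> R by rewrite ltr0n.
have lam20 : 0 < 2 * lam by lra.
have lL : 0 < 2 * lam * L%:R by rewrite mulr_gt0.
have lL2 : 0 < 2 * lam * L%:R ^+ 2 by rewrite mulr_gt0// exprn_gt0.
have e3 : 0 < lam ^+ 2 * M by rewrite mulr_gt0.
have e5 : 0 < e / (56 * q * M * L%:R) by rewrite divr_gt0// !mulr_gt0.
have [a0 ha0] := evI (short_times nF F1 UF nF F1 (8 * L) e3)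
  (evI (ev_small X e5) (ev_spacers X ltr01)).
(* Large enough that q tau exceeds the height of tower [a0], beyond which the short-time estimates
   hold. *)
have [B [hB3 hB]] : exists B : nat, 3 <= B%:R :> R /\ H a0 <= q * B%:R.
  exists (Num.truncn (H a0 / q + 3)).+1.
  have hx : 0 < H a0 / q by rewrite divr_gt0// H_gt0.
  have := truncnS_gt (H a0 / q + 3); set x := _.+1%:R => hxx; split; first lra.
  by rewrite mulrC -ler_pdivrMr//; lra.
exists B.
have Q04 : 0 < 4 * Q0 by lra.
have h16 : (0 : R) < 16 by lra.
have [n0 hn0] := evI (ev_ge 1) (evI (ev_spacers X h16)
  (evI (ev_pred (ev_cuts X (8 * L%:R)))
  (evI (ev_pred (ev_spacers X Q04)) (ev_pred (ev_spacers X ltr01))))).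
exists n0 => n /hn0[n1 [hq16 [hL8 [hQ4 hq1]]]] t Bt tH kt.
have Hn := H_gt0 X n; have Dn := D_gt0 X n; have r0 := rho_gt0 X n.
have Ht : H n <= t by nra.
have taB : B%:R <= tau X n t by rewrite /tau ler_pdivlMr.
have k8 := kap_le hq16; have k0 := kap_gt0 X n.
have tr := tau_le hq16 tH; have kE := kapE X n.
set kp := kap X n in kt k8 k0 kE; set ta := tau X n t in kt taB tr.
have t3 : 3 <= ta by lra.
have ta0 : 0 < ta by lra.
have qt0 : 0 < q * ta by rewrite mulr_gt0.
have qB : q * B%:R <= q * ta by rewrite ler_pM2l.
have qtH : H 0 <= q * ta.
  by apply: le_trans (_ : H a0 <= _); [exact: H_le|lra].
have [a [Ha aH]] := scale_index qtH.
have aa0 : (a0 <= a)%N.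
  rewrite leqNgt; apply/negP => /(H_le X) h; move: aH hB qB h; lra.
have [hshort [hsmall hqa]] := ha0 a aa0.
have Hag := H_gt0 X a; have ra := rho_gt0 X a.
have [hshort' _] := ha0 a.+1 (leqW aa0).
have Ha1 := H_gt0 X a.+1.
have rp := rho_gt0 X n.-1; have Hp := H_gt0 X n.-1.
have HnE : H n <= 2 * (rho n.-1)%:R * H n.-1.
  by rewrite -[in leLHS](prednK n1); apply: HS_le; move: hq1; rewrite mul1r.
(* Few differences means 2 q r tau <= Q0 H_n, and tau <= 2 r. Hence (q tau)^2 <= q Q0 H_n, so q tau
   is below H_{n-1} because r_{n-1} is small compared with that height. *)
have an : (a.+1 < n)%N.
  rewrite ltnNge; apply/negP => na.
  have hHp : H n.-1 <= q * ta by apply: le_trans Ha; apply: H_le; rewrite -ltnS prednK.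
  have h1 : 2 * q * (rho n)%:R * ta <= Q0 * H n.
    by rewrite -kE mulrAC ler_pM2r.
  have h2 : q * ta * ta <= Q0 * H n.
    have : (q * ta) * ta <= (q * ta) * (2 * (rho n)%:R) by rewrite ler_pM2l.
    by move: h1; clear -X nF nG F1 G1 UF; lra.
  have h3 : H n.-1 * H n.-1 <= (q * ta) * (q * ta) by rewrite ler_pM// ltW.
  have h4 : q * (q * ta * ta) <= q * (Q0 * H n) by rewrite ler_pM2l.
  have h5 : q * Q0 * H n <= q * Q0 * (2 * (rho n.-1)%:R * H n.-1).
    by rewrite ler_pM2l// mulr_gt0.
  have h6 : H n.-1 * H n.-1 <= (2 * q * Q0 * (rho n.-1)%:R) * H n.-1.
    by move: h3 h4 h5; clear -X nF nG F1 G1 UF; lra.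
  by move: h6; rewrite ler_pM2r//; move: hQ4 Hp; clear -X nF nG F1 G1 UF; lra.
(* Active K lie between tau / 3 and 2 tau, so a multiplier [ell] between z and z + 1 puts q K ell
   between H_{a+1} and 8 H_{a+1}. Its first L - 1 multiples are then short times for tower
   [a.+1]. *)
pose z := 3 * H a.+1 / (q * ta).
have z0 : 0 < z by rewrite divr_gt0// mulr_gt0.
have [ell [zl lz]] : exists ell : nat, z <= ell%:R /\ ell%:R <= z + 1.
  exists (Num.truncn z).+1; split; first exact/ltW/truncnS_gt.
  by rewrite -natr1 lerD2r truncn_le ltW.
have zE : z * (q * ta) = 3 * H a.+1 by rewrite /z divfK ?gt_eqF.
have step_ge k : active X n t k -> H a.+1 <= q * (k.+1 * ell)%:R.
  move=> /(active_ge hq16 t3) hk; rewrite natrM mulrA.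
  have : q * (ta / 3) * z <= q * k.+1%:R * ell%:R.
    apply: ler_pM => //; [|exact: ltW|by rewrite ler_pM2l].
    by apply: mulr_ge0; [exact: ltW|apply: divr_ge0 => //; exact: ltW].
  by move: zE; clear -X nF nG F1 G1 UF; lra.
have step_le k : active X n t k -> q * (k.+1 * ell)%:R <= 8 * H a.+1.
  move=> /(active_le Ht) hk; rewrite natrM mulrA.
  have : q * k.+1%:R * ell%:R <= q * (2 * ta) * (z + 1).
    apply: ler_pM => //; last by rewrite ler_pM2l.
    by apply: mulr_ge0 => //; exact: ltW.
  by move: zE Ha aH; clear -X nF nG F1 G1 UF; lra.
have Hap : H a.+1 <= H n.-1 by apply: H_le; rewrite -ltnS prednK.
have LHn : 8 * L%:R * H a.+1 <= H n.
  apply: (@le_trans _ _ ((rho n.-1)%:R * H n.-1)).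
    by apply: ler_pM => //; exact: ltW.
  by have := le_HS X n.-1; rewrite prednK.
have t0 : 0 <= t := le_trans (ltW Hn) Ht.
have hin k : (k < rho n)%N -> ~~ active X n t k -> forall i, (i < rho n - k.+1)%N ->
    C n (t - gap X n i k.+1) = 0 by move=> kr ak i; exact: inactive.
have hact k : (k < rho n)%N -> active X n t k -> forall z,
    \sum_(i < rho n - k.+1) cell (- H n) 0 (z - (t - gap X n i k.+1)) <= (rho n)%:R.
  move=> kr ak z'; apply: (@le_trans _ _ (\sum_(i < rho n - k.+1) 1)).
    by apply: ler_sum => i _; exact: cell_le1.
  by rewrite sumr_const card_ord ler_nat leq_subr.
have := correlation_bound nF nG F1 G1 ell t0 L0 (ltW r0) hin hact.
rewrite (corr_eq0 nF nG F1 G1 (n := n)) ?mulr0 ?subr0; last by rewrite ger0_norm.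
move=> /le_trans; apply.
have HM := H_mass X n; have HMa := H_mass X a.
have hA k : active X n t k ->
    (rho n)%:R / L%:R * Int (fun z => `|average n L (k.+1 * ell) z|) <= e / (4 * Q%:R) * D n.+1.
  move=> ak; have sl := step_le k ak; have sg := step_ge k ak.
  set u := q * _ in sl sg.
  have LH : L%:R * u <= H n.
    by apply: le_trans LHn; rewrite [8 * _]mulrC -mulrA ler_pM2l.
  have rL : 0 <= (rho n)%:R / L%:R :> R by apply: divr_ge0.
  have := ler_wpM2l rL (Int_average_amgm nF F1 L0 lam0 LH).
  move=> /le_trans; apply.
  have hS : Int (fun z => average n L (k.+1 * ell) z ^+ 2) <=
      L%:R * (M * D n) + L%:R ^+ 2 * (lam ^+ 2 * M * D n).
    rewrite (Int_average_sq X nF); apply: (sum_distance_le (c := fun d => CF n (d%:R * u))).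
    - by apply: mulr_ge0 (ltW Dn); exact: ltW.
    - by apply: le_trans (ler_norm _) _; apply: le_trans (corr_le_H nF nF F1 F1 _ _) _.
    - move=> d /andP[d0 dL]; apply: le_trans (ler_norm _) _; apply: hshort' => //.
        apply: le_trans (sg) _; by rewrite ler_peMl ?ler1n//; exact: le_trans (ltW Ha1) sg.
      rewrite natrM; apply: (@le_trans _ _ (L%:R * (8 * H a.+1))).
        apply: ler_pM => //; first exact: le_trans (ltW Ha1) sg.
        by rewrite ler_nat ltnW.
      by rewrite mulrA [L%:R * 8]mulrC.
  apply: (@le_trans _ _ ((rho n)%:R / L%:R * (lam * L%:R * (M * D n) +
     (L%:R * (M * D n) + L%:R ^+ 2 * (lam ^+ 2 * M * D n)) / (2 * lam * L%:R)))).
    apply: ler_wpM2l => //; apply: lerD; last by rewrite ler_pM2r ?invr_gt0.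
    by rewrite ler_pM2l// mulr_gt0.
  have -> : (rho n)%:R / L%:R * (lam * L%:R * (M * D n) +
     (L%:R * (M * D n) + L%:R ^+ 2 * (lam ^+ 2 * M * D n)) / (2 * lam * L%:R)) =
     (rho n)%:R * (M * D n) * (lam + lam / 2 + (2 * lam * L%:R)^-1).
    by field; rewrite !gt_eqF.
  have l1 : (2 * lam * L%:R)^-1 <= lam / 2.
    rewrite -(ler_pM2l lL) mulfV ?gt_eqF//.
    by rewrite (_ : 2 * lam * L%:R * (lam / 2) = lam ^+ 2 * L%:R)//; field.
  have m2 : (rho n)%:R * (M * D n) * (2 * lam) = e / (4 * Q%:R) * D n.+1.
    by rewrite DS /lam; field; rewrite !gt_eqF.
  rewrite -m2 ler_pM2l; last by do ?apply: mulr_gt0.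
  by move: l1; clear -X nF nG F1 G1 UF; lra.
have [K0 hK0] := @active_window _ X n t hq16 Ht Q (le_trans (lerD kt (lexx 3)) hQ).
have hsum : \sum_(k < rho n | active X n t k)
    ((rho n)%:R / L%:R * Int (fun z => `|average n L (k.+1 * ell) z|)) <= e / 4 * D n.+1.
  apply: (@le_trans _ _ (\sum_(k < rho n | active X n t k) (e / (4 * Q%:R) * D n.+1 * 1))).
    by apply: ler_sum => k ak; rewrite mulr1; exact: hA.
  rewrite -mulr_sumr; have := @sum_window R (fun=> 1) _ (rho n) _ _ (fun _ => ler01) hK0.
  rewrite [X in _ <= X -> _]sumr_const card_ord => hc.
  have c0 : 0 <= e / (4 * Q%:R) * D n.+1.
    by apply: mulr_ge0 (ltW (D_gt0 X _)); rewrite divr_ge0 ?(ltW e0)//; lra.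
  apply: le_trans (ler_wpM2l c0 hc) _; rewrite le_eqVlt; apply/orP; left; apply/eqP.
  by field; rewrite gt_eqF.
(* Shifting by [ell * L] copies creates boundary terms. They are negligible because r_a is small
   compared with H_a, itself at most q tau <= 2 q r_n. *)
have hell : ell%:R <= 7 * (rho a)%:R :> R.
  have : z <= 6 * (rho a)%:R.
    rewrite -(ler_pM2r qt0) zE; have := HS_le (X := X) (n := a).
    rewrite mul1r in hqa; move=> /(_ hqa) h.
    have : (rho a)%:R * H a <= (rho a)%:R * (q * ta) by rewrite ler_pM2l.
    by move: h; clear -X nF nG F1 G1 UF; lra.
  have : 1 <= (rho a)%:R :> R by rewrite ler1n (leq_trans _ (cuts_ge2 X a)).
  by move: lz; clear -X nF nG F1 G1 UF; lra.
have hbd : 2 * ((ell * L)%:R * H n) <= e / 2 * D n.+1.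
  have s1 : 7 * (rho a)%:R <= e / (8 * q * M * L%:R) * H a.
    have : 7 * (rho a)%:R <= 7 * (e / (56 * q * M * L%:R) * H a).
      by rewrite ler_pM2l.
    move=> /le_trans; apply; rewrite le_eqVlt; apply/orP; left; apply/eqP.
    by field; rewrite !gt_eqF.
  have s2 : H a <= 2 * q * (rho n)%:R.
    apply: le_trans Ha _; apply: le_trans (ler_wpM2l (ltW q0) tr) _.
    by rewrite mulrA [q * 2]mulrC.
  have c0 : 0 <= e / (8 * q * M * L%:R) by rewrite ltW// divr_gt0// !mulr_gt0.
  have s3 : ell%:R <= e / (8 * q * M * L%:R) * (2 * q * (rho n)%:R).
    by apply: le_trans hell _; apply: le_trans s1 _; rewrite ler_wpM2l.
  rewrite natrM; apply: (@le_trans _ _ (2 * (e / (8 * q * M * L%:R) * (2 * q * (rho n)%:R) *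
      L%:R * (M * D n)))).
    rewrite ler_pM2l//; apply: ler_pM => //; [exact: ltW|by rewrite ler_pM2r].
  by rewrite DS le_eqVlt; apply/orP; left; apply/eqP; field; rewrite !gt_eqF.
have := mulr_gt0 e0 (D_gt0 X n.+1).
by lra.
Qed.

(** Three ranges: times below a fixed multiple of H_n, then few or many index differences. *)
Lemma correlation_small e : 0 < e -> ev (fun n => forall t, H n <= t -> t < H n.+1 ->
  `|C n.+1 t| <= e * D n.+1).
Proof.
move=> e0; have [Q0 h1] := regime_long nF nG F1 G1 UF e0.
have Q00 : 0 < Num.max 1 Q0 by rewrite lt_max ltr01.
have [B h2] := regime_short Q00 e0.
have [n0 hn0] := evI h1 (evI h2 (bounded_times nF F1 UF nG G1 B e0)).
exists n0 => n /hn0[g1 [g2 g3]] t Ht tH.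
have Hn := H_gt0 X n; have t0 : 0 <= t by lra.
have [tB|Bt] := leP t (B%:R * H n).
  have := g3 t t0 tB; rewrite (corr_eq0 nF nG F1 G1 (n := n)) ?mulr0 ?subr0//.
  by rewrite ger0_norm.
have [hQ|/ltW hQ] := leP (Num.max 1 Q0) (kap X n * tau X n t).
  by apply: g1 => //; apply: le_trans hQ; rewrite le_max lexx orbT.
by apply: g2 => //; exact: ltW.
Qed.

(* Since [t < H n.+1], the points of tower [n.+1] that climb past its top     *)
(* cross exactly one copy of it, up to an error summable over later stages.   *)
Theorem tower_mixing e : 0 < e -> exists t0, forall t, t0 <= t ->
  exists N0, forall N, (N0 <= N)%N -> `|C N t| <= e * D N.
Proof.
move=> e0; have M0 := mass_gt0 X; have e4 : 0 < e / 4 by lra.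
have [n0 hn0] := evI (correlation_small e4) (evI (ev_pred (bounded_times nF F1 UF nG G1 1 e4))
  (ev_cuts X (4 * M / e))).
have [m hm] := ev_height X 0.
exists (H n0.+1) => t Ht.
have [n [Hnt tHn]] := scale_index (le_trans (H_le X (leq0n _)) Ht).
have nn0 : (n0 <= n)%N.
  rewrite leqNgt; apply/negP => nn0; have := H_le X (ltnW nn0 : (n.+1 <= n0.+1)%N); lra.
have [h1 _] := hn0 n nn0.
have [_ [h2 _]] := hn0 n.+2 (leqW (leqW nn0)).
have [_ [_ h3]] := hn0 n.+1 (leqW nn0).
have Hn := H_gt0 X n; have t0 : 0 <= t by lra.
have c1 : `|C n.+1 t| <= e / 4 * D n.+1 by exact: h1.
have tH1 : t <= 1%:R * H n.+1 by rewrite mul1r ltW.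
have c2 := h2 t t0 tH1; rewrite /= in c2.
have D1 := D_gt0 X n.+1; have D2 := D_gt0 X n.+2; have r1 := rho_gt0 X n.+1.
have c3 : `|C n.+2 t| <= e / 2 * D n.+2.
  rewrite -[C n.+2 t](subrK ((rho n.+1)%:R * C n.+1 t)).
  apply: le_trans (ler_normD _ _) _; rewrite normrM (ger0_norm (ltW r1)).
  by have := ler_wpM2l (ltW r1) c1; move: c2; rewrite (DS X n.+1); lra.
exists n.+2 => N nN.
pose E k := D k / D n.+2.
(* As for short times, the [- 1] absorbs the new error at each stage. *)
have hC : `|C N t| <= D N * (e / 2) + 2 * t * (E N - 1).
  rewrite -(subnKC nN); elim: (N - n.+2)%N => [|k IHk].
    by rewrite addn0 /E divff ?gt_eqF// subrr mulr0 addr0 mulrC.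
  rewrite addnS; set l := (n.+2 + k)%N in IHk *.
  have tl : t <= H l.
    by apply: le_trans (ltW tHn) _; apply: H_le; exact: leq_trans (leqnSn _) (leq_addr _ _).
  have ht := tail_bound nF nG F1 G1 t0 tl; have rl := rho_gt0 X l.
  have r2 : 2 <= (rho l)%:R :> R by rewrite ler_nat cuts_ge2.
  rewrite -[C l.+1 t](subrK ((rho l)%:R * C l t)).
  apply: le_trans (ler_normD _ _) _; rewrite normrM (ger0_norm (ltW rl)).
  have h4 := ler_wpM2l (ltW rl) IHk.
  apply: le_trans (lerD ht h4) _.
  have -> : E l.+1 = E l * (rho l)%:R by rewrite /E DS; ring.
  rewrite DS; have : 2 * t <= (rho l)%:R * t by rewrite ler_wpM2r.
  by lra.
have EN : D N * (2 * t / D n.+2) = 2 * t * E N by rewrite /E; ring.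
have : 2 * t / D n.+2 <= e / 2.
  rewrite ler_pdivrMr// (DS X n.+1); have HM := H_mass X n.+1.
  have h5 : 4 * M * D n.+1 <= e * (rho n.+1)%:R * D n.+1.
    by rewrite ler_pM2r//; move: h3; rewrite ler_pdivrMr// [e * _]mulrC.
  by lra.
move=> /(ler_wpM2l (ltW (D_gt0 X N))); rewrite EN => h6.
by apply: le_trans hC _; lra.
Qed.

End ShortRange.

(** * Columns of the staircase and the special flow over them *)

Section Columns.
Variables (R : realType) (r : nat -> nat) (a : R).
Hypotheses (r0 : forall n, (0 < r n.+1)%N) (a0 : 0 < a).
Notation w := (stair_width r a).
Notation sp := (stair_spstart r a).
Notation col := (stair_column r a).
Notation h := (stair_height r a).

(** The j-th subcolumn with its spacers; ['C(j, 2)] spacers were used by the previous subcolumns. *)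
Definition block m j : seq R :=
  [seq c + j%:R * w m.+1 | c <- col m] ++
  [seq sp m + ('C(j, 2) + k)%:R * w m.+1 | k <- iota 0 j].

Definition blocks m J : seq R := flatten [seq block m j | j <- iota 0 J].

Lemma sum_ord_bin j : (\sum_(i < j) i)%N = 'C(j, 2).
Proof. by rewrite -bin2_sum big_mkord. Qed.

Lemma colS m : col m.+1 = blocks m (r m.+1).
Proof.
rewrite /blocks /=; congr flatten; apply: eq_map => j; rewrite /block.
by congr (_ ++ _); apply: eq_map => k; rewrite sum_ord_bin.
Qed.

Lemma spS m : sp m.+1 = sp m + 'C(r m.+1, 2)%:R * w m.+1.
Proof. by rewrite /= /stair_nspacers sum_ord_bin. Qed.

Lemma blocksS m J : blocks m J.+1 = blocks m J ++ block m J.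
Proof.
by rewrite /blocks -addn1 iotaD map_cat flatten_cat/= cats0 add0n.
Qed.

Lemma size_block m j : size (block m j) = (h m + j)%N.
Proof. by rewrite /block size_cat !size_map size_iota. Qed.

Lemma size_blocks m J : size (blocks m J) = (J * h m + 'C(J, 2))%N.
Proof.
elim: J => [|J IHJ]; first by rewrite mul0n bin0n.
by rewrite blocksS size_cat IHJ size_block binS bin1 mulSn; lia.
Qed.

Lemma heightS m : h m.+1 = (r m.+1 * h m + 'C(r m.+1, 2))%N.
Proof. by rewrite /stair_height colS size_blocks. Qed.

Lemma width_gt0 n : 0 < w n.
Proof. by elim: n => //= n IHn; rewrite divr_gt0// ltr0n. Qed.

Lemma widthS n : (r n.+1)%:R * w n.+1 = w n.
Proof. by rewrite /= mulrC divfK// pnatr_eq0 -lt0n. Qed.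

Lemma height_width n : (h n)%:R * w n = sp n.
Proof.
elim: n => [|n IHn]; first by rewrite /stair_height /= mul1r.
rewrite heightS natrD natrM mulrDl spS -IHn; congr (_ + _).
by rewrite mulrAC widthS mulrC.
Qed.

Lemma spstart_le n : sp n <= sp n.+1.
Proof. by rewrite spS lerDl mulr_ge0// ltW// width_gt0. Qed.

Lemma spstart_mono m n : (m <= n)%N -> sp m <= sp n.
Proof.
move=> /subnK <-; elim: (n - m)%N => // k IHk.
by rewrite addSn; apply: le_trans IHk (spstart_le _).
Qed.

Lemma spstart_gt0 n : 0 < sp n.
Proof. by apply: lt_le_trans a0 _; apply: (spstart_mono (leq0n n)). Qed.

Lemma cell_cat (u v z x : R) : u <= v -> v <= z -> cell u v x + cell v z x = cell u z x.
Proof.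
move=> uv vz; rewrite /cell; case: (leP u x) => h1; case: (ltP x v) => h2;
  case: (ltP x z) => h3 /=; rewrite ?addr0 ?add0r//; exfalso; lra.
Qed.

Lemma cell_split (u s x : R) N : 0 <= s ->
  \sum_(j < N) cell (u + j%:R * s) (u + j%:R * s + s) x = cell u (u + N%:R * s) x.
Proof.
move=> s0; elim: N => [|N IHN].
  rewrite big_ord0 mul0r addr0 /cell ifF//; apply/negP => /andP[]; lra.
rewrite big_ord_recr/= IHN; have Ns : 0 <= N%:R * s by rewrite mulr_ge0.
have -> : u + N.+1%:R * s = u + N%:R * s + s by rewrite -natr1; ring.
by rewrite cell_cat; lra.
Qed.

Lemma sum_blocks (g : nat -> R) J :
  \sum_(j < J) \sum_(k < j) g ('C(j, 2) + k)%N = \sum_(i < 'C(J, 2)) g i.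
Proof.
elim: J => [|J IHJ]; first by rewrite bin0n !big_ord0.
by rewrite big_ord_recr/= IHJ binS bin1 big_split_ord.
Qed.

Lemma sum_iota (V : nmodType) (F : nat -> V) N :
  \sum_(j <- iota 0 N) F j = \sum_(j < N) F j.
Proof. by rewrite -(big_mkord xpredT F) /index_iota subn0. Qed.

(** One identity between indicators records that the levels tile [0, sp n): it yields both the
    uniqueness and the existence of the level of a point. *)
Lemma sum_levels n x : \sum_(c <- col n) cell c (c + w n) x = cell 0 (sp n) x.
Proof.
elim: n => [|n IHn]; first by rewrite big_seq1 add0r.
have w0 := ltW (width_gt0 n.+1).
rewrite colS /blocks big_flatten big_map sum_iota.
under eq_bigr do rewrite /block big_cat !big_map sum_iota.
rewrite big_split/= exchange_big/=.
rewrite (eq_bigr (fun c => cell c (c + w n) x)) => [|c _]; last first.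
  by rewrite cell_split// widthS.
rewrite IHn (sum_blocks (fun i => cell (sp n + i%:R * w n.+1) (sp n + i%:R * w n.+1 + w n.+1) x)).
by rewrite cell_split// -spS cell_cat ?spstart_le// ltW// spstart_gt0.
Qed.

Definition in_level n k x := (k < h n)%N && (nth 0 (col n) k <= x < nth 0 (col n) k + w n).

Lemma level_uniq n k k' x : in_level n k x -> in_level n k' x -> k = k'.
Proof.
move=> /andP[kh kx] /andP[k'h k'x]; apply/eqP; apply: contraT => kk'.
have := sum_levels n x; rewrite (big_nth 0) big_mkord -/(h n).
rewrite (bigD1 (Ordinal kh))//= (bigD1 (Ordinal k'h))/=; last first.
  by rewrite -val_eqE/= eq_sym.
rewrite {1}/cell kx {1}/cell k'x => h1.
have := cell_le1 0 (sp n) x; rewrite -h1.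
have : 0 <= \sum_(i < h n | (i != Ordinal kh) && (i != Ordinal k'h))
   cell (nth 0 (col n) i) (nth 0 (col n) i + w n) x.
  by apply: sumr_ge0 => i _; exact: cell_ge0.
by move=> *; exfalso; lra.
Qed.

Lemma level_exists n x : 0 <= x < sp n -> exists k, in_level n k x.
Proof.
move=> xs; have := sum_levels n x; rewrite [RHS]/cell xs => h1.
have [/hasP[c cc cx]|/hasPn h2] := boolP (has (fun c => c <= x < c + w n) (col n)).
  by exists (index c (col n)); rewrite /in_level index_mem cc nth_index.
exfalso; move: h1; rewrite big_seq big1 => [/eqP|c cc]; first by rewrite eq_sym oner_eq0.
by rewrite /cell (negbTE (h2 c cc)).
Qed.

Lemma stair_levelE n k x : in_level n k x -> stair_level r a n x = k.
Proof.
move=> kx; apply: (@level_uniq n _ _ x) => //; have /andP[kh hx] := kx.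
have hs : has (fun c => c <= x < c + w n) (col n).
  by apply/hasP; exists (nth 0 (col n) k) => //; rewrite mem_nth.
rewrite /in_level /stair_level -has_find hs /=.
exact: (nth_find 0 hs).
Qed.

Lemma level_range n k x : in_level n k x -> 0 <= x < sp n.
Proof.
move=> /andP[kh kx]; have := sum_levels n x; rewrite [RHS]/cell; case: ifP => // _ /eqP.
rewrite (big_nth 0) big_mkord -/(h n) psumr_eq0 => [|i _]; last exact: cell_ge0.
move=> /allP /(_ (Ordinal kh)); rewrite mem_index_enum => /(_ isT)/=.
by rewrite /cell kx oner_eq0.
Qed.

Lemma stair_level_out n x : ~~ (0 <= x < sp n) -> stair_level r a n x = h n.
Proof.
move=> nx; apply: hasNfind; apply/negP => hs; move/negP: nx; apply.
apply: (@level_range n (stair_level r a n x)); rewrite /in_level /stair_level -has_find hs.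
exact: (nth_find 0 hs).
Qed.

(** Below subcolumn [j] lie [j] full subcolumns and 0 + ... + (j - 1) spacers. *)
Lemma nth_blocks m J j k : (j < J)%N -> (k < h m)%N ->
  nth 0 (blocks m J) (j * h m + 'C(j, 2) + k) = nth 0 (col m) k + j%:R * w m.+1.
Proof.
move=> jJ kh; elim: J jJ => // J IHJ; rewrite ltnS leq_eqVlt => /orP[/eqP <-|jJ].
  rewrite blocksS nth_cat size_blocks ltnNge leq_addr/= addKn /block nth_cat.
  by rewrite size_map -/(h m) kh (nth_map 0).
rewrite blocksS nth_cat size_blocks ifT; first exact: IHJ.
have := leq_bin2l 2 jJ; rewrite binS bin1.
have : (j.+1 * h m <= J * h m)%N by rewrite leq_mul2r jJ orbT.
by rewrite mulSn; lia.
Qed.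

Lemma index_lt m j k : (j < r m.+1)%N -> (k < h m)%N ->
  (j * h m + 'C(j, 2) + k < h m.+1)%N.
Proof.
move=> jr kh; rewrite heightS.
have := leq_bin2l 2 jr; rewrite binS bin1.
have : (j.+1 * h m <= r m.+1 * h m)%N by rewrite leq_mul2r jr orbT.
by rewrite mulSn; lia.
Qed.

Lemma nth_colS m j k : (j < r m.+1)%N -> (k < h m)%N ->
  nth 0 (col m.+1) (j * h m + 'C(j, 2) + k) = nth 0 (col m) k + j%:R * w m.+1.
Proof. by move=> jr kh; rewrite colS nth_blocks. Qed.

Lemma height_gt0 n : (0 < h n)%N.
Proof.
elim: n => // n IHn; apply: leq_ltn_trans (index_lt (r0 n) IHn); exact: leq0n.
Qed.

Lemma col_bottom n : nth 0 (col n) 0 = 0.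
Proof.
elim: n => //= n IHn; have := nth_colS (r0 n) (height_gt0 n).
by rewrite IHn mul0r addr0.
Qed.

Lemma in_levelS n k x : in_level n k x -> exists j, (j < r n.+1)%N /\
  in_level n.+1 (j * h n + 'C(j, 2) + k) x.
Proof.
move=> /andP[kh /andP[kx xk]]; have w0 := width_gt0 n.+1.
have z0 : 0 <= (x - nth 0 (col n) k) / w n.+1 by rewrite divr_ge0 ?subr_ge0// ltW.
exists (Num.truncn ((x - nth 0 (col n) k) / w n.+1)); set j := Num.truncn _.
have jr : (j < r n.+1)%N.
  rewrite /j truncn_lt_nat// ltr_pdivrMr// widthS; lra.
split=> //; rewrite /in_level index_lt// nth_colS// andTb.
have := truncn_itv z0; rewrite -/j -natr1 ler_pdivlMr// ltr_pdivrMr// mulrDl mul1r.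
by move=> /andP[]; lra.
Qed.

(** Refining a column keeps the relative position of a level and the one beneath it, so the
    approximate inverse maps stabilise at the point. *)
Lemma in_level_down n m k x : (0 < k)%N -> in_level n k x -> (n <= m)%N ->
  exists k', [/\ (0 < k')%N, in_level m k' x &
    nth 0 (col m) k'.-1 - nth 0 (col m) k' = nth 0 (col n) k.-1 - nth 0 (col n) k].
Proof.
move=> k0 kx /subnK <-; elim: (m - n)%N => [|l [k' [k'0 k'x k'E]]]; first by exists k.
rewrite addSn; have [j [jr jx]] := in_levelS k'x; have /andP[k'h _] := k'x.
exists (j * h (l + n) + 'C(j, 2) + k')%N; split => //; first by rewrite addn_gt0 k'0 orbT.
have -> : (j * h (l + n) + 'C(j, 2) + k').-1 = (j * h (l + n) + 'C(j, 2) + k'.-1)%N by lia.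
rewrite (nth_colS jr k'h) (nth_colS jr (leq_ltn_trans (leq_pred _) k'h)) -k'E; ring.
Qed.

Lemma in_level_up n m k x : (k.+1 < h n)%N -> in_level n k x -> (n <= m)%N ->
  exists k', [/\ (k'.+1 < h m)%N, in_level m k' x &
    nth 0 (col m) k'.+1 - nth 0 (col m) k' = nth 0 (col n) k.+1 - nth 0 (col n) k].
Proof.
move=> k0 kx /subnK <-; elim: (m - n)%N => [|l [k' [k'0 k'x k'E]]]; first by exists k.
rewrite addSn; have [j [jr jx]] := in_levelS k'x; have /andP[k'h _] := k'x.
exists (j * h (l + n) + 'C(j, 2) + k')%N; split => //; rewrite -(addnS _ k'); first exact: index_lt.
by rewrite (nth_colS jr k'h) (nth_colS jr k'0) -k'E; ring.
Qed.

Lemma limn_eventually (u : nat -> R) n l : (forall m, (n <= m)%N -> u m = l) ->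
  limn u = l.
Proof.
move=> ul; apply/cvg_lim => //; apply: cvg_near_cst; near=> m; apply: ul.
by near: m; exists n.
Unshelve. all: by end_near. Qed.

Lemma stair_Tn_invE n k x : (0 < k)%N -> in_level n k x ->
  stair_Tn_inv r a n x = x - nth 0 (col n) k + nth 0 (col n) k.-1.
Proof.
move=> k0 kx; rewrite /stair_Tn_inv (stair_levelE kx); have /andP[kh _] := kx.
by rewrite k0 kh.
Qed.

Lemma stair_T_invE n k x : (0 < k)%N -> in_level n k x ->
  stair_T_inv r a x = x - nth 0 (col n) k + nth 0 (col n) k.-1.
Proof.
move=> k0 kx; apply: (limn_eventually (n := n)) => m nm.
have [k' [k'0 k'x e]] := in_level_down k0 kx nm.
by rewrite (stair_Tn_invE k'0 k'x); lra.
Qed.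

Lemma stair_TnE n k x : (k.+1 < h n)%N -> in_level n k x ->
  stair_Tn r a n x = x - nth 0 (col n) k + nth 0 (col n) k.+1.
Proof. by move=> kh kx; rewrite /stair_Tn (stair_levelE kx) -/(h n) kh. Qed.

Lemma stair_TE n k x : (k.+1 < h n)%N -> in_level n k x ->
  stair_T r a x = x - nth 0 (col n) k + nth 0 (col n) k.+1.
Proof.
move=> kh kx; apply: (limn_eventually (n := n)) => m nm.
have [k' [k'0 k'x e]] := in_level_up kh kx nm.
by rewrite (stair_TnE k'0 k'x); lra.
Qed.

Lemma iter_stair_T n k j u : (k + j < h n)%N -> 0 <= u < w n ->
  iter j (stair_T r a) (nth 0 (col n) k + u) = nth 0 (col n) (k + j) + u.
Proof.
move=> kj /andP[u0 uw]; elim: j kj => [|j IHj] kj; first by rewrite addn0.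
rewrite iterS IHj; last by apply: ltn_trans kj; rewrite addnS.
rewrite addnS in kj *; rewrite (@stair_TE n (k + j)%N)//; first by ring.
by rewrite /in_level (ltn_trans _ kj)//; lra.
Qed.

Lemma col_bounds n c : c \in col n -> 0 <= c /\ c + w n <= sp n.
Proof.
elim: n c => [|n IHn] c; first by rewrite /= inE => /eqP ->; rewrite add0r.
have w0 := width_gt0 n.+1.
rewrite colS => /flattenP[s /mapP[j jr ->]]; move: jr; rewrite mem_iota leq0n add0n andTb => jr.
have jR : j.+1%:R * w n.+1 <= (r n.+1)%:R * w n.+1 by rewrite ler_pM2r// ler_nat.
have jw : 0 <= j%:R * w n.+1 by rewrite mulr_ge0// ltW.
rewrite -natr1 mulrDl mul1r in jR.
rewrite mem_cat => /orP[/mapP[c' /IHn[c0 cw] ->]|/mapP[k kj ->]].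
  by have := spstart_le n; rewrite widthS in jR; split; lra.
move: kj; rewrite mem_iota leq0n add0n andTb => kj; rewrite spS; have s0 := spstart_gt0 n.
have : ('C(j, 2) + k).+1%:R * w n.+1 <= 'C(r n.+1, 2)%:R * w n.+1.
  rewrite ler_pM2r// ler_nat; have := leq_bin2l 2 jr; rewrite binS bin1; lia.
rewrite -natr1 mulrDl mul1r => h1.
have : 0 <= ('C(j, 2) + k)%:R * w n.+1 by rewrite mulr_ge0// ltW.
by split; lra.
Qed.

(** No level straddles the discontinuity of the roof, which is therefore constant on each level. *)
Lemma col_spacer_or_base n c : c \in col n -> c + w n <= a \/ a <= c.
Proof.
elim: n c => [|n IHn] c; first by rewrite /= inE => /eqP ->; rewrite add0r; left.
have w0 := width_gt0 n.+1.
rewrite colS => /flattenP[s /mapP[j jr ->]]; move: jr; rewrite mem_iota leq0n add0n andTb => jr.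
have jR : j.+1%:R * w n.+1 <= (r n.+1)%:R * w n.+1 by rewrite ler_pM2r// ler_nat.
have jw : 0 <= j%:R * w n.+1 by rewrite mulr_ge0// ltW.
rewrite -natr1 mulrDl mul1r widthS in jR.
rewrite mem_cat => /orP[/mapP[c' /IHn[] cw ->]|/mapP[k kj ->]]; [left|right|right]; first lra.
  by lra.
have : 0 <= ('C(j, 2) + k)%:R * w n.+1 by rewrite mulr_ge0// ltW.
by have := spstart_mono (leq0n n); rewrite /=; lra.
Qed.

Lemma roof_level (p q : R) n c u : c \in col n -> 0 <= u -> u < w n ->
  roof a p q (c + u) = roof a p q c.
Proof.
move=> cc u0 uw; rewrite /roof; have [h1|h1] := col_spacer_or_base cc.
  by rewrite !ifT//; lra.
by rewrite !ifF//; apply/negbTE; rewrite -leNgt; lra.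
Qed.

End Columns.

(** * The vertical flow as a translation along a column *)

Section FlowOnColumns.
Variables (R : realType) (r : nat -> nat) (a p q : R).
Hypotheses (r0 : forall n, (0 < r n.+1)%N) (a0 : 0 < a) (q0 : 0 < q) (qp : q < p).
Notation w := (stair_width r a).
Notation sp := (stair_spstart r a).
Notation col := (stair_column r a).
Notation h := (stair_height r a).
Notation rf := (roof a p q).
Implicit Type A : set (R * R).

Lemma roof_ge x : q <= rf x.
Proof. by rewrite /roof; case: ifP => _ //; exact: ltW. Qed.

Lemma roof_le x : rf x <= p.
Proof. by rewrite /roof; case: ifP => _ //; exact: ltW. Qed.

Lemma roof_gt0 x : 0 < rf x.
Proof. exact: lt_le_trans q0 (roof_ge x). Qed.

Definition total (s : seq R) : R := \sum_(c <- s) rf c.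

Lemma total_cat s1 s2 : total (s1 ++ s2) = total s1 + total s2.
Proof. by rewrite /total big_cat. Qed.

Lemma total_ge0 s : 0 <= total s.
Proof. by apply: sumr_ge0 => c _; rewrite ltW// roof_gt0. Qed.

(* The special flow over a column is a translation of the coordinate [z],    *)
(* minus the distance to the top of the column: the lowest level comes last  *)
(* since the flow moves down the column.  [trace s A] is the indicator       *)
(* function of [A] in this coordinate.                                       *)
Fixpoint trace (s : seq R) A (z : R) : R :=
  if s is c :: s' then
    cell (- rf c) 0 z * \1_A (c, z + rf c) + trace s' A (z + rf c)
  else 0.

Lemma trace_cat s1 s2 A z :
  trace (s1 ++ s2) A z = trace s1 A z + trace s2 A (z + total s1).
Proof.
elim: s1 z => [|c s1 IHs] z; first by rewrite /total big_nil addr0 add0r.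
by rewrite /= IHs addrA /total big_cons addrA.
Qed.

Definition below (s : seq R) k := total (take k s).

Lemma below_cons c s k : below (c :: s) k.+1 = rf c + below s k.
Proof. by rewrite /below /= /total big_cons. Qed.

Lemma below0 s : below s 0 = 0. Proof. by rewrite /below take0 /total big_nil. Qed.

Lemma cell_shift (u v s x : R) : cell u v (x + s) = cell (u - s) (v - s) x.
Proof.
by rewrite /cell; congr (if _ then _ else _); apply/idP/idP => /andP[? ?];
  apply/andP; split; lra.
Qed.

Lemma traceE s A z : trace s A z = \sum_(k < size s)
  cell (- below s k.+1) (- below s k) z * \1_A (nth 0 s k, z + below s k.+1).
Proof.
elim: s z => [|c s IHs] z; first by rewrite big_ord0.
rewrite [LHS]/= big_ord_recl below_cons !below0 addr0 oppr0 IHs; congr (_ + _).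
apply: eq_bigr => k _; rewrite lift0 !below_cons [in LHS]cell_shift.
by congr (cell _ _ _ * \1_A (_, _)); ring.
Qed.

Lemma belowS s k : (k < size s)%N -> below s k.+1 = below s k + rf (nth 0 s k).
Proof. by move=> ks; rewrite /below (take_nth 0)// -cats1 total_cat /total big_seq1. Qed.

Lemma below_le s k k' : (k <= k')%N -> below s k <= below s k'.
Proof.
move=> kk'; rewrite /below -(subnKC kk') takeD total_cat lerDl; exact: total_ge0.
Qed.

Lemma below_size s : below s (size s) = total s.
Proof. by rewrite /below take_size. Qed.

Lemma below_ge s k : (k <= size s)%N -> k%:R * q <= below s k.
Proof.
elim: k => [|k IHk] ks; first by rewrite mul0r below0.
rewrite belowS// -natr1 mulrDl mul1r; apply: lerD; [exact: IHk (ltnW ks)|exact: roof_ge].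
Qed.

Lemma trace_at s A k z : (k < size s)%N -> - below s k.+1 <= z -> z < - below s k ->
  trace s A z = \1_A (nth 0 s k, z + below s k.+1).
Proof.
move=> ks z1 z2; rewrite traceE (bigD1 (Ordinal ks))//= big1 ?addr0 => [|k' k'k].
  by rewrite /cell z1 z2 mul1r.
rewrite /cell ifF ?mul0r//; apply/negP => /andP[z3 z4]; move: k'k.
rewrite -val_eqE/= neq_ltn => /orP[] lt.
  by have := below_le s lt; lra.
by have := below_le s lt; lra.
Qed.

Lemma indic_le1 A z : 0 <= (\1_A z : R) <= 1.
Proof. by rewrite indicE; case: (_ \in _); rewrite /= ?lexx ?ler01. Qed.

Lemma trace_le s A z : 0 <= trace s A z <= cell (- total s) 0 z.
Proof.
elim: s z => [|c s IHs] z; first by rewrite /= /cell; case: ifP; rewrite lexx ?ler01.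
rewrite /= /total big_cons -/(total s); have /andP[i0 i1] := indic_le1 A (c, z + rf c).
have /andP[t0 t1] := IHs (z + rf c); have rc := roof_gt0 c; have ts := total_ge0 s.
rewrite addr_ge0 ?mulr_ge0 ?cell_ge0//=.
apply: le_trans (lerD (ler_piMr (cell_ge0 _ _ _) i1) t1) _.
rewrite le_eqVlt; apply/orP; left; apply/eqP.
rewrite -(@cell_cat _ (- (rf c + total s)) (- rf c) 0); [|lra|lra].
by rewrite addrC cell_shift; congr (cell _ _ _ + _); ring.
Qed.

(** Over each level the set is a product. With [supported], this makes its trace determine its area
    and evolve by the tower recursion. *)
Definition adapted n A := forall c u y, c \in col n -> 0 <= u -> u < w n ->
  A (c + u, y) <-> A (c, y).

Definition supported n A := forall x y, A (x, y) -> x < sp n.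

(** Old levels are only subdivided, and the set is empty over the new spacers. *)
Lemma adaptedS n A : adapted n A -> supported n A -> adapted n.+1 A.
Proof.
move=> aA sA c u y; have w0 := width_gt0 r0 a0 n.+1.
rewrite colS => /flattenP[s /mapP[j jr ->]]; move: jr.
rewrite mem_iota leq0n add0n andTb => jr.
rewrite mem_cat => /orP[/mapP[c' c'c ->]|/mapP[k _ ->]] u0 uw.
  have jR : j.+1%:R * w n.+1 <= (r n.+1)%:R * w n.+1 by rewrite ler_pM2r// ler_nat.
  have jw : 0 <= j%:R * w n.+1 by rewrite mulr_ge0// ltW.
  rewrite -natr1 mulrDl mul1r widthS// in jR.
  by rewrite -addrA !aA//; lra.
have := mulr_ge0 (ler0n R ('C(j, 2) + k)) (ltW w0).
by split => /sA; lra.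
Qed.

Lemma supported_mono m n A : (m <= n)%N -> supported m A -> supported n A.
Proof. by move=> mn sA x y /sA; have := spstart_mono r0 a0 mn; lra. Qed.

Lemma adapted_mono m n A : (m <= n)%N -> adapted m A -> supported m A -> adapted n A.
Proof.
move=> /subnK <-; elim: (n - m)%N => // k IHk aA sA; rewrite addSn.
by apply: adaptedS (IHk aA sA) _; apply: supported_mono sA; rewrite leq_addl.
Qed.

Lemma indic_iff A (x y : R * R) : (A x <-> A y) -> \1_A x = \1_A y :> R.
Proof.
move=> xy; rewrite !indicE; congr (_%:R); congr nat_of_bool.
by apply/idP/idP; rewrite !inE; apply xy.
Qed.

Lemma spacer_ge n i : a <= sp n + i%:R * w n.+1.
Proof.
have := mulr_ge0 (ler0n R i) (ltW (width_gt0 r0 a0 n.+1)).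
by have := spstart_mono r0 a0 (leq0n n); rewrite [sp 0]/=; lra.
Qed.

Lemma roof_spacer n i : rf (sp n + i%:R * w n.+1) = q.
Proof. by rewrite /roof ltNge spacer_ge. Qed.

Lemma copy_width n j : (j < r n.+1)%N ->
  0 <= j%:R * w n.+1 /\ j%:R * w n.+1 + w n.+1 <= w n.
Proof.
move=> jr; have w0 := width_gt0 r0 a0 n.+1.
have : j.+1%:R * w n.+1 <= (r n.+1)%:R * w n.+1 by rewrite ler_pM2r// ler_nat.
rewrite -natr1 mulrDl mul1r widthS// => h1; split => //.
by rewrite mulr_ge0// ltW.
Qed.

Lemma roof_copy n j c : (j < r n.+1)%N -> c \in col n -> rf (c + j%:R * w n.+1) = rf c.
Proof.
move=> jr cc; have [h1 h2] := copy_width jr; have w0 := width_gt0 r0 a0 n.+1.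
by apply: (roof_level r0 a0 p q cc) => //; lra.
Qed.

Lemma total_block n j : (j < r n.+1)%N ->
  total (block r a n j) = total (col n) + j%:R * q.
Proof.
move=> jr; rewrite /block total_cat; congr (_ + _); rewrite /total big_map.
  by rewrite [LHS]big_seq [RHS]big_seq; apply: eq_bigr => c cc; exact: roof_copy.
rewrite (eq_bigr (fun=> q)) => [|k _]; last exact: roof_spacer.
by rewrite big_const_seq count_predT size_iota iter_addr_0 mulr_natl.
Qed.

Lemma total_blocks n J : (J <= r n.+1)%N ->
  total (blocks r a n J) = offset q (total (col n)) J.
Proof.
elim: J => [|J IHJ] JR.
  by rewrite /offset /total big_nil bin0n mul0r mulr0 addr0.
rewrite blocksS total_cat IHJ ?(ltnW JR)// total_block// /offset binS bin1 natrD -natr1.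
by ring.
Qed.

Lemma totalS n : total (col n.+1) = offset q (total (col n)) (r n.+1).
Proof. by rewrite colS total_blocks. Qed.

Lemma trace_map n j A z : (j < r n.+1)%N -> adapted n A ->
  trace [seq c + j%:R * w n.+1 | c <- col n] A z = trace (col n) A z.
Proof.
move=> jr aA; have [h1 h2] := copy_width jr; have w0 := width_gt0 r0 a0 n.+1.
have rc c : c \in col n -> rf (c + j%:R * w n.+1) = rf c by exact: roof_copy.
have d0 : j%:R * w n.+1 < w n by lra.
set d := j%:R * w n.+1 in h1 rc d0 *; clearbody d.
have : {subset col n <= col n} by [].
elim: {1 3 4}(col n) z => //= c s IHs z sub.
have cc : c \in col n by apply: sub; rewrite inE eqxx.
rewrite rc// IHs => [|c' c's]; last by apply: sub; rewrite inE c's orbT.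
by congr (_ * _ + _); apply: indic_iff; exact: aA.
Qed.

Lemma trace_spacers n A z (s : seq nat) : supported n A ->
  trace [seq sp n + i%:R * w n.+1 | i <- s] A z = 0.
Proof.
move=> sA; have := width_gt0 r0 a0 n.+1; set d := w n.+1; clearbody d => d0.
elim: s z => //= i s IHs z; rewrite IHs addr0.
rewrite indicE (_ : (_ \in _) = false) ?mulr0//; apply/negP; rewrite inE => /sA.
by have := mulr_ge0 (ler0n R i) (ltW d0); lra.
Qed.

Lemma trace_blocks n A J z : (J <= r n.+1)%N -> adapted n A -> supported n A ->
  trace (blocks r a n J) A z =
  \sum_(j < J) trace (col n) A (z + offset q (total (col n)) j).
Proof.
move=> + aA sA; elim: J => [|J IHJ] JR; first by rewrite big_ord0.
rewrite blocksS trace_cat IHJ ?(ltnW JR)// total_blocks ?(ltnW JR)// big_ord_recr/=.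
congr (_ + _); rewrite /block trace_cat trace_map// addrC.
rewrite (_ : [seq sp n + ('C(J, 2) + k)%:R * w n.+1 | k <- iota 0 J] =
   [seq sp n + i%:R * w n.+1 | i <- [seq ('C(J, 2) + k)%N | k <- iota 0 J]]).
  by rewrite trace_spacers// add0r.
by rewrite -map_comp.
Qed.

Lemma traceS n A z : adapted n A -> supported n A ->
  trace (col n.+1) A z = \sum_(j < r n.+1) trace (col n) A (z + offset q (total (col n)) j).
Proof. by move=> aA sA; rewrite colS trace_blocks. Qed.

(** The flow adds [t] to the coordinate [y - below (col n) k.+1], provided that it does not leave
    through the roof of the bottom level. The bound on [t] is preserved at a crossing because the
    next roof is at least [q]. *)
Lemma vflow_tower n k y t fuel : (k < h n)%N -> 0 <= y -> y < rf (nth 0 (col n) k) ->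
  0 <= t -> y + t < below (col n) k.+1 -> t < q * fuel%:R + (rf (nth 0 (col n) k) - y) ->
  exists k' y', [/\ (k' < h n)%N, 0 <= y' < rf (nth 0 (col n) k'),
    y' - below (col n) k'.+1 = y + t - below (col n) k.+1 &
    forall u, 0 <= u -> u < w n ->
      vflow_fuel (stair_T_inv r a) a p q fuel (nth 0 (col n) k + u) y t =
      (nth 0 (col n) k' + u, y')].
Proof.
elim: fuel k y t => [|fuel IHf] k y t kh y0 yf t0 yt tf.
  exists k, (y + t); split=> //; [by apply/andP; split; lra|] => u u0 uw.
  by rewrite /= (roof_level r0 a0 p q (mem_nth 0 kh))// ifT//; lra.
have cc : nth 0 (col n) k \in col n by rewrite mem_nth.
have [ytf|ytf] := ltP (y + t) (rf (nth 0 (col n) k)).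
  exists k, (y + t); split=> //; first by apply/andP; split; lra.
  by move=> u u0 uw; rewrite /= (roof_level r0 a0 p q cc)// ytf.
have bk := belowS kh.
case: k => [|k] in kh y0 yf yt tf cc ytf bk *.
  by exfalso; move: bk yt; rewrite below0 => ->; lra.
have kh' := ltnW kh; have bk' := belowS kh'.
have f1 := roof_ge (nth 0 (col n) k).
rewrite -natr1 in tf.
set f := rf (nth 0 (col n) k.+1) in yf tf ytf bk *.
have t1 : 0 <= t - (f - y) by lra.
have t2 : 0 + (t - (f - y)) < below (col n) k.+1 by lra.
have t3 : t - (f - y) < q * fuel%:R + (rf (nth 0 (col n) k) - 0) by lra.
have [k' [y' [k'h y'r y'E hf]]] := IHf k 0 _ kh' (lexx 0) (roof_gt0 _) t1 t2 t3.
exists k', y'; split => //; first by rewrite y'E; lra.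
move=> u u0 uw; rewrite -(hf u u0 uw) /= (roof_level r0 a0 p q cc)// -/f ltNge ytf/=.
congr (vflow_fuel _ _ _ _ _ _ _ _).
rewrite (@stair_T_invE _ r a r0 a0 n k.+1)//=; first by ring.
by rewrite /in_level kh/=; apply/andP; split; lra.
Qed.

End FlowOnColumns.

(** * Measurability of the staircase maps and of the flow *)

Section FlowMeasurability.
Variables (R : realType) (r : nat -> nat) (a : R).
Hypotheses (r0 : forall n, (0 < r n.+1)%N) (a0 : 0 < a).
Notation w := (stair_width r a).
Notation sp := (stair_spstart r a).
Notation col := (stair_column r a).
Notation h := (stair_height r a).

Lemma measurable_cell (u v : R) : measurable_fun setT (cell u v).
Proof. by have [] := nice_ind u v. Qed.

Lemma sum_level n (g : nat -> R) x k : in_level r a n k x ->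
  \sum_(i < h n) cell (nth 0 (col n) i) (nth 0 (col n) i + w n) x * g i = g k.
Proof.
move=> kx; have /andP[kh kx'] := kx.
rewrite (bigD1 (Ordinal kh))//= big1 ?addr0 => [|i ik]; first by rewrite /cell kx' mul1r.
rewrite /cell; case: ifP => ix; rewrite ?mul0r//; exfalso; move/negP: ik; apply.
apply/eqP/val_inj => /=; apply: (level_uniq r0 a0 _ kx).
by rewrite /in_level ltn_ord.
Qed.

Lemma sum_no_level n (g : nat -> R) x : ~~ (0 <= x < sp n) ->
  \sum_(i < h n) cell (nth 0 (col n) i) (nth 0 (col n) i + w n) x * g i = 0.
Proof.
move=> nx; apply: big1 => i _; rewrite /cell; case: ifP => ix; rewrite ?mul0r//.
exfalso; move/negP: nx; apply; apply: (level_range r0 a0 (k := i)).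
by rewrite /in_level ltn_ord.
Qed.

Lemma stair_Tn_inv_sum n x : stair_Tn_inv r a n x = x +
  \sum_(k < h n) cell (nth 0 (col n) k) (nth 0 (col n) k + w n) x *
    (if (0 < k)%N then nth 0 (col n) k.-1 - nth 0 (col n) k else 0).
Proof.
have [xs|xs] := boolP (0 <= x < sp n); last first.
  rewrite (sum_no_level (fun k => if (0 < k)%N then nth 0 (col n) k.-1 - nth 0 (col n) k else 0) xs).
  by rewrite /stair_Tn_inv (stair_level_out r0 a0 xs) -/(h n) ltnn andbF addr0.
have [k kx] := level_exists r0 a0 xs; have /andP[kh _] := kx.
rewrite (sum_level (fun k => if (0 < k)%N then nth 0 (col n) k.-1 - nth 0 (col n) k else 0) kx).
rewrite /stair_Tn_inv (stair_levelE r0 a0 kx) -/(h n) kh andbT.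
by case: ifP => _; ring.
Qed.

Lemma stair_Tn_sum n x : stair_Tn r a n x = x +
  \sum_(k < h n) cell (nth 0 (col n) k) (nth 0 (col n) k + w n) x *
    (if (k.+1 < h n)%N then nth 0 (col n) k.+1 - nth 0 (col n) k else 0).
Proof.
have [xs|xs] := boolP (0 <= x < sp n); last first.
  rewrite (sum_no_level (fun k => if (k.+1 < h n)%N then nth 0 (col n) k.+1 - nth 0 (col n) k else 0) xs).
  rewrite /stair_Tn (stair_level_out r0 a0 xs) -/(h n) ifF ?addr0//.
  by apply/negbTE; rewrite -leqNgt leqW.
have [k kx] := level_exists r0 a0 xs; have /andP[kh _] := kx.
rewrite (sum_level (fun k => if (k.+1 < h n)%N then nth 0 (col n) k.+1 - nth 0 (col n) k else 0) kx).
rewrite /stair_Tn (stair_levelE r0 a0 kx) -/(h n).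
by case: ifP => _; ring.
Qed.

Lemma measurable_step n (g : nat -> R) : measurable_fun setT (fun x : R => x +
  \sum_(k < h n) cell (nth 0 (col n) k) (nth 0 (col n) k + w n) x * g k).
Proof.
apply: measurable_funD => //.
have : forall s : seq 'I_(h n), measurable_fun setT (fun x : R =>
    \sum_(k <- s) cell (nth 0 (col n) k) (nth 0 (col n) k + w n) x * g k).
  elim=> [|k s IHs]; first by under eq_fun do rewrite big_nil; exact: measurable_cst.
  under eq_fun do rewrite big_cons; apply: measurable_funD => //.
  apply: measurable_funM; [exact: measurable_cell|exact: measurable_cst].
by move=> /(_ (index_enum _)).
Qed.

(** In both cases the approximating sequence is eventually constant, so the limit exists at every
    point, including those never off a bottom level; measurability passes to it. *)
Lemma stair_T_inv_cases x : (exists n k, (0 < k)%N /\ in_level r a n k x) \/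
  (forall n, stair_Tn_inv r a n x = x).
Proof.
have [|nex] := pselect (exists n k, (0 < k)%N /\ in_level r a n k x); first by left.
right=> n; have [xs|xs] := boolP (0 <= x < sp n); last first.
  by rewrite /stair_Tn_inv (stair_level_out r0 a0 xs) -/(h n) ltnn andbF.
have [k kx] := level_exists r0 a0 xs; rewrite /stair_Tn_inv (stair_levelE r0 a0 kx).
have [->//|k0] := posnP k; exfalso; apply: nex; by exists n, k.
Qed.

Lemma stair_T_cases x : (exists n k, (k.+1 < h n)%N /\ in_level r a n k x) \/
  (forall n, stair_Tn r a n x = x).
Proof.
have [|nex] := pselect (exists n k, (k.+1 < h n)%N /\ in_level r a n k x); first by left.
right=> n; have [xs|xs] := boolP (0 <= x < sp n); last first.
  rewrite /stair_Tn (stair_level_out r0 a0 xs) -/(h n) ifF//.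
  by apply/negbTE; rewrite -leqNgt leqW.
have [k kx] := level_exists r0 a0 xs; rewrite /stair_Tn (stair_levelE r0 a0 kx) -/(h n).
by case: ifPn => // kh; exfalso; apply: nex; exists n, k.
Qed.

Lemma stair_T_inv_cvg x : stair_Tn_inv r a n x @[n --> \oo] --> stair_T_inv r a x.
Proof.
suff [n [l hl]] : exists n l, forall m, (n <= m)%N -> stair_Tn_inv r a m x = l.
  rewrite (_ : stair_T_inv r a x = l); last exact: limn_eventually hl.
  by apply: cvg_near_cst; exists n => // m /= /hl.
have [[n [k [k0 kx]]]|hx] := stair_T_inv_cases x; last by exists 0%N, x.
exists n, (x - nth 0 (col n) k + nth 0 (col n) k.-1) => m nm.
have [k' [k'0 k'x e]] := in_level_down r0 a0 k0 kx nm.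
by rewrite (stair_Tn_invE r0 a0 k'0 k'x); lra.
Qed.

Lemma stair_T_cvg x : stair_Tn r a n x @[n --> \oo] --> stair_T r a x.
Proof.
suff [n [l hl]] : exists n l, forall m, (n <= m)%N -> stair_Tn r a m x = l.
  rewrite (_ : stair_T r a x = l); last exact: limn_eventually hl.
  by apply: cvg_near_cst; exists n => // m /= /hl.
have [[n [k [k0 kx]]]|hx] := stair_T_cases x; last by exists 0%N, x.
exists n, (x - nth 0 (col n) k + nth 0 (col n) k.+1) => m nm.
have [k' [k'0 k'x e]] := in_level_up r0 a0 k0 kx nm.
by rewrite (stair_TnE r0 a0 k'0 k'x); lra.
Qed.

Lemma measurable_stair_T_inv : measurable_fun setT (stair_T_inv r a : R -> R).
Proof.
apply: (@measurable_fun_cvg _ _ _ _ (fun n x => stair_Tn_inv r a n x)) => [n|x _].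
  by under eq_fun do rewrite stair_Tn_inv_sum;
    exact: (measurable_step n (fun k => if (0 < k)%N then nth 0 (col n) k.-1 - nth 0 (col n) k else 0)).
exact: stair_T_inv_cvg.
Qed.

Lemma measurable_stair_T : measurable_fun setT (stair_T r a : R -> R).
Proof.
apply: (@measurable_fun_cvg _ _ _ _ (fun n x => stair_Tn r a n x)) => [n|x _].
  by under eq_fun do rewrite stair_Tn_sum;
    exact: (measurable_step n (fun k => if (k.+1 < h n)%N then nth 0 (col n) k.+1 - nth 0 (col n) k else 0)).
exact: stair_T_cvg.
Qed.

Variables p q : R.

Lemma measurable_roof : measurable_fun setT (roof a p q : R -> R).
Proof.
apply: measurable_fun_ifT; [|exact: measurable_cst|exact: measurable_cst].
by apply: measurable_fun_ltr => //; exact: measurable_cst.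
Qed.

Lemma measurable_vflow_fuel fuel (x y t : R * R -> R) :
  measurable_fun setT x -> measurable_fun setT y -> measurable_fun setT t ->
  measurable_fun setT (fun z =>
    vflow_fuel (stair_T_inv r a) a p q fuel (x z) (y z) (t z)).
Proof.
elim: fuel x y t => [|fuel IHf] x y t mx my mt /=.
  have e : measurable_fun setT (fun z => (x z, y z + t z)).
    by apply: measurable_fun_pair => //; exact: measurable_funD.
  rewrite (_ : (fun z => _) = (fun z => (x z, y z + t z))) //.
  by apply/funext => z; case: ifP.
have mr : measurable_fun setT (fun z => roof a p q (x z)).
  exact: (measurableT_comp measurable_roof).
apply: measurable_fun_ifT.
- by apply: measurable_fun_ltr => //; exact: measurable_funD.
- by apply: measurable_fun_pair => //; exact: measurable_funD.
- apply: IHf.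
  + exact: (measurableT_comp measurable_stair_T_inv).
  + exact: measurable_cst.
  + by apply: measurable_funB => //; exact: measurable_funB.
Qed.

Lemma measurable_vflow t : measurable_fun setT (vflow (stair_T_inv r a) a p q t : R * R -> R * R).
Proof.
apply: measurable_vflow_fuel; [exact: measurable_fst|exact: measurable_snd|].
exact: measurable_cst.
Qed.

Lemma measurable_polygon : measurable (polygon a p q : set (R * R)).
Proof.
have mr : measurable_fun setT (fun z : R * R => roof a p q z.1).
  exact: (measurableT_comp measurable_roof measurable_fst).
have e : polygon a p q = (fun z : R * R =>
    ((0 <= z.1) && (z.1 < 1)) && ((0 <= z.2) && (z.2 < roof a p q z.1))) @^-1` [set true].
  by apply/seteqP; split=> z /=; [case=> -> ->|move=> /andP[]].
rewrite e -[X in measurable X]setTI.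
have mle f : measurable_fun setT f -> measurable_fun setT (fun z : R * R => 0 <= f z :> R).
  by move=> mf; apply: measurable_fun_ler => //; exact: measurable_cst.
apply: measurable_and => //; apply: measurable_and => //.
- by apply: mle; exact: measurable_fst.
- by apply: measurable_fun_ltr; [exact: measurable_fst|exact: measurable_cst].
- by apply: mle; exact: measurable_snd.
- by apply: measurable_fun_ltr => //; exact: measurable_snd.
Qed.

End FlowMeasurability.

(** * Area and flow correlations *)

Section Area.
Variable R : realType.
Variables (p : R) (p0 : 0 < p).
Implicit Types E F : set (R * R).

(** A bounding rectangle of finite area for all the sets, so that real-valued areas may be added and
    subtracted. *)
Definition frame : set (R * R) := `[0, 1[%classic `*` `[0, p[%classic.

Definition area E : R := fine (leb2 E).

Lemma area_def E : area E = fine (leb2 E). Proof. by []. Qed.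

Lemma measurable_frame : measurable frame.
Proof. by apply: measurableX; exact: measurable_itv. Qed.

Lemma leb2X (A B : set R) : measurable A -> measurable B ->
  leb2 (A `*` B) = (lebesgue_measure A * lebesgue_measure B)%E.
Proof. by move=> mA mB; rewrite /leb2 product_measure1E. Qed.

Lemma leb2_frame : leb2 frame = p%:E.
Proof.
rewrite leb2X; [|exact: measurable_itv|exact: measurable_itv].
by rewrite !lebesgue_measure_itv/= !lte_fin ltr01 p0 -!EFinB !subr0 mul1e.
Qed.

Lemma area_frame : area frame = p.
Proof. by rewrite /area leb2_frame. Qed.

Lemma leb2_le E F : measurable E -> measurable F -> E `<=` F -> (leb2 E <= leb2 F)%E.
Proof.
move=> mE mF EF; rewrite /leb2.
by apply: (le_measure (lebesgue_measure \x lebesgue_measure)%E); rewrite ?inE.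
Qed.

Lemma areaE E : measurable E -> E `<=` frame -> leb2 E = (area E)%:E.
Proof.
move=> mE EF; rewrite /area fineK// ge0_fin_numE; last exact: measure_ge0.
by rewrite (le_lt_trans (leb2_le mE measurable_frame EF))// leb2_frame ltry.
Qed.

Lemma area_ge0 E : 0 <= area E.
Proof. by apply: fine_ge0; exact: measure_ge0. Qed.

Lemma area0 : area set0 = 0.
Proof. by rewrite /area /leb2 measure0. Qed.

Lemma area_le E F : measurable E -> measurable F -> E `<=` F -> F `<=` frame ->
  area E <= area F.
Proof.
move=> mE mF EF FQ; rewrite -lee_fin -!areaE//; first exact: leb2_le.
exact: subset_trans FQ.
Qed.

Lemma areaU E F : measurable E -> measurable F -> E `<=` frame -> F `<=` frame ->
  E `&` F = set0 -> area (E `|` F) = area E + area F.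
Proof.
move=> mE mF EQ FQ EF0; apply: EFin_inj; rewrite EFinD -!areaE//.
- by rewrite /leb2 measureU.
- exact: measurableU.
- by rewrite subUset.
Qed.

Lemma areaD E F : measurable E -> measurable F -> E `<=` F -> F `<=` frame ->
  area (F `\` E) = area F - area E.
Proof.
move=> mE mF EF FQ; apply/esym/eqP; rewrite subr_eq -areaU//.
- by rewrite setUC setDUK.
- exact: measurableD.
- by move=> x [/FQ].
- exact: subset_trans FQ.
- by rewrite setDE -setIA (setIC _ E) setICr setI0.
Qed.

Lemma area_strip c w (A : set R) : 0 <= w -> measurable A -> A `<=` `[0, p[%classic ->
  area (`[c, c + w[%classic `*` A) = w * Int (\1_A : R -> R).
Proof.
move=> w0 mA Ap; have h1 : (lebesgue_measure A < +oo)%E.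
  apply: (@le_lt_trans _ _ (lebesgue_measure (`[0, p[%classic : set R))).
    by apply: le_measure; rewrite ?inE//; exact: measurable_itv.
  by rewrite lebesgue_measure_itv/= lte_fin p0 -EFinB ltry.
rewrite /area leb2X//.
rewrite /Int /Rintegral integral_indic// setIT.
rewrite lebesgue_measure_itv/= lte_fin -EFinB.
have /fineK <- : lebesgue_measure A \is a fin_num by rewrite ge0_fin_numE.
move: w0; rewrite le_eqVlt => /predU1P[<-|w0].
  by rewrite addr0 ltxx mul0e mul0r.
by rewrite ltrDl w0 -EFinM/=; congr (_ * _); ring.
Qed.

Lemma leb2_bigcup (F : nat -> set (R * R)) : (forall n, measurable (F n)) ->
  trivIset setT F -> leb2 (\bigcup_n F n) = (\sum_(0 <= n <oo) leb2 (F n))%E.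
Proof.
move=> mF tF; have mU : measurable (\bigcup_n F n) by exact: bigcupT_measurable.
refine (@measure_semi_bigcup _ _ _ (lebesgue_measure \x lebesgue_measure)%E F mF tF mU).
Qed.

Lemma area_bigU_le (A : nat -> set (R * R)) e : (forall n, measurable (A n)) ->
  (forall n, A n `<=` frame) -> 0 < e ->
  exists n, area (\bigcup_k A k `\` \big[setU/set0]_(i < n) A i) <= e.
Proof.
move=> mA AQ e0; pose S := \bigcup_k A k; pose U n := \big[setU/set0]_(i < n) A i.
have mU n : measurable (U n) by apply: bigsetU_measurable.
have mS : measurable S by apply: bigcup_measurable.
have SQ : S `<=` frame by apply: bigcup_sub.
have mUU : measurable (\bigcup_n U n) by exact: bigcupT_measurable.
have US n : U n `<=` S by rewrite /U -bigcup_mkord => x [i /= ilt xA]; exists i.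
have cv : leb2 (U n) @[n --> \oo] --> leb2 S.
  rewrite (_ : S = \bigcup_n U n).
    refine (@nondecreasing_cvg_mu _ _ _ (lebesgue_measure \x lebesgue_measure)%E U mU mUU _).
    by move=> m n mn; apply/subsetPset; apply: subset_bigsetU.
  apply/seteqP; split => x; last by move=> [n _ /US].
  by move=> [k _ xk]; exists k.+1 => //; rewrite /U -bigcup_mkord; exists k => /=.
rewrite areaE// in cv.
move/fine_cvgP: cv => [_] /cvgrPdist_le /(_ e e0)[n _ /(_ n (leqnn n))/= h]; exists n.
rewrite (areaD (mU n) mS (US n) SQ); move: h; rewrite -/(area S) -/(area (U n)) => h.
by apply: le_trans h; exact: ler_norm.
Qed.

End Area.

Opaque area.

(** * Areas of flow correlations as integrals of traces *)

Section FlowCorrelations.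
Variables (R : realType) (r : nat -> nat) (a p q : R).
Hypotheses (r0 : forall n, (0 < r n.+1)%N) (a0 : 0 < a) (q0 : 0 < q) (qp : q < p).
Notation w := (stair_width r a).
Notation sp := (stair_spstart r a).
Notation col := (stair_column r a).
Notation h := (stair_height r a).
Notation rf := (roof a p q).
Notation P := (polygon a p q).
Notation vf := (vflow (stair_T_inv r a) a p q).
Hypothesis sp1 : forall n, sp n <= 1.
Implicit Type A B E : set (R * R).

Lemma p_gt0 : 0 < p. Proof. exact: lt_trans q0 qp. Qed.

Lemma polygon_frame : P `<=` frame p.
Proof.
move=> [x y] /= [x01 /andP[y0 yf]]; split; rewrite /= in_itv//=.
by rewrite y0 (lt_le_trans yf)// roof_le.
Qed.

Lemma indic_inj (z z' : R * R) A : \1_A z = \1_A z' :> R -> A z <-> A z'.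
Proof.
rewrite !indicE; case: (boolP (z \in A)); case: (boolP (z' \in A)).
- by rewrite !inE.
- by move=> _ _ /eqP; rewrite oner_eq0.
- by move=> _ _ /eqP; rewrite eq_sym oner_eq0.
- by rewrite !notin_setE.
Qed.

Lemma measurable_slice E (x : R) : measurable E -> measurable [set y | E (x, y)].
Proof.
move=> mE; rewrite (_ : [set _ | _] = (fun y : R => (x, y)) @^-1` E)//.
rewrite -[X in measurable X]setTI; apply: (measurable_fun_pair _ _ measurableT mE).
  exact: measurable_cst.
exact: measurable_id.
Qed.

Lemma nice_trace s A : measurable A -> nice (trace a p q s A).
Proof.
move=> mA; elim: s => [|c s IHs]; first exact: nice0.
apply: niceD; last exact: nice_shift IHs.
apply: (nice_bndM (N := 1)); first exact: nice_ind.
  rewrite (_ : (fun z => _) = (\1_[set y | A (c, y)] : R -> R) \o (fun z => z + rf c)).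
    apply: measurableT_comp; first by apply: measurable_indic; exact: measurable_slice.
    exact: measurable_funD.
  by apply/funext => z; rewrite /= !indicE; congr (_%:R); congr nat_of_bool;
    apply/idP/idP; rewrite !inE.
by move=> z; have /andP[i0 i1] := indic_le1 A (c, z + rf c); rewrite ger0_norm.
Qed.

(** Time [t] at most the height below level [k] keeps the orbit inside the column; two units of fuel
    beyond the integer part of t / q cover all crossings. *)
Lemma vflow_trace n k A (t y u : R) : adapted r a n A -> A `<=` P -> (k < h n)%N ->
  0 <= t -> t <= below a p q (col n) k -> 0 <= y < rf (nth 0 (col n) k) -> 0 <= u < w n ->
  \1_A (vf t (nth 0 (col n) k + u, y)) =
  trace a p q (col n) A (y - below a p q (col n) k.+1 + t).
Proof.
move=> aA AP kh t0 tk /andP[y0 yf] /andP[u0 uw].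
have bk := belowS a p q kh.
have tf : t < q * (Num.truncn (t / q)).+2%:R + (rf (nth 0 (col n) k) - y).
  have := truncnS_gt (t / q); rewrite ltr_pdivrMr//; set N := Num.truncn _ => tN.
  by rewrite -[N.+2%:R]natr1 mulrDr mulr1 (mulrC q); have := q0; lra.
have yt : y + t < below a p q (col n) k.+1 by lra.
have [k' [y' [k'h /andP[y'0 y'f] y'E hf]]] := vflow_tower r0 a0 q0 qp kh y0 yf t0 yt tf.
have -> : vf t (nth 0 (col n) k + u, y) = (nth 0 (col n) k' + u, y') by exact: hf.
rewrite (_ : y - _ + t = y' - below a p q (col n) k'.+1); last by rewrite y'E; lra.
rewrite (trace_at q0 qp A k'h)//; [|by lra|by have := belowS a p q k'h; lra].
rewrite subrK; apply: indic_iff; apply: aA => //; exact: mem_nth.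
Qed.

Definition slab n k : set (R * R) :=
  `[nth 0 (col n) k, nth 0 (col n) k + w n[%classic `*` `[0, p[%classic.

Lemma measurable_slab n k : measurable (slab n k).
Proof. by apply: measurableX; exact: measurable_itv. Qed.

Lemma sum_slabs n E K : (K <= h n)%N -> measurable E -> E `<=` frame p ->
  area (E `&` \big[setU/set0]_(k < K) slab n k) = \sum_(k < K) area (E `&` slab n k).
Proof.
move=> + mE EQ; elim: K => [|K IHK] Kh; first by rewrite !big_ord0 setI0 area0.
rewrite !big_ord_recr/= setIUr (areaU p_gt0) ?IHK ?(ltnW Kh)//.
- apply: measurableI => //; apply: bigsetU_measurable => i _; exact: measurable_slab.
- by apply: measurableI => //; exact: measurable_slab.
- by move=> z [/EQ].
- by move=> z [/EQ].
- apply/seteqP; split => // z [[_ zU] [_ [/= zK _]]]; move: zU.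
  rewrite -bigcup_mkord => -[i /= iK [/= zi _]]; move: zK zi; rewrite !in_itv/= => zK zi.
  have := @level_uniq R r a r0 a0 n i K z.1; rewrite /in_level zi zK (ltn_trans iK Kh) Kh.
  by move=> /(_ isT isT) iK'; move: iK; rewrite iK' ltnn.
Qed.

Lemma slab_le n k E : (k < h n)%N -> measurable E -> E `<=` frame p ->
  0 <= area (E `&` slab n k) <= w n * p.
Proof.
move=> kh mE EQ; rewrite area_ge0/=.
have w0 := width_gt0 r0 a0 n.
have sQ : slab n k `<=` frame p.
  have [c0 cw] := col_bounds r0 a0 (mem_nth 0 kh); have s1 := sp1 n.
  by move=> z [/= z1 z2]; split => //=; move: z1; rewrite !in_itv/=; lra.
have mS := measurable_slab n k.
apply: (@le_trans _ _ (area (slab n k))).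
  by apply: (area_le p_gt0 _ mS _ sQ); [exact: measurableI|exact: subIsetr].
rewrite /slab (area_strip p_gt0 _ (ltW w0))//.
rewrite (_ : \1_ _ = cell 0 p); last first.
  by apply/funext => z; rewrite /cell indicE mem_setE in_itv/=; case: ifP.
by rewrite (Int_ind (ltW p_gt0)) subr0.
Qed.

Lemma area_outside n E : measurable E -> E `<=` frame p ->
  0 <= area E - area (E `&` \big[setU/set0]_(k < h n) slab n k) <= p * (1 - sp n).
Proof.
move=> mE EQ; set U := \big[_/_]_(k < _) _.
have mU : measurable U by apply: bigsetU_measurable => i _; exact: measurable_slab.
have mF := measurable_frame p; have FF := @subset_refl _ (frame p).
have eU B : measurable B -> B `<=` frame p -> area B - area (B `&` U) = area (B `\` U).
  move=> mB BQ; rewrite -(areaD p_gt0) ?setDIr ?setDv ?set0U//.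
  exact: measurableI.
rewrite eU// area_ge0/=.
apply: (@le_trans _ _ (area (frame p `\` U))).
  apply: (area_le p_gt0); [exact: measurableD|exact: measurableD| |by move=> z []].
  by move=> z [/EQ].
rewrite -eU// sum_slabs// (eq_bigr (fun=> w n * p)); last first.
  move=> k _; apply/eqP; rewrite eq_le; have /andP[_ ->] := slab_le (ltn_ord k) mF FF.
  have w0 := width_gt0 r0 a0 n.
  have sQ : slab n k `<=` frame p.
    have [c0 cw] := col_bounds r0 a0 (mem_nth 0 (ltn_ord k)); have s1 := sp1 n.
    by move=> z [/= z1 z2]; split => //=; move: z1; rewrite !in_itv/=; lra.
  rewrite setIC (setIidl sQ) /slab (area_strip p_gt0 _ (ltW w0))//.
  rewrite (_ : \1_ _ = cell 0 p); last first.
    by apply/funext => z; rewrite /cell indicE mem_setE in_itv/=; case: ifP.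
  by rewrite (Int_ind (ltW p_gt0)) subr0 lexx.
rewrite sumr_const card_ord -mulr_natl mulrA height_width// area_frame; last exact: p_gt0.
by rewrite mulrBr mulr1 mulrC.
Qed.

Lemma sum_below_cells (s : seq R) (z : R) :
  \sum_(k < size s) cell (- below a p q s k.+1) (- below a p q s k) z =
  cell (- total a p q s) 0 z.
Proof.
rewrite -below_size; elim: {-2}(size s) (leqnn (size s)) => [|K IHK] Ks.
  rewrite big_ord0 below0 /cell ifF//; apply/negP => /andP[]; lra.
rewrite big_ord_recr/= (IHK (ltnW Ks)) addrC cell_cat//.
  by rewrite lerN2; exact: below_le.
by rewrite oppr_le0; apply: (total_ge0 _ q0 qp).
Qed.

(** Over one level the set is a product of the level with a vertical fibre, and the fibre is read
    off the traces. *)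
Lemma slab_correlation n k A B (t : R) : measurable A -> measurable B -> A `<=` P -> B `<=` P ->
  adapted r a n A -> adapted r a n B -> (k < h n)%N -> 0 <= t ->
  t <= below a p q (col n) k ->
  area ((vf t @^-1` A `&` B) `&` slab n k) =
  w n * Int (fun z => cell (- below a p q (col n) k.+1) (- below a p q (col n) k) z *
     (trace a p q (col n) B z * trace a p q (col n) A (z + t))).
Proof.
move=> mA mB AP BP aA aB kh t0 tk; set c := nth 0 (col n) k.
have w0 := width_gt0 r0 a0 n; have cc : c \in col n by exact: mem_nth.
have bk := belowS a p q kh; rewrite -/c in bk.
set E := vf t @^-1` A `&` B.
have mE : measurable E.
  apply: measurableI => //; rewrite -[X in measurable X]setTI.
  exact: (measurable_vflow r0 a0 p q t measurableT mA).
have EP y : E (c, y) -> 0 <= y < rf c by move=> [_ /BP []].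
have sl y u : 0 <= y < rf c -> 0 <= u < w n -> E (c + u, y) <-> E (c, y).
  move=> y0 uw; have /andP[u0 uw'] := uw.
  have := vflow_trace aA AP kh t0 tk y0 uw; have u00 : 0 <= (0 : R) < w n by rewrite lexx w0.
  have := vflow_trace aA AP kh t0 tk y0 u00; rewrite -/c addr0 => <-.
  move=> e0; have e := indic_inj e0; rewrite /E /= aB//.
  by split=> -[h1 h2]; split=> //; apply e.
have -> : E `&` slab n k = `[c, c + w n[%classic `*` [set y | E (c, y)].
  apply/seteqP; split=> -[x y] /=.
    move=> [Exy [/=]]; rewrite ?in_itv/= -/c => xc y0.
    have [_ /BP[/= _ yf]] := Exy.
    have rx : rf x = rf c.
      rewrite -(roof_level r0 a0 p q cc (u := x - c)); [congr rf; ring|lra|lra].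
    split => //.
    apply/(sl y (x - c)); [by rewrite -rx|lra|].
    by rewrite (_ : c + (x - c) = x)//; ring.
  rewrite ?in_itv/= => -[xc Ey]; have yf := EP y Ey; split.
    rewrite (_ : x = c + (x - c)); last by ring.
    apply/sl => //; lra.
  split; rewrite /= ?in_itv//= -/c.
  by have := roof_le a qp c; have := yf; lra.
rewrite (area_strip p_gt0 _ (ltW w0))//.
- congr (_ * _); rewrite -(Int_shift (below a p q (col n) k.+1)); last first.
    apply: (@niceP _ _ 1 0 (rf c)).
    + by apply: measurable_indic; exact: measurable_slice.
    + by move=> z; rewrite indicE; case: (_ \in _); rewrite ?normr1 ?normr0 ?ler01.
    + move=> z; rewrite indicE; case: (boolP (_ \in _)) => [|_]; last by rewrite eqxx.
      by rewrite inE => /EP.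
  congr Int; apply/funext => z; rewrite {1}/cell.
  case: ifPn => [/andP[z1 z2]|nz]; last first.
    rewrite mul0r indicE; case: (boolP (_ \in _)) => // /set_mem /EP h1.
    by move: nz; rewrite (_ : _ && _ = true)//; lra.
  rewrite mul1r (trace_at q0 qp B kh)// -/c.
  have y0 : 0 <= z + below a p q (col n) k.+1 < rf c by apply/andP; split; lra.
  have u00 : 0 <= (0 : R) < w n by rewrite lexx w0.
  have := vflow_trace aA AP kh t0 tk y0 u00; rewrite -/c addr0 addrK => <-.
  rewrite !indicE -natrM mulnb; congr (_%:R); congr nat_of_bool; rewrite andbC.
  by apply/idP/andP; rewrite !inE /E /=.
- exact: measurable_slice.
- move=> y /EP; have := roof_le a qp c; rewrite /= in_itv/=; lra.
Qed.

(** The two errors are the area outside the column and that over the lowest levels, from which the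
    flow may leave the column before time [t]. *)
Theorem flow_correlation n A B (t : R) : measurable A -> measurable B -> A `<=` P -> B `<=` P ->
  adapted r a n A -> adapted r a n B -> 0 <= t ->
  `|area (vf t @^-1` A `&` B) - w n * Int (fun z => trace a p q (col n) B z *
      trace a p q (col n) A (z + t))| <= p * (1 - sp n) + p * (t / q + 1) * w n.
Proof.
move=> mA mB AP BP aA aB t0; have w0 := width_gt0 r0 a0 n; have pp := p_gt0.
set E := vf t @^-1` A `&` B.
have mE : measurable E.
  apply: measurableI => //; rewrite -[X in measurable X]setTI.
  exact: (measurable_vflow r0 a0 p q t measurableT mA).
have EQ : E `<=` frame p by move=> z [_ /BP]; exact: polygon_frame.
set f := fun z => _ * _.
have nf : nice f by apply: niceM; [|apply: nice_shift]; exact: nice_trace.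
pose b := below a p q (col n).
have f01 z : 0 <= f z <= 1.
  have /andP[A0 A1] := trace_le a q0 qp (col n) A (z + t).
  have /andP[B0 B1] := trace_le a q0 qp (col n) B z.
  rewrite mulr_ge0//=; apply: mulr_ile1 => //.
    by apply: le_trans B1 _; exact: cell_le1.
  by apply: le_trans A1 _; exact: cell_le1.
have fE : Int f = \sum_(k < h n) Int (fun z => cell (- b k.+1) (- b k) z * f z).
  rewrite -Int_sum => [|k]; last by apply: niceM => //; exact: nice_ind.
  congr Int; apply/funext => z; rewrite -mulr_suml sum_below_cells.
  rewrite /cell; case: ifPn => nz; first by rewrite mul1r.
  rewrite mul0r /f; have := trace_le a q0 qp (col n) B z; rewrite /cell (negbTE nz) => tB.
  by rewrite (_ : trace _ _ _ _ B z = 0) ?mul0r//; lra.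
have := area_outside n mE EQ; rewrite sum_slabs// => out.
rewrite fE mulr_sumr.
have bd : `|\sum_(k < h n) area (E `&` slab n k) -
    \sum_(k < h n) w n * Int (fun z => cell (- b k.+1) (- b k) z * f z)| <=
    p * (t / q + 1) * w n; last first.
  by move: bd out; rewrite !ler_norml; lra.
rewrite -sumrB; apply: le_trans (ler_norm_sum _ _ _) _.
have tq : 0 <= t / q by rewrite divr_ge0// ltW.
(* Every roof is at least [q], so only levels with index at most t / q can be left in time [t]. *)
apply: (@le_trans _ _ (\sum_(k < h n) (if k%:R <= t / q then w n * p else 0))); last first.
  rewrite -big_mkcond (eq_bigr (fun=> (w n * p) * 1)) => [|k _]; last by rewrite mulr1.
  rewrite -mulr_sumr (_ : p * _ * w n = (w n * p) * (t / q + 1)); last by ring.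
  by rewrite ler_pM2l ?mulr_gt0//; exact: count_le.
apply: ler_sum => k _; case: ifPn => [_|kt].
  have s1 := slab_le (ltn_ord k) mE EQ.
  have bk := belowS a p q (ltn_ord k); rewrite -/(b k) -/(b k.+1) in bk.
  have rc := roof_le a qp (nth 0 (col n) k); have rg := roof_gt0 a q0 qp (nth 0 (col n) k).
  have i0 : 0 <= Int (fun z => cell (- b k.+1) (- b k) z * f z).
    by apply: Int_ge0 => z; rewrite mulr_ge0 ?cell_ge0//; have /andP[] := f01 z.
  have i1 : Int (fun z => cell (- b k.+1) (- b k) z * f z) <= 1 * (- b k - - b k.+1).
    apply: ler_Int_bound => //; [by apply: niceM => //; exact: nice_ind|lra|].
    by move=> z; rewrite mul1r ler_piMr ?cell_ge0//; have /andP[] := f01 z.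
  have := mulr_ge0 (ltW w0) i0.
  have : w n * Int (fun z => cell (- b k.+1) (- b k) z * f z) <= w n * p.
    rewrite ler_pM2l//; lra.
  by rewrite ler_norml; lra.
rewrite slab_correlation// ?subrr ?normr0//.
rewrite -ltNge ltr_pdivrMr// in kt; have := below_ge a qp (ltnW (ltn_ord k)); lra.
Qed.

End FlowCorrelations.

(** * Cuts of a mixing staircase *)

Section CutsOfMixing.
Variables (R : realType) (r : nat -> nat) (a : R).
Hypotheses (r0 : forall n, (0 < r n.+1)%N) (a0 : 0 < a) (a1 : a < 1).
Notation w := (stair_width r a).
Notation sp := (stair_spstart r a).
Notation col := (stair_column r a).
Notation h := (stair_height r a).
Hypothesis sp_cvg : sp n @[n --> \oo] --> (1 : R).
Hypothesis mixT : mixing_map (stair_T r a).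

Lemma spstart_le1 n : sp n <= 1.
Proof.
have <- : limn sp = 1 by exact: cvg_lim.
apply: nondecreasing_cvgn_le; last by apply/cvg_ex; exists 1.
by move=> m k mk; exact: spstart_mono.
Qed.

Lemma spstart_near1 (e : R) : 0 < e -> exists N, forall n, (N <= n)%N -> 1 - sp n <= e.
Proof.
move=> e0; have /cvgrPdist_le /(_ e e0)[N _ hN] := sp_cvg.
by exists N => n /hN; apply: le_trans; exact: ler_norm.
Qed.

Lemma width_le m n : (m <= n)%N -> w n <= w m.
Proof.
move=> /subnK <-; elim: (n - m)%N => // k IHk; rewrite addSn /=.
apply: le_trans IHk; rewrite ler_pdivrMr ?ltr0n// ler_peMr ?ler1n//.
by rewrite ltW// width_gt0.
Qed.

Lemma trivial_stage n : r n.+1 = 1%N ->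
  [/\ col n.+1 = col n, w n.+1 = w n & sp n.+1 = sp n].
Proof.
move=> r1; split.
- rewrite colS r1 /blocks /= /block /= !cats0 -[RHS]map_id.
  by apply: eq_map => c; rewrite mul0r addr0.
- by rewrite /= r1 divr1.
- by rewrite spS r1 mul0r addr0.
Qed.

Lemma stationary N k : (forall n, (N <= n)%N -> r n.+1 = 1%N) ->
  [/\ col (k + N)%N = col N, w (k + N)%N = w N & sp (k + N)%N = sp N].
Proof.
move=> rN; elim: k => // k [IH1 IH2 IH3]; rewrite addSn.
by have [-> -> ->] := trivial_stage (rN _ (leq_addl k N)).
Qed.

Lemma lebesgue_Int (A : set R) : measurable A -> A `<=` `[0, 1[%classic ->
  lebesgue_measure A = (Int (\1_A : R -> R))%:E.
Proof.
move=> mA A1; rewrite /Int /Rintegral integral_indic// setIT fineK//.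
have h1 : (lebesgue_measure A <= 1%:E :> \bar R)%E.
  have -> : 1%:E = lebesgue_measure (`[0, 1[%classic : set R) :> \bar R.
    by rewrite lebesgue_measure_itv/= lte_fin ltr01 -EFinB subr0.
  by apply: le_measure; rewrite ?inE//; exact: measurable_itv.
rewrite ge0_fin_numE; last exact: measure_ge0.
by apply: le_lt_trans h1 _; rewrite ltry.
Qed.

Lemma measurable_iter n : measurable_fun setT (iter n (stair_T r a) : R -> R).
Proof.
elim: n => [|n IHn]; first exact: measurable_id.
rewrite (_ : iter n.+1 _ = stair_T r a \o iter n (stair_T r a)); last first.
  by apply/funext => x; rewrite iterS.
by apply: measurableT_comp IHn; exact: measurable_stair_T.
Qed.

Lemma itv_cell (u v : R) : \1_(`[u, v[%classic : set R) = cell u v :> (R -> R).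
Proof. by apply/funext => z; rewrite /cell indicE mem_setE in_itv/=; case: ifP. Qed.

Lemma mixing_itv (u v e : R) : 0 <= u -> u <= v -> v <= 1 -> 0 < e ->
  exists K, forall k, (K <= k)%N ->
    `|(v - u) * (v - u) - Int (\1_(iter k (stair_T r a) @^-1` `[u, v[%classic `&` `[u, v[%classic) : R -> R)|
     <= e.
Proof.
move=> u0 uv v1 e0; set A : set R := `[u, v[%classic.
have mA : measurable A by exact: measurable_itv.
have A1 : A `<=` `[0, 1[%classic.
  by move=> x; rewrite /A /= !in_itv/=; lra.
have := mixT mA mA A1 A1; rewrite (lebesgue_Int mA A1) itv_cell Int_ind// -EFinM.
have mI k : measurable (iter k (stair_T r a) @^-1` A `&` A).
  apply: measurableI => //; rewrite -[X in measurable X]setTI.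
  exact: (measurable_iter k measurableT mA).
rewrite (_ : (fun n => _) = (fun k => (Int (\1_(iter k (stair_T r a) @^-1` A `&` A) : R -> R))%:E)); last first.
  by apply/funext => k; rewrite lebesgue_Int// => x [_ /A1].
move=> /fine_cvgP[_] /cvgrPdist_le /(_ e e0)[K _ hK].
by exists K => k /hK.
Qed.

(** Were all later cuts trivial, T would fix every point of the top level of a stationary column, a
    set of measure strictly between 0 and 1. *)
Lemma nontrivial_stage N : exists n, (N <= n)%N /\ (2 <= r n.+1)%N.
Proof.
apply: contrapT => nex.
have rN n : (N <= n)%N -> r n.+1 = 1%N.
  move=> Nn; apply/eqP; rewrite eqn_leq r0 andbT leqNgt; apply/negP => r2.
  by apply: nex; exists n.
have w0 := width_gt0 r0 a0 N; have w1 : w N < 1.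
  by apply: le_lt_trans a1; exact: (width_le (leq0n N)).
have hN := height_gt0 r0 a0 N; pose k := (h N).-1.
have kh : (k < h N)%N by rewrite prednK.
have [c0 cw] := col_bounds r0 a0 (mem_nth 0 kh); have s1 := spstart_le1 N.
set c := nth 0 (col N) k in c0 cw.
(* The default value of [stair_Tn] on a top level is the identity; as the column no longer changes,
   this default survives in the limit. *)
have fixT x : c <= x < c + w N -> stair_T r a x = x.
  move=> cx; apply: (limn_eventually (n := N)) => n /subnK <-.
  have [e1 e2 _] := stationary (n - N) rN.
  rewrite /stair_Tn (@stair_levelE R r a r0 a0 _ k _) /in_level /stair_height ?e1 ?e2 ?kh//.
  by rewrite -/(h N) /k prednK// ltnn.
have d0 : 0 < (w N - w N * w N) / 2 by rewrite divr_gt0// subr_gt0 gtr_pMr.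
have cw' : c <= c + w N by rewrite lerDl ltW.
have [K /(_ K (leqnn K))] := mixing_itv c0 cw' (le_trans cw s1) d0.
rewrite (_ : _ `&` _ = `[c, c + w N[%classic); last first.
  apply/seteqP; split=> [x []//|x xA]; split=> //; move: (xA); rewrite /= in_itv/= => xc.
  by rewrite (_ : iter K _ x = x) ?in_itv//=; elim: K => //= K ->; exact: fixT.
rewrite itv_cell Int_ind// (_ : c + w N - c = w N); last by ring.
rewrite distrC ger0_norm; last by rewrite subr_ge0 ger_pMr ?ltW.
by move: d0; lra.
Qed.

Lemma width_small (e : R) : 0 < e -> exists N, forall n, (N <= n)%N -> w n <= e.
Proof.
move=> e0.
have hk K : exists n, w n * (2 ^ K)%:R <= a.
  elim: K => [|K [n hn]]; first by exists 0%N; rewrite mulr1.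
  have [m [nm r2]] := nontrivial_stage n; exists m.+1.
  have w1 := width_gt0 r0 a0 m.+1.
  have r2R : 2 <= (r m.+1)%:R :> R by rewrite (ler_nat _ 2).
  have : w m.+1 * 2 <= w n.
    apply: le_trans (width_le nm); rewrite -(widthS a r0 m) mulrC ler_pM2r//.
  rewrite expnS natrM mulrA -(ler_pM2r (x := (2 ^ K)%:R)); last by rewrite ltr0n expn_gt0.
  by move=> /le_trans; apply.
pose K := (Num.truncn (a / e)).+1; have [N hN] := hk K; exists N => n /width_le h1.
apply: le_trans h1 _; rewrite leNgt; apply/negP => ew.
have := truncnS_gt (a / e); rewrite -/K ltr_pdivrMr// => aK.
have K2 : K%:R <= (2 ^ K)%:R :> R by rewrite ler_nat ltnW// ltn_expl.
have : K%:R * e <= w N * (2 ^ K)%:R.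
  by rewrite mulrC; apply: ler_pM => //; exact: ltW.
lra.
Qed.

Lemma height_large K : exists N, forall n, (N <= n)%N -> (K <= h n)%N.
Proof.
have e0 : 0 < a / K.+1%:R by rewrite divr_gt0// ltr0n.
have [N hN] := width_small e0; exists N => n /hN wn.
have w0 := width_gt0 r0 a0 n.
have := spstart_mono r0 a0 (leq0n n); rewrite [sp 0]/= -(height_width r0 a0 n) => h1.
have : a <= (h n)%:R * (a / K.+1%:R) by apply: le_trans h1 _; rewrite ler_pM2l ?ltr0n ?height_gt0.
by rewrite mulrCA ler_pMr// ler_pdivlMr ?ltr0n// mul1r ler_nat => /ltnW.
Qed.

Lemma width_div m n : (m <= n)%N -> exists D : nat, w m = D%:R * w n.
Proof.
move=> /subnK <-; elim: (n - m)%N => [|k [D hD]]; first by exists 1%N; rewrite mul1r.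
by rewrite addSn; exists (D * r (k + m).+1)%N; rewrite natrM -mulrA widthS.
Qed.

Lemma col_multiple n c : c \in col n -> exists i : nat, c = i%:R * w n.
Proof.
elim: n c => [|n IHn] c; first by rewrite /= inE => /eqP ->; exists 0%N; rewrite mul0r.
rewrite colS => /flattenP[s /mapP[j _ ->]].
rewrite mem_cat => /orP[/mapP[c' /IHn[i ->] ->]|/mapP[k _ ->]].
  by exists (i * r n.+1 + j)%N; rewrite natrD natrM mulrDl -mulrA widthS.
by exists (h n * r n.+1 + ('C(j, 2) + k))%N; rewrite [in RHS]natrD natrM mulrDl -mulrA widthS// height_width.
Qed.

(* If [r n.+1] is small, then [T^(h n)] moves the first subcolumn onto the   *)
(* second one, hence a large part of a union of levels into itself.          *)
Lemma return_mass m n : (m <= n)%N -> (2 <= r n.+1)%N ->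
  w m / (r n.+1)%:R <=
  Int (\1_(iter (h n) (stair_T r a) @^-1` `[0, w m[%classic `&` `[0, w m[%classic) : R -> R).
Proof.
move=> mn r2; have [D wD] := width_div mn; set E := _ `&` _.
have w0 := width_gt0 r0 a0 n; have w1 := width_gt0 r0 a0 n.+1; have wm := width_gt0 r0 a0 m.
have rw := widthS a r0 n.
have r2R : 2 <= (r n.+1)%:R :> R by rewrite (ler_nat _ 2).
have ww : 2 * w n.+1 <= w n by rewrite -rw ler_pM2r.
have rn0 : (r n.+1)%:R != 0 :> R by rewrite pnatr_eq0 -lt0n.
have mE : measurable E.
  apply: measurableI; last exact: measurable_itv.
  rewrite -[X in measurable X]setTI.
  by apply: (measurable_iter (h n) measurableT); exact: measurable_itv.
have nE : nice (\1_E : R -> R).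
  apply: (@niceP _ _ 1 0 (w m)); first exact: measurable_indic.
    by move=> x; rewrite indicE; case: (_ \in _); rewrite ?normr1 ?normr0 ?ler01.
  move=> x; rewrite indicE; case: (boolP (x \in E)) => [/set_mem[_]|_]; last by rewrite eqxx.
  by rewrite /= in_itv.
have sub j x : (j < D)%N -> j%:R * w n <= x < j%:R * w n + w n.+1 -> E x.
  move=> jD /andP[x0 x1].
  have jDR : j%:R * w n + w n <= w m.
    by rewrite wD -[X in _ + X]mul1r -mulrDl natr1 ler_pM2r// ler_nat.
  have jw0 : 0 <= j%:R * w n by rewrite mulr_ge0// ltW.
  have wms : w m <= sp n.
    apply: (@le_trans _ _ a); first exact: (width_le (leq0n m)).
    exact: (spstart_mono r0 a0 (leq0n n)).
  have xs : 0 <= x < sp n by lra.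
  have [k kx] := level_exists r0 a0 xs; have /andP[kh /andP[kx1 kx2]] := kx.
  have [i ci] := col_multiple (mem_nth 0 kh).
  have ij : i = j.
    apply/eqP; rewrite eqn_leq; apply/andP; split; rewrite -ltnS -(ltr_nat R) -natr1;
      rewrite -(ltr_pM2r w0) mulrDl mul1r -?ci; lra.
  rewrite ij in ci; split; last by rewrite /= in_itv/=; lra.
  have e1 := nth_colS a0 (r0 n : (0 < r n.+1)%N) kh; rewrite mul0n bin0n !add0n mul0r addr0 in e1.
  have e2 := nth_colS a0 r2 kh; rewrite mul1n bin_small// addn0 mul1r in e2.
  have ind := index_lt a0 r2 kh; rewrite mul1n bin_small// addn0 in ind.
  have u0 : 0 <= x - j%:R * w n < w n.+1 by lra.
  have := @iter_stair_T R r a r0 a0 n.+1 k (h n) (x - j%:R * w n).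
  rewrite addnC => /(_ ind u0); rewrite addnC in e2; rewrite [(h n + k)%N]addnC.
  rewrite e1 e2 ci => e3.
  rewrite /= (_ : x = j%:R * w n + (x - j%:R * w n)); last by ring.
  have e4 : 0 <= j%:R * w n + w n.+1 + (x - j%:R * w n) < w m by lra.
  by rewrite e3 in_itv; exact: e4.
have -> : w m / (r n.+1)%:R = Int (fun x => \sum_(j < D) cell (j%:R * w n) (j%:R * w n + w n.+1) x).
  rewrite Int_sum => [|j]; last exact: nice_ind.
  rewrite (eq_bigr (fun=> w n.+1)) => [|j _]; last by rewrite Int_ind ?lerDl ?ltW// addrC addKr.
  by rewrite sumr_const card_ord -[RHS]mulr_natl wD -rw mulrA [_ * w n.+1]mulrC mulrA mulfK // mulrC.
apply: ler_Int => // [|x]; first by apply: nice_sum => j; exact: nice_ind.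
have [xE|xE] := pselect (E x).
  rewrite indicE mem_set//=; apply: (@le_trans _ _ (cell 0 (0 + D%:R * w n) x)); last exact: cell_le1.
  rewrite -(cell_split _ _ _ (ltW w0)); apply: ler_sum => j _; rewrite add0r /cell.
  case: ifPn => [/andP[x0 x1]|_]; last by case: ifP.
  by rewrite ifT//; move: x1; rewrite -[_ / _]/(w n.+1); lra.
rewrite big1 ?indicE ?ler0n// => j _; rewrite /cell; case: ifP => // xj; exfalso.
by apply: xE; exact: sub xj.
Qed.

(** For [0, w m) with [w m] tiny, mixing caps the return mass at 3/2 of the squared width, whereas a
    stage with r < M cuts would return at least w m / r, that is at least twice the squared
    width. *)
Lemma cuts_grow M : exists N, forall n, (N <= n)%N -> (2 <= r n.+1)%N -> (M <= r n.+1)%N.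
Proof.
have e0 : 0 < (2 * M.+1%:R)^-1 :> R by rewrite invr_gt0 mulr_gt0// ltr0n.
have [m /(_ m (leqnn m)) wm] := width_small e0.
have w0 := width_gt0 r0 a0 m.
have w1 : w m <= 1 by apply: le_trans (width_le (leq0n m)) (ltW a1).
have ww2 : 0 < w m * w m / 2 by rewrite divr_gt0 ?mulr_gt0.
have [K hK] := mixing_itv (lexx 0) (ltW w0) w1 ww2.
have [N hN] := height_large K; exists (maxn m N) => n; rewrite geq_max => /andP[mn Nn] r2.
rewrite leqNgt; apply/negP => rM.
have := hK _ (hN _ Nn); have := return_mass mn r2; rewrite subr0 ler_norml => h1 /andP[h2 _].
have rR : 0 < (r n.+1)%:R :> R by rewrite ltr0n.
have rMR : (r n.+1)%:R <= M.+1%:R :> R by rewrite ler_nat (leq_trans (ltnW rM)).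
have : 2 * w m * (r n.+1)%:R <= 1.
  have M0 : 0 < 2 * M.+1%:R :> R by rewrite mulr_gt0.
  move: wm; rewrite -[_^-1]mul1r ler_pdivlMr// => wm.
  apply: le_trans wm; rewrite mulrCA mulrA (mulrC 2) -!mulrA ler_pM2l// ler_pM2l//.
rewrite -ler_pdivlMr// => h3.
have : w m * (2 * w m) <= w m * (1 / (r n.+1)%:R) by rewrite ler_pM2l.
rewrite div1r => h4; have := mulr_gt0 w0 w0; lra.
Qed.

(** The spacers added at the stage have total length of order r times the width w_n, which must fit
    in the vanishing remainder 1 - sp n; and w_n is at least a / h_n. *)
Lemma cuts_vs_height (e : R) : 0 < e -> exists N, forall n, (N <= n)%N -> (2 <= r n.+1)%N ->
  (r n.+1)%:R <= e * (h n)%:R.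
Proof.
move=> e0; have d0 : 0 < e * a / 4 by rewrite divr_gt0// mulr_gt0.
have [N hN] := spstart_near1 d0; exists N => n /hN h1 r2.
have w0 := width_gt0 r0 a0 n; have w1 := width_gt0 r0 a0 n.+1.
have s1 := spstart_le1 n.+1; rewrite spS in s1.
have hw := height_width r0 a0 n; have rw := widthS a r0 n.
have sa := spstart_mono r0 a0 (leq0n n); rewrite [sp 0]/= in sa.
set s := sp n in h1 s1 hw sa; set W := w n.+1 in w1 rw s1; set V := w n in w0 rw hw.
have C2 : 4 * 'C(r n.+1, 2)%:R = 2 * (r n.+1)%:R * ((r n.+1)%:R - 1) :> R.
  have /(congr1 (fun k => k%:R : R)) := mul_bin_diag (r n.+1) 1.
  by rewrite bin1 !natrM -subn1 natrB// => e1; lra.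
have r2R : 2 <= (r n.+1)%:R :> R by rewrite (ler_nat _ 2).
set C := 'C(_, 2)%:R in s1 C2; set ro := (r n.+1)%:R in C2 r2R rw *; set H := (h n)%:R in hw *.
have H0 : 0 <= H by exact: ler0n.
(* Here r >= 2 is needed, in the form r <= 2 (r - 1). *)
have rV : ro * V <= 4 * (C * W).
  rewrite -rw; have -> : 4 * (C * W) = 2 * ro * (ro - 1) * W by rewrite -C2; ring.
  rewrite mulrA ler_pM2r//; nra.
have : ro * V <= e * a by lra.
have : e * a <= e * (H * V) by rewrite ler_pM2l// hw.
by rewrite mulrA => h2 h3; rewrite -(ler_pM2r w0); lra.
Qed.

End CutsOfMixing.

(** * The tower over a column, with idle stages skipped *)

Section StageTower.
Variables (R : realType) (r : nat -> nat) (a p q : R).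
Hypotheses (r0 : forall n, (0 < r n.+1)%N) (a0 : 0 < a) (a1 : a < 1).
Hypotheses (q0 : 0 < q) (qp : q < p).
Notation w := (stair_width r a).
Notation sp := (stair_spstart r a).
Notation col := (stair_column r a).
Notation h := (stair_height r a).
Notation rf := (roof a p q).
Notation tot := (total a p q).
Hypothesis sp_cvg : sp n @[n --> \oo] --> (1 : R).
Hypothesis mixT : mixing_map (stair_T r a).
Hypothesis incomm : forall m n : int, m%:~R * p + n%:~R * q = 0 -> m = 0 /\ n = 0.

Lemma nontrivial_stageb N : exists n, (N <= n)%N && (2 <= r n.+1)%N.
Proof.
by have [n [Nn r2]] := nontrivial_stage r0 a0 a1 sp_cvg mixT N; exists n; rewrite Nn.
Qed.

Definition next_stage N := ex_minn (nontrivial_stageb N).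

Lemma next_stage_ge N : (N <= next_stage N)%N.
Proof. by rewrite /next_stage; case: ex_minnP => n /andP[]. Qed.

Lemma next_stage_cut N : (2 <= r (next_stage N).+1)%N.
Proof. by rewrite /next_stage; case: ex_minnP => n /andP[]. Qed.

Lemma idle_stages N k : (N <= k)%N -> (k <= next_stage N)%N ->
  [/\ col k = col N, w k = w N & sp k = sp N].
Proof.
move=> /subnK <-; elim: (k - N)%N => // l IHl; rewrite addSn => lN.
have [<- <- <-] := IHl (ltnW lN).
apply: trivial_stage; apply/eqP; rewrite eqn_leq r0 andbT leqNgt; apply/negP => r2.
move: lN; rewrite /next_stage; case: ex_minnP => n _ /(_ (l + N)%N).
by rewrite leq_addl r2 => /(_ isT) h1 h2; have := leq_trans h2 h1; rewrite ltnn.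
Qed.

Variable m : nat.

(** Tower k is the column at [stage k], just before its nontrivial cut; it coincides with the column
    right after the previous one. *)
Fixpoint stage k := next_stage (if k is k'.+1 then (stage k').+1 else m).

Lemma stage_cut k : (2 <= r (stage k).+1)%N.
Proof. by case: k => [|k]; exact: next_stage_cut. Qed.

Lemma stage_ge k : (m + k <= stage k)%N.
Proof.
elim: k => [|k IHk]; first by rewrite addn0; exact: next_stage_ge.
by rewrite addnS; apply: leq_trans (next_stage_ge _).
Qed.

Lemma stage0 : [/\ col (stage 0) = col m, w (stage 0) = w m & sp (stage 0) = sp m].
Proof. by apply: idle_stages => //; exact: next_stage_ge. Qed.

Lemma stageS k : [/\ col (stage k.+1) = col (stage k).+1, w (stage k.+1) = w (stage k).+1 &
  sp (stage k.+1) = sp (stage k).+1].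
Proof. by apply: idle_stages => //; exact: next_stage_ge. Qed.

Definition stage_cuts k := r (stage k).+1.

Lemma stage_height k : height stage_cuts q (tot (col m)) k = tot (col (stage k)).
Proof.
elim: k => [|k IHk]; first by have [-> _ _] := stage0.
by have [-> _ _] := stageS k; rewrite totalS//= IHk.
Qed.

Lemma stage_copies k : copies R stage_cuts k * w (stage k) = w m.
Proof.
elim: k => [|k IHk]; first by have [_ -> _] := stage0; rewrite /copies big_ord0 mul1r.
by have [_ -> _] := stageS k; rewrite /copies big_ord_recr/= -mulrA widthS.
Qed.

Lemma total_ge n : (h n)%:R * q <= tot (col n).
Proof. by rewrite -below_size; exact: below_ge. Qed.

Lemma total_le n : tot (col n) <= (h n)%:R * p.
Proof.
rewrite /total /stair_height; elim: (col n) => [|c s IHs]; first by rewrite big_nil mul0r.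
by rewrite big_cons /= -natr1 mulrDl mul1r addrC lerD// roof_le.
Qed.

Lemma total_col_gt0 n : 0 < tot (col n).
Proof.
by apply: lt_le_trans (total_ge n); rewrite mulr_gt0// ltr0n height_gt0.
Qed.

Lemma total_combination s : exists i j : nat, tot s = i%:R * p + j%:R * q.
Proof.
elim: s => [|c s [i [j e]]]; first by exists 0%N, 0%N; rewrite /total big_nil; ring.
rewrite /total big_cons -/(tot s) e /roof; case: ifP => _.
  by exists i.+1, j; rewrite -natr1; ring.
by exists i, j.+1; rewrite -natr1; ring.
Qed.

(** The bottom level starts at 0 and has roof [p], so the coefficient of [p] in the total height is
    positive. *)
Lemma stage_incommensurable (j : nat) (c : int) : (0 < j)%N -> j%:R * tot (col m) <> c%:~R * q.
Proof.
move=> j0; have := col_bottom r0 a0 m; have := height_gt0 r0 a0 m.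
rewrite /stair_height; case: (col m) => // c0 s _ /= ->.
have [i1 [i2 e]] := total_combination s.
rewrite /total big_cons -/(tot s) e /roof a0 => e2.
have [] := incomm (m := (j * i1.+1)%N) (n := (j * i2)%N%:Z - c).
  rewrite rmorphB/= -!pmulrn !natrM -natr1 mulrBl -e2; ring.
by move=> /eqP; rewrite eqz_nat muln_eq0/= orbF => /eqP jE; rewrite jE in j0.
Qed.

(** The region over the column has area at most [p], and each copy carries the level width. *)
Lemma stage_mass k : height stage_cuts q (tot (col m)) k <= p / w m * copies R stage_cuts k.
Proof.
have wk := width_gt0 r0 a0 (stage k); have wm := width_gt0 r0 a0 m.
rewrite stage_height; apply: le_trans (total_le _) _.
rewrite -(ler_pM2r wk) -[leRHS]mulrA stage_copies divfK ?gt_eqF// mulrAC height_width//.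
rewrite ler_piMl//; first by rewrite ltW// (lt_trans q0).
exact: spstart_le1.
Qed.

Lemma stage_cuts_infty M : exists n0, forall n, (n0 <= n)%N -> (M <= stage_cuts n)%N.
Proof.
have [N hN] := cuts_grow r0 a0 a1 sp_cvg mixT M; exists N => n Nn.
apply: hN (stage_cut n); apply: leq_trans Nn _.
by apply: leq_trans (stage_ge n); exact: leq_addl.
Qed.

Lemma stage_cuts_small (e : R) : 0 < e -> exists n0, forall n, (n0 <= n)%N ->
  (stage_cuts n)%:R <= e * height stage_cuts q (tot (col m)) n.
Proof.
move=> e0; have [N hN] := cuts_vs_height r0 a0 sp_cvg (mulr_gt0 e0 q0).
exists N => n Nn; have Ns : (N <= stage n)%N.
  by apply: leq_trans Nn _; apply: leq_trans (stage_ge n); exact: leq_addl.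
apply: le_trans (hN _ Ns (stage_cut n)) _.
by rewrite stage_height -mulrA ler_pM2l// mulrC total_ge.
Qed.

Definition stage_tower : tower R := Tower stage_cut stage_cuts_infty stage_cuts_small q0
  (total_col_gt0 m) stage_mass stage_incommensurable.

Lemma stage_th k : th stage_tower k = tot (col (stage k)).
Proof. exact: stage_height. Qed.

Lemma stage_td k : td stage_tower k = w m / w (stage k).
Proof.
by rewrite -(stage_copies k) mulfK// gt_eqF// width_gt0.
Qed.

Lemma W_trace k A z : adapted r a m A -> supported r a m A ->
  W stage_tower 0 k (trace a p q (col m) A) z = trace a p q (col (stage k)) A z.
Proof.
move=> aA sA; elim: k z => [|k IHk] z; first by have [-> _ _] := stage0.
have mk : (m <= stage k)%N by apply: leq_trans (stage_ge k); exact: leq_addr.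
have [-> _ _] := stageS k; rewrite traceS//.
- apply: eq_bigr => i _; rewrite -[LHS]/(W stage_tower 0 k _ _) IHk.
  by rewrite /bo -(stage_th k).
- exact: adapted_mono aA sA.
- exact: supported_mono sA.
Qed.

(** The interval is cut into equal pieces no longer than the spacer. *)
Lemma UE_long_cell (X : tower R) (al be : R) : - th X 0 <= al -> al <= be -> be <= 0 ->
  UE X (cell al be) (be - al).
Proof.
move=> Hal; rewrite le_eqVlt => /predU1P[<- _|ab be0].
  rewrite subrr; apply: UE_ext (UE0 X) => x; rewrite /cell ifF//.
  by apply/negP => /andP[]; lra.
have s0 := spacer_gt0 X; pose N := (Num.truncn ((be - al) / spacer X)).+1.
have := truncnS_gt ((be - al) / spacer X); rewrite -/N ltr_pdivrMr// => hN.
have N0 : 0 < N%:R :> R by rewrite ltr0n.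
have [s sE] : exists s, s = (be - al) / N%:R by eexists.
have Ns : N%:R * s = be - al by rewrite sE mulrC divfK// gt_eqF.
have sp0 : 0 < s by rewrite sE divr_gt0// subr_gt0.
have sq : s <= spacer X by rewrite sE ler_pdivrMr// mulrC ltW.
rewrite -Ns (_ : N%:R * s = \sum_(i < N) s); last by rewrite sumr_const card_ord mulr_natl.
apply: (UE_ext (F := fun x => \sum_(i <- index_enum 'I_N)
    cell (al + i%:R * s) (al + i%:R * s + s) x)) => [x|].
  by rewrite cell_split ?ltW// Ns addrC subrK.
apply: UE_sum => i.
have i0 : 0 <= i%:R * s by rewrite mulr_ge0// ltW.
have i1 : i%:R * s + s <= be - al.
  by rewrite -Ns -[X in _ + X]mul1r -mulrDl natr1 ler_pM2r// ler_nat.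
rewrite -[X in UE _ _ X](_ : al + i%:R * s + s - (al + i%:R * s) = s); last by ring.
by apply: UE_cell; lra.
Qed.

End StageTower.

(** * Mixing for unions of rectangles over levels *)

Section StepSets.
Variables (R : realType) (r : nat -> nat) (a p q : R).
Hypotheses (r0 : forall n, (0 < r n.+1)%N) (a0 : 0 < a).
Hypotheses (q0 : 0 < q) (qp : q < p).
Notation w := (stair_width r a).
Notation sp := (stair_spstart r a).
Notation col := (stair_column r a).
Notation h := (stair_height r a).
Notation rf := (roof a p q).
Notation tot := (total a p q).
Notation P := (polygon a p q).
Hypothesis sp1 : forall n, sp n <= 1.

Definition step_fits m (al be : nat -> R) := forall k, (k < h m)%N ->
  [/\ 0 <= al k, al k <= be k & be k <= rf (nth 0 (col m) k)].

Definition step m (al be : nat -> R) : set (R * R) :=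
  [set z | exists k, in_level r a m k z.1 /\ al k <= z.2 < be k].

Variables (m : nat) (al be : nat -> R).
Hypothesis fits : step_fits m al be.
Notation S := (step m al be).

Lemma step_level k u y : (k < h m)%N -> 0 <= u < w m ->
  S (nth 0 (col m) k + u, y) <-> al k <= y < be k.
Proof.
move=> kh u0; have kl : in_level r a m k (nth 0 (col m) k + u).
  by rewrite /in_level kh/=; lra.
split=> [[k' [/= k'l yk]]|yk]; last by exists k.
by rewrite (level_uniq r0 a0 kl k'l).
Qed.

Lemma step_polygon : S `<=` P.
Proof.
move=> [x y] [k [/= kl yk]]; have /andP[kh kx] := kl; have [h1 h2 h3] := fits kh.
have cc := mem_nth 0 kh; have [c0 cw] := col_bounds r0 a0 cc; have s1 := sp1 m.
have rx : rf x = rf (nth 0 (col m) k).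
  rewrite -(roof_level r0 a0 p q cc (u := x - nth 0 (col m) k)); [congr rf; ring|lra|lra].
split => /=; rewrite ?rx; lra.
Qed.

Lemma step_supported : supported r a m S.
Proof. by move=> x y [k [/= /(level_range r0 a0)]]; lra. Qed.

Lemma step_adapted : adapted r a m S.
Proof.
move=> c u y /(nthP 0)[k kh <-] u0 uw; have w0 := width_gt0 r0 a0 m.
have u00 : 0 <= (0 : R) < w m by rewrite lexx w0.
rewrite step_level//; last by rewrite u0.
by have := step_level y kh u00; rewrite addr0 => ->.
Qed.

Definition brick k : set (R * R) :=
  `[nth 0 (col m) k, nth 0 (col m) k + w m[%classic `*` `[al k, be k[%classic.

Lemma step_bricks : S = \big[setU/set0]_(k < h m) brick k.
Proof.
rewrite -bigcup_mkord; apply/seteqP; split => -[x y] /=.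
  move=> [k [/andP[kh kx] yk]]; exists k => //.
move=> [k /= kh [/=]]; rewrite !in_itv/= => kx yk; exists k.
by rewrite /in_level kh.
Qed.

Lemma measurable_step_set : measurable S.
Proof.
rewrite step_bricks; apply: bigsetU_measurable => k _.
by apply: measurableX; exact: measurable_itv.
Qed.

Lemma area_step : area S = w m * \sum_(k < h m) (be k - al k).
Proof.
have pp : 0 < p by exact: lt_trans q0 qp.
have w0 := width_gt0 r0 a0 m.
have SF : S `<=` frame p by apply: subset_trans step_polygon _; exact: polygon_frame.
have SU : S `&` \big[setU/set0]_(k < h m) slab r a p m k = S.
  apply: setIidl => -[x y] Sxy; have [_ /= yf] := step_polygon Sxy.
  have [k [/= /andP[kh kx] _]] := Sxy; rewrite -bigcup_mkord; exists k => //.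
  split; rewrite /= in_itv//=; have := roof_le a qp x; move: yf; lra.
rewrite -SU (sum_slabs r0 a0 q0 qp (leqnn _) measurable_step_set SF) mulr_sumr.
apply: eq_bigr => k _; have kh := ltn_ord k; have [h1 h2 h3] := fits kh.
have rc := roof_le a qp (nth 0 (col m) k).
rewrite (_ : S `&` _ = brick k).
  rewrite /brick (area_strip pp) ?ltW//.
  - by rewrite itv_cell Int_ind.
  - by move=> y; rewrite /= !in_itv/=; lra.
apply/seteqP; split => -[x y] /=.
  move=> [Sxy [/= xk _]]; split => //=; rewrite in_itv/=.
  move: xk; rewrite in_itv/= => xk.
  apply/(@step_level k (x - nth 0 (col m) k) y kh); first lra.
  by rewrite (_ : nth 0 (col m) k + (x - nth 0 (col m) k) = x)//; ring.
move=> [/=]; rewrite !in_itv/= => xk yk; split.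
  rewrite (_ : x = nth 0 (col m) k + (x - nth 0 (col m) k)); last by ring.
  by apply/step_level => //; lra.
by split; rewrite /= in_itv//=; lra.
Qed.

Lemma trace_step z : trace a p q (col m) S z =
  \sum_(k < h m) cell (- below a p q (col m) k.+1 + al k) (- below a p q (col m) k.+1 + be k) z.
Proof.
rewrite traceE; apply: eq_bigr => k _; have kh := ltn_ord k; have [h1 h2 h3] := fits kh.
have bk := belowS a p q kh; have w0 := width_gt0 r0 a0 m.
have u00 : 0 <= (0 : R) < w m by rewrite lexx w0.
have := step_level (z + below a p q (col m) k.+1) kh u00; rewrite addr0 => sl.
rewrite indicE /cell; case: (boolP (_ \in _)) => [/set_mem/sl yk|/negP nS].
  by rewrite mulr1 !ifT//; lra.
rewrite mulr0 ifF//; apply/negP => yk; apply: nS; apply/mem_set/sl; lra.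
Qed.

End StepSets.

(** * Asymptotic comparison with the whole column *)

Section StepMixing.
Variables (R : realType) (r : nat -> nat) (a p q : R).
Hypotheses (r0 : forall n, (0 < r n.+1)%N) (a0 : 0 < a) (a1 : a < 1).
Hypotheses (q0 : 0 < q) (qp : q < p).
Notation w := (stair_width r a).
Notation sp := (stair_spstart r a).
Notation col := (stair_column r a).
Notation h := (stair_height r a).
Notation rf := (roof a p q).
Notation tot := (total a p q).
Notation P := (polygon a p q).
Notation vf := (vflow (stair_T_inv r a) a p q).
Hypothesis sp_cvg : sp n @[n --> \oo] --> (1 : R).
Hypothesis mixT : mixing_map (stair_T r a).
Hypothesis incomm : forall m n : int, m%:~R * p + n%:~R * q = 0 -> m = 0 /\ n = 0.

Definition whole m : set (R * R) := step r a m (fun=> 0) (fun k => rf (nth 0 (col m) k)).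

Lemma whole_fits m : step_fits r a p q m (fun=> 0) (fun k => rf (nth 0 (col m) k)).
Proof. by move=> k kh; split => //; rewrite ltW// roof_gt0. Qed.

Lemma wholeE m x y : whole m (x, y) <-> P (x, y) /\ x < sp m.
Proof.
have s1 := spstart_le1 r0 a0 sp_cvg; split=> [Wxy|[Pxy xs]].
  split; first exact: (step_polygon r0 a0 s1 (@whole_fits m)).
  exact: (step_supported r0 a0 Wxy).
case: Pxy => /= /andP[x0 _] yf; have xs0 : 0 <= x < sp m by rewrite x0.
have [k kl] := level_exists r0 a0 xs0; have /andP[kh kx] := kl.
exists k; split => //=; rewrite -(roof_level r0 a0 p q (mem_nth 0 kh) (u := x - nth 0 (col m) k)).
- by rewrite (_ : _ + _ = x)//; ring.
- lra.
- lra.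
Qed.

Lemma trace_whole m z : trace a p q (col m) (whole m) z = cell (- tot (col m)) 0 z.
Proof.
rewrite (trace_step r0 a0 (@whole_fits m)) -sum_below_cells//; apply: eq_bigr => k _.
by rewrite addr0 (belowS a p q (ltn_ord k)); congr cell; ring.
Qed.

Lemma area_whole m : area (whole m) = w m * tot (col m).
Proof.
have s1 := spstart_le1 r0 a0 sp_cvg.
rewrite (area_step r0 a0 q0 qp s1 (@whole_fits m)); congr (_ * _).
by rewrite /total (big_nth 0) big_mkord; apply: eq_bigr => k _; rewrite subr0.
Qed.

Lemma error_small (t e : R) : 0 < e -> 0 <= t -> exists N, forall n, (N <= n)%N ->
  p * (1 - sp n) + p * (t / q + 1) * w n <= e.
Proof.
move=> e0 t0; have p0 : 0 < p by exact: lt_trans qp.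
have c0 : 0 < p * (t / q + 1).
  by rewrite mulr_gt0// ltr_wpDl// divr_ge0// ltW.
have d1 : 0 < e / 2 / p by rewrite !divr_gt0.
have d2 : 0 < e / 2 / (p * (t / q + 1)) by rewrite !divr_gt0.
have [N1 h1] := spstart_near1 sp_cvg d1.
have [N2 h2] := width_small r0 a0 a1 sp_cvg mixT d2.
exists (maxn N1 N2) => n; rewrite geq_max => /andP[/h1 + /h2].
rewrite (ler_pdivlMr _ _ p0) (ler_pdivlMr _ _ c0) (mulrC (1 - _)) (mulrC (w n)); lra.
Qed.

(** Only sets over the fixed column [m] are compared, [whole m] serving as reference: this leaves a
    function of mean zero on the initial tower, as required for decay in the tower. *)
Lemma step_mixing m al be al' be' (e : R) :
  step_fits r a p q m al be -> step_fits r a p q m al' be' -> 0 < e ->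
  exists t0, forall t, t0 <= t ->
    `|area (vf t @^-1` step r a m al be `&` step r a m al' be') -
      area (step r a m al be) / area (whole m) *
      area (vf t @^-1` whole m `&` step r a m al' be')| <= e.
Proof.
move=> fA fB e0; set A := step r a m al be; set B := step r a m al' be'.
have s1 := spstart_le1 r0 a0 sp_cvg.
pose X := stage_tower r0 a0 a1 q0 qp sp_cvg mixT incomm m.
have wm := width_gt0 r0 a0 m; have tm := total_col_gt0 r0 a0 q0 qp m.
have mA : measurable A by exact: measurable_step_set.
have mB : measurable B by exact: measurable_step_set.
have mW : measurable (whole m) by exact: measurable_step_set.
have AP : A `<=` P by exact: (step_polygon r0 a0 s1 fA).
have BP : B `<=` P by exact: (step_polygon r0 a0 s1 fB).
have WP : whole m `<=` P by exact: (step_polygon r0 a0 s1 (@whole_fits m)).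
have aA : adapted r a m A by exact: step_adapted.
have aB : adapted r a m B by exact: step_adapted.
have aW : adapted r a m (whole m) by exact: step_adapted.
have sA : supported r a m A by exact: step_supported.
have sB : supported r a m B by exact: step_supported.
have sW : supported r a m (whole m) by exact: step_supported.
set c := area A / area (whole m).
have c01 : 0 <= c <= 1.
  rewrite /c divr_ge0 ?area_ge0//= ler_pdivrMr ?mul1r; last by rewrite area_whole mulr_gt0.
  apply: (area_le (lt_trans q0 qp)) => //; last first.
    by apply: subset_trans WP _; exact: polygon_frame.
  by move=> [x y] Axy; apply/wholeE; split; [exact: AP|exact: sA Axy].
(* The coefficient [c] is the mean of the trace over the initial tower, so [F] has integral zero. *)
pose F z := trace a p q (col m) A z + - c * cell (- th X 0) 0 z.
pose G := trace a p q (col m) B.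
have th0 : th X 0 = tot (col m) by [].
have nA : nice (trace a p q (col m) A) by exact: nice_trace.
have nF : nice F by apply: niceD => //; apply: niceZ; exact: nice_ind.
have nG : nice G by exact: nice_trace.
have F1 z : `|F z| <= cell (- th X 0) 0 z.
  have := trace_le a q0 qp (col m) A z; rewrite /F th0.
  have := cell_ge0 (- tot (col m)) 0 z; set x := cell _ _ _; set y := trace _ _ _ _ _ _ => x0 yx.
  have /andP[c0 c1] := c01; have cx0 := mulr_ge0 c0 x0; have := ler_wpM2r x0 c1.
  by rewrite ler_norml; lra.
have G1 z : `|G z| <= cell (- th X 0) 0 z.
  by have /andP[g0 g1] := trace_le a q0 qp (col m) B z; rewrite ger0_norm.
have UF : UE X F 0.
  have U1 : UE X (trace a p q (col m) A) (\sum_(k < h m) (be k - al k)).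
    apply: (UE_ext (F := fun z => \sum_(k <- index_enum 'I_(h m))
      cell (- below a p q (col m) k.+1 + al k) (- below a p q (col m) k.+1 + be k) z)).
      by move=> z; rewrite trace_step.
    apply: UE_sum => k; have kh := ltn_ord k; have [h1 h2 h3] := fA k kh.
    have bk := belowS a p q kh; have b0 := below_le a q0 qp (col m) (leq0n k).
    have b1 := below_le a q0 qp (col m) kh; rewrite below_size -th0 in b1.
    rewrite below0 in b0.
    rewrite -[X in UE _ _ X](_ : - below a p q (col m) k.+1 + be k -
      (- below a p q (col m) k.+1 + al k) = _); last by ring.
    by apply: UE_long_cell; lra.
  have U2 : UE X (cell (- th X 0) 0) (th X 0).
    rewrite -[X in UE _ _ X](_ : 0 - - th X 0 = _); last by ring.
    by apply: UE_long_cell; rewrite ?th0; lra.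
  rewrite [X in UE _ _ X](_ : 0 = \sum_(k < h m) (be k - al k) + - c * th X 0).
    exact: UE_D U1 (UE_Z (- c) U2).
  rewrite /c area_whole (area_step r0 a0 q0 qp s1 fA) th0.
  by field; rewrite !gt_eqF.
have e2 : 0 < e / 2 / w m by rewrite !divr_gt0.
have [t0 ht0] := tower_mixing nF nG F1 G1 UF e2.
exists (Num.max t0 0) => t; rewrite ge_max => /andP[tt0 tpos].
have [N0 hN0] := ht0 t tt0.
have e4 : 0 < e / 4 by lra.
have [N1 hN1] := error_small e4 tpos.
pose N := maxn N0 N1; have /hN0 := leq_maxl N0 N1; rewrite -/N => hc.
pose n := stage r0 a0 a1 sp_cvg mixT m N.
have mn : (m + N <= n)%N by exact: stage_ge.
have /hN1 err : (N1 <= n)%N.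
  by apply: leq_trans (leq_maxr N0 N1) _; apply: leq_trans mn; exact: leq_addl.
have {}mn : (m <= n)%N by apply: leq_trans mn; exact: leq_addr.
have wn := width_gt0 r0 a0 n.
have fc D : measurable D -> D `<=` P -> adapted r a m D -> supported r a m D ->
    `|area (vf t @^-1` D `&` B) - w n * Int (fun z => trace a p q (col n) B z *
      trace a p q (col n) D (z + t))| <= e / 4.
  move=> mD DP aD sD; apply: le_trans err.
  exact: (flow_correlation r0 a0 q0 qp s1 mD mB DP BP (adapted_mono r0 a0 mn aD sD)
    (adapted_mono r0 a0 mn aB sB) tpos).
have cA := fc A mA AP aA sA; have cW := fc (whole m) mW WP aW sW.
move: hc; rewrite stage_td -/n mulrCA.
have -> : corr X F G N t =
    Int (fun z => trace a p q (col n) B z * trace a p q (col n) A (z + t)) +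
    - c * Int (fun z => trace a p q (col n) B z * trace a p q (col n) (whole m) (z + t)).
  have nn D : measurable D ->
      nice (fun z => trace a p q (col n) B z * trace a p q (col n) D (z + t)).
    by move=> mD; apply: niceM; [|apply: nice_shift]; exact: nice_trace.
  rewrite -IntZ -?IntD; [|exact: nn|exact/niceZ/nn|exact: nn].
  congr Int; apply/funext => z; rewrite W_trace// -/n.
  rewrite W_D W_Z W_trace// -/n.
  rewrite (_ : W X 0 N (cell _ _) _ = W X 0 N (trace a p q (col m) (whole m)) (z + t)); last first.
    by apply: eq_W => x; rewrite trace_whole.
  by rewrite W_trace// -/n; ring.
move: cA cW; set IA := Int _; set IW := Int _.
set x := area (vf t @^-1` A `&` B); set y := area (vf t @^-1` whole m `&` B).
move=> cA cW hc.
have {}hc : `|w n * (IA + - c * IW)| <= e / 2.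
  rewrite normrM gtr0_norm// -ler_pdivlMl//; apply: le_trans hc _.
  by rewrite le_eqVlt; apply/orP; left; apply/eqP; field; rewrite !gt_eqF.
have cc : `|c * (y - w n * IW)| <= e / 4.
  have /andP[c0 c1] := c01; rewrite normrM ger0_norm//.
  apply: le_trans cW; rewrite ler_piMl//.
rewrite (_ : x - c * y = (x - w n * IA) - c * (y - w n * IW) + w n * (IA + - c * IW)); last by ring.
apply: le_trans (ler_normD _ _) _; rewrite (_ : e = e / 4 + e / 4 + e / 2); last by field.
by apply: lerD hc; apply: le_trans (ler_normB _ _) _; apply: lerD.
Qed.

End StepMixing.

(** * Extension to Borel sets *)

Section PolygonInduction.
Variables (R : realType) (a p q : R).
Hypotheses (q0 : 0 < q) (qp : q < p).
Notation P := (polygon a p q).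
Implicit Type S : set (R * R).

Let p0 : 0 < p. Proof. exact: lt_trans q0 qp. Qed.
Let mP : measurable P. Proof. exact: measurable_polygon. Qed.

Definition box (x y : R) : set (R * R) := P `&` [set z | z.1 < x /\ z.2 < y].

Lemma measurable_box x y : measurable (box x y).
Proof.
apply: measurableI => //.
rewrite (_ : [set _ | _] = `]-oo, x[%classic `*` `]-oo, y[%classic).
  by apply: measurableX; exact: measurable_itv.
by apply/seteqP; split => -[u v] /=; rewrite !in_itv.
Qed.

(** The whole line is included so that products of two members contain the half-planes and the
    plane. *)
Definition rays : set (set R) := [set A | A = setT \/ exists x, A = `]-oo, x[%classic].
Definition quadrants : set (set (R * R)) := [set S | exists A B, [/\ rays A, rays B & S = A `*` B]].

Lemma measurable_rays A : rays A -> measurable A.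
Proof. by move=> [->|[x ->]]; [exact: measurableT|exact: measurable_itv]. Qed.

Lemma measurable_quadrants : (@measurable _ (R * R)%type) = <<s quadrants >>.
Proof.
rewrite measurable_prod_measurableType eqEsubset; split.
  apply: smallest_sub; first exact: smallest_sigma_algebra.
  move=> _ [A mA [B mB <-]].
  pose T := g_sigma_algebraType quadrants.
  have m1 : measurable_fun [set: T] (fst : T -> R).
    apply: (measurability _ (RGenInftyO.measurableE R)) => //.
    move=> _ [_ [x ->] <-]; apply: sub_sigma_algebra; exists `]-oo, x[%classic, setT.
    by split; [right; exists x|left|rewrite setXT setTI].
  have m2 : measurable_fun [set: T] (snd : T -> R).
    apply: (measurability _ (RGenInftyO.measurableE R)) => //.
    move=> _ [_ [x ->] <-]; apply: sub_sigma_algebra; exists setT, `]-oo, x[%classic.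
    by split; [left|right; exists x|rewrite setTX setTI].
  have := measurableI _ _ (m1 measurableT A mA) (m2 measurableT B mB).
  by rewrite !setTI => h; rewrite (_ : A `*` B = (fst @^-1` A) `&` (snd @^-1` B)).
apply: smallest_sub; first exact: smallest_sigma_algebra.
move=> _ [A [B [rA rB ->]]]; apply: sub_sigma_algebra.
by exists A; [exact: measurable_rays|exists B => //; exact: measurable_rays].
Qed.

(** Dynkin's theorem for the quadrants. The polygon being bounded, the whole line acts on it as a
    ray, so that every generator restricts to a box. *)
Lemma polygon_induction (Q : set (R * R) -> Prop) :
  (forall x y, Q (box x y)) ->
  (forall S, measurable S -> S `<=` P -> Q S -> Q (P `\` S)) ->
  (forall F : (set (R * R))^nat, (forall n, measurable (F n)) -> (forall n, F n `<=` P) ->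
     trivIset setT F -> (forall n, Q (F n)) -> Q (\bigcup_n F n)) ->
  forall S, measurable S -> S `<=` P -> Q S.
Proof.
move=> Qbox QD QU S mS SP; have <- : S `&` P = S by exact: setIidl.
have mS' : <<s quadrants >> S by rewrite -measurable_quadrants.
have rI A : rays A -> exists x, forall u, u < 1 + p -> A u <-> u < x.
  move=> [->|[x ->]]; last by exists x => u _; rewrite /= in_itv.
  by exists (1 + p) => u up; split.
have Qquad A B : rays A -> rays B -> Q ((A `*` B) `&` P).
  move=> /rI[x hx] /rI[y hy]; rewrite (_ : _ `&` _ = box x y)//.
  have b u v : P (u, v) -> u < 1 + p /\ v < 1 + p.
    by move=> [/= u1 vf]; have := roof_le a qp u; have := p0; split; lra.
  apply/seteqP; split => -[u v] /=.
    by move=> [[/= Au Bv] Puv]; have [up vp] := b _ _ Puv; split => //; split; [apply/hx|apply/hy].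
  move=> [Puv [/= ux vy]]; have [up vp] := b _ _ Puv.
  by split => //; split; [apply/hx|apply/hy].
apply: (@dynkin_induction _ _ quadrants (fun S => Q (S `&` P))) mS'.
- exact: measurable_quadrants.
- move=> _ _ [A [B [rA rB ->]]] [A' [B' [rA' rB' ->]]]; exists (A `&` A'), (B `&` B').
  have rr X Y : rays X -> rays Y -> rays (X `&` Y).
    move=> [->|[x ->]] [->|[y ->]].
    + by left; rewrite setTI.
    + by right; exists y; rewrite setTI.
    + by right; exists x; rewrite setIT.
    + right; exists (Num.min x y); apply/seteqP; split => u /=; rewrite !in_itv/= lt_min.
        by move=> [-> ->].
      by move=> /andP[].
  by split; [exact: rr|exact: rr|rewrite setXI].
- by rewrite -setXTT; apply: Qquad; left.
- by move=> _ [A [B [rA rB ->]]]; exact: Qquad.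
- move=> E mE QE; rewrite (_ : ~` E `&` P = P `\` (E `&` P)).
    by apply: QD => //; exact: measurableI.
  by rewrite setDIr setDv setU0 setDE setIC.
- move=> F mF tF QF; rewrite setI_bigcupl; apply: QU => [n|n||n].
  + by apply: measurableI => //; exact: mF.
  + by move=> z [].
  + exact: trivIset_setIr.
  + exact: QF.
Qed.

End PolygonInduction.

Lemma step_gap (R : realType) (c w x g f p : R) : 0 < w -> 0 < p -> 0 <= g -> g <= f -> f <= p ->
  f - 0 - ((if c + w <= x then g else 0) - 0) - (f - (if c < x then g else 0)) <=
  p * cell c (c + w) x.
Proof.
move=> w0 p0 g0 gf fp; rewrite /cell.
case: (leP (c + w) x) => h1; case: (ltP c x) => h2.
- by rewrite ifF ?mulr0; [lra|apply/negP; lra].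
- by exfalso; lra.
- by rewrite ifT; lra.
- by case: ifP => _; rewrite ?mulr1 ?mulr0; lra.
Qed.

(** * Invariance of the area under the flow *)

Section FlowPreservesArea.
Variables (R : realType) (r : nat -> nat) (a p q : R).
Hypotheses (r0 : forall n, (0 < r n.+1)%N) (a0 : 0 < a) (a1 : a < 1).
Hypotheses (q0 : 0 < q) (qp : q < p).
Notation w := (stair_width r a).
Notation sp := (stair_spstart r a).
Notation col := (stair_column r a).
Notation h := (stair_height r a).
Notation rf := (roof a p q).
Notation tot := (total a p q).
Notation P := (polygon a p q).
Notation box := (box a p q).
Notation W := (whole r a p q).
Notation vf := (vflow (stair_T_inv r a) a p q).
Hypothesis sp_cvg : sp n @[n --> \oo] --> (1 : R).
Hypothesis mixT : mixing_map (stair_T r a).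
Implicit Types A B S : set (R * R).

Let p0 : 0 < p. Proof. exact: lt_trans q0 qp. Qed.
Let s1 n : sp n <= 1. Proof. exact: spstart_le1. Qed.
Let PF : P `<=` frame p. Proof. exact: polygon_frame. Qed.
Let mP : measurable P. Proof. exact: measurable_polygon. Qed.
Let mW n : measurable (W n). Proof. exact: measurable_step_set. Qed.

Lemma whole_sub n : W n `<=` P.
Proof. exact: (step_polygon r0 a0 s1 (@whole_fits R r a p q q0 qp n)). Qed.

Lemma stair_T_inv_range x : 0 <= x < 1 -> 0 <= stair_T_inv r a x < 1.
Proof.
move=> x01; have [[n [k [k0 kx]]]|hx] := stair_T_inv_cases r0 a0 x; last first.
  by rewrite /stair_T_inv (limn_eventually (n := 0%N) (l := x)).
rewrite (stair_T_invE r0 a0 k0 kx); have /andP[kh /andP[x0 x1]] := kx.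
have kh' : (k.-1 < h n)%N by apply: leq_ltn_trans kh; exact: leq_pred.
by have [c0 cw] := col_bounds r0 a0 (mem_nth 0 kh'); have := s1 n; lra.
Qed.

Lemma vflow_fuel_polygon fuel (x y t : R) : P (x, y) -> 0 <= t ->
  t < q * fuel%:R + (rf x - y) -> P (vflow_fuel (stair_T_inv r a) a p q fuel x y t).
Proof.
elim: fuel x y t => [|fuel IHf] x y t [/= x01 /andP[y0 yf]] t0 tf /=.
  have ytf : y + t < rf x by lra.
  by rewrite ytf; split => //=; lra.
case: ifPn => [ytf|]; first by split => //=; lra.
rewrite -leNgt => ytf; apply: IHf.
- by split => /=; [exact: stair_T_inv_range|rewrite lexx roof_gt0].
- by lra.
- have := roof_ge a qp (stair_T_inv r a x); move: tf; rewrite -natr1; have := q0; lra.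
Qed.

Lemma vflow_polygon (t : R) z : 0 <= t -> P z -> P (vf t z).
Proof.
case: z => x y t0 Pxy; apply: vflow_fuel_polygon => //=.
have := truncnS_gt (t / q); rewrite ltr_pdivrMr//; set N := Num.truncn _ => tN.
have [_ /= yf] := Pxy.
by rewrite -[N.+2%:R]natr1 mulrDr mulr1 (mulrC q); have := q0; lra.
Qed.

Lemma vflow0 z : P z -> vf 0 z = z.
Proof. by case: z => x y [/= _ /andP[_ yf]]; rewrite /vflow /= addr0 yf. Qed.

Lemma measurable_vflow_pre (t : R) S : measurable S -> measurable (vf t @^-1` S).
Proof.
move=> mS; rewrite -[X in measurable X]setTI.
exact: (measurable_vflow r0 a0 p q t measurableT mS).
Qed.

Lemma area_defect n : 0 <= area P - area (W n) <= p * (1 - sp n).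
Proof.
have WP := @whole_sub n; rewrite -(areaD p0)//; rewrite area_ge0/=.
have sp0 := spstart_gt0 r0 a0 n.
have -> : p * (1 - sp n) = area (`[sp n, sp n + (1 - sp n)[%classic `*` `[0, p[%classic : set (R * R)).
  rewrite (area_strip p0) ?subr_ge0//.
  by rewrite itv_cell Int_ind ?subr0 ?(mulrC p)// ltW.
apply: (area_le p0).
- exact: measurableD.
- by apply: measurableX; exact: measurable_itv.
- move=> [x y] [Pxy nW]; have [/= x01 yf] := Pxy; split; rewrite /= in_itv/=.
    have [|xs] := ltP x (sp n); last by lra.
    by move=> xs; exfalso; apply: nW; apply/(wholeE r0 a0 q0 qp sp_cvg).
  by have := roof_le a qp x; lra.
- by move=> [x y] [/=]; rewrite !in_itv/= => ? ?; split; rewrite /= in_itv/=; lra.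
Qed.

Lemma area_polygon_gt0 : 0 < area P.
Proof.
have /andP[h1 _] := area_defect 0; apply: (@lt_le_trans _ _ (area (W 0))); last lra.
rewrite area_whole// mulr_gt0// ?width_gt0//; exact: total_col_gt0.
Qed.

(** On traces the flow is a translation, which preserves integrals. What enters from outside the
    column has length at most [t] and weight [w n], and the other errors vanish as n grows. *)
Lemma step_preserved m al be (t : R) : step_fits r a p q m al be -> 0 <= t ->
  area (vf t @^-1` step r a m al be `&` P) = area (step r a m al be).
Proof.
move=> fA t0; set A := step r a m al be.
have mA : measurable A by exact: measurable_step_set.
have AP : A `<=` P by exact: (step_polygon r0 a0 s1 fA).
have aA : adapted r a m A by exact: step_adapted.
have sA : supported r a m A by exact: step_supported.
suff hs e : 0 < e -> `|area (vf t @^-1` A `&` P) - area A| <= e.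
  apply/eqP; rewrite -subr_eq0 -normr_le0; apply/ler_addgt0Pl => e e0.
  by rewrite addr0; exact: hs.
move=> e0; have e4 : 0 < e / 4 by lra.
have [N1 h1] := error_small r0 a0 a1 q0 qp sp_cvg mixT e4 t0.
have [N2 h2] := error_small r0 a0 a1 q0 qp sp_cvg mixT e4 (lexx 0).
have t1 : 0 < e / 4 / (t + 1) by rewrite divr_gt0// ltr_wpDl.
have [N3 h3] := width_small r0 a0 a1 sp_cvg mixT t1.
pose n := maxn m (maxn N1 (maxn N2 N3)).
have mn : (m <= n)%N by exact: leq_maxl.
have /h1 {}h1 : (N1 <= n)%N by rewrite /n !leq_max leqnn !orbT.
have /h2 {}h2 : (N2 <= n)%N by rewrite /n !leq_max leqnn !orbT.
have /h3 {}h3 : (N3 <= n)%N by rewrite /n !leq_max leqnn !orbT.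
have wn := width_gt0 r0 a0 n.
have {}aA : adapted r a n A by exact: adapted_mono aA sA.
have aW : adapted r a n (W n) by exact: step_adapted.
have nA : nice (trace a p q (col n) A) by exact: nice_trace.
have c1 := le_trans (flow_correlation r0 a0 q0 qp s1 mA (mW n) AP (@whole_sub n) aA aW t0) h1.
have c2 := le_trans (flow_correlation r0 a0 q0 qp s1 (mW n) mA (@whole_sub n) AP aW aA (lexx 0)) h2.
have e1 : area (vf 0 @^-1` W n `&` A) = area A.
  congr area; apply/seteqP; split => [z []//|[x y] Axy]; split => //=.
  rewrite vflow0; last exact: AP.
  apply/(wholeE r0 a0 q0 qp sp_cvg); split; first exact: AP.
  by apply: lt_le_trans (sA _ _ Axy) _; exact: spstart_mono.
rewrite e1 in c2.
set f := trace a p q (col n) A in c1 c2 nA.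
have e2 : Int (fun z => f z * trace a p q (col n) (W n) (z + 0)) = Int f.
  congr Int; apply/funext => z; rewrite addr0 trace_whole//.
  have := trace_le a q0 qp (col n) A z; rewrite -/f /cell; case: ifP => _; first by rewrite mulr1.
  by rewrite mulr0; lra.
rewrite e2 in c2.
(* The difference is carried by the [z] below the tower for which [z + t] is inside, an interval of
   length [t]. *)
have c3 : 0 <= Int f - Int (fun z => trace a p q (col n) (W n) z * f (z + t)) <= t.
  have nW : nice (trace a p q (col n) (W n)) by exact: nice_trace.
  have nfW : nice (fun z => trace a p q (col n) (W n) z * f (z + t)).
    by apply: niceM => //; exact: nice_shift.
  rewrite -(Int_shift t nA) -[X in _ - X]mul1r -mulNr -IntZ// -IntD; [|exact: nice_shift|exact: niceZ].
  have b z : 0 <= f (z + t) + -1 * (trace a p q (col n) (W n) z * f (z + t)) <=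
      1 * cell (- tot (col n) - t) (- tot (col n)) z.
    rewrite trace_whole// mul1r; have := trace_le a q0 qp (col n) A (z + t).
    rewrite -/f /cell => /andP[f0].
    case: (boolP (_ <= z + t < 0)) => [zt|_ f1].
      case: (boolP (- tot (col n) <= z < 0)) => z0.
        by case: ifP => _ *; lra.
      have zt' : z < - tot (col n) by rewrite ltNge; apply: contra z0 => ?; lra.
      by move=> f1; rewrite ifT; lra.
    have -> : f (z + t) = 0 by lra.
    by rewrite mulr0 mulr0 addr0 lexx/=; case: ifP.
  apply/andP; split; first by apply: Int_ge0 => z; have /andP[] := b z.
  apply: (@le_trans _ _ (1 * (- tot (col n) - (- tot (col n) - t)))); last by lra.
  apply: ler_Int_bound => //; [|lra|by move=> z; have /andP[] := b z].
  by apply: niceD; [exact: nice_shift|exact: niceZ].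
have c4 : 0 <= area (vf t @^-1` A `&` P) - area (vf t @^-1` A `&` W n) <= e / 4.
  have mvA := measurable_vflow_pre t mA.
  have WP := @whole_sub n.
  rewrite -(areaD p0); first last.
  - by move=> z [_ /PF].
  - by move=> z [? /WP].
  - exact: measurableI.
  - exact: measurableI.
  rewrite area_ge0/=; apply: (@le_trans _ _ (area (P `\` W n))).
    apply: (area_le p0).
    - by apply: measurableD; exact: measurableI.
    - exact: measurableD.
    - by move=> z [[zA zP] nz]; split => // zW; apply: nz.
    - by move=> z [/PF].
  rewrite (areaD p0)//; have /andP[_ h6] := area_defect n.
  have h5 : 0 <= p * (t / q + 1) * w n.
    by rewrite !mulr_ge0 ?(ltW p0) ?addr_ge0 ?divr_ge0 ?(ltW q0)// ltW.
  have {}h1 : p * (1 - sp n) <= e / 4 by apply: le_trans h1; rewrite lerDl.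
  exact: le_trans h6 h1.
have c5 : 0 <= w n * (Int f - Int (fun z => trace a p q (col n) (W n) z * f (z + t))) <= e / 4.
  have /andP[i0 i1] := c3; rewrite mulr_ge0 ?(ltW wn)//=.
  apply: (@le_trans _ _ (w n * (t + 1))).
    by rewrite ler_pM2l//; apply: le_trans i1 _; rewrite lerDl.
  by rewrite -ler_pdivlMr// ltr_wpDl.
move: c1 c2 c4 c5; rewrite !ler_norml mulrBr; clear.
move: (area A) (area (_ `&` P)) (area (_ `&` W n)) (w n * Int f) (w n * Int _) => x1 x2 x3 x4 x5.
by move=> *; lra.
Qed.

(** Step sets inside the box and inside its complement together almost fill the polygon, which gives
    estimates from both sides without an outer approximation. *)
Lemma box_approx x y d : 0 < d -> exists N, forall n, (N <= n)%N ->
  exists al be al' be', [/\ step_fits r a p q n al be, step_fits r a p q n al' be',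
    step r a n al be `<=` box x y, step r a n al' be' `<=` P `\` box x y &
    area P - area (step r a n al be) - area (step r a n al' be') <= d /\ area P - area (W n) <= d].
Proof.
move=> d0; have [N hN] := error_small r0 a0 a1 q0 qp sp_cvg mixT d0 (lexx 0).
exists N => n /hN; rewrite mul0r add0r mulr1 => {}hN.
have w0 := width_gt0 r0 a0 n; pose c k := nth 0 (col n) k.
pose g k := Num.max 0 (Num.min y (rf (c k))).
have g0 k : 0 <= g k by rewrite le_max lexx.
have g1 k : g k <= rf (c k) by rewrite ge_max ltW ?roof_gt0//= ge_min lexx orbT.
have rp k : 0 <= rf (c k) by rewrite ltW// roof_gt0.
(* Levels entirely to the left of [x] belong to the inner set, those starting at or after [x] to the
   outer one; only the level cut by the line at [x] loses area, at most p times its width. *)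
pose be k := if c k + w n <= x then g k else 0.
pose al' k := if c k < x then g k else 0.
have fA : step_fits r a p q n (fun=> 0) be.
  by move=> k kh; rewrite /be; case: ifP => _; split.
have fB : step_fits r a p q n al' (fun k => rf (c k)).
  by move=> k kh; rewrite /al'; case: ifP => _; split.
exists (fun=> 0), be, al', (fun k => rf (c k)); split => //.
- move=> [u v] uv; split; first exact: (step_polygon r0 a0 s1 fA).
  have [k [/= /andP[kh kx]]] := uv; rewrite /be; case: ifP => [ckx|_]; last by lra.
  move: kx; rewrite -/(c k) /g lt_max lt_min => kx /andP[v0 /orP[|/andP[]]]; lra.
- move=> [u v] uv; split; first exact: (step_polygon r0 a0 s1 fB).
  move=> [_ [/= ux vy]]; have [k [/= /andP[kh kx]]] := uv.
  move: kx; rewrite -/(c k) /al' => kx; rewrite ifT; last by lra.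
  by rewrite /g ge_max ge_min; move=> /andP[/andP[_ /orP[]]]; lra.
have /andP[d1 d2] := area_defect n.
have wp : 0 <= p * w n by rewrite mulr_ge0// ltW.
split; last by apply: le_trans d2 (le_trans _ hN); rewrite lerDl.
have aW : area (W n) = w n * \sum_(k < h n) (rf (c k) - 0).
  exact: (area_step r0 a0 q0 qp s1 (@whole_fits R r a p q q0 qp n)).
suff : area (W n) - area (step r a n (fun=> 0) be) - area (step r a n al' (fun k => rf (c k)))
    <= p * w n.
  by move=> hs; apply: le_trans hN; apply: le_trans (lerD d2 hs); rewrite !addrA subrK.
rewrite aW (area_step r0 a0 q0 qp s1 fA) (area_step r0 a0 q0 qp s1 fB).
rewrite -!mulrBr -!sumrB mulrC ler_pM2r//.
apply: (@le_trans _ _ (p * cell 0 (sp n) x)); last by rewrite ler_piMr ?cell_le1// ltW.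
rewrite -(sum_levels r0 a0) (big_nth 0) big_mkord mulr_sumr; apply: ler_sum => k _.
by apply: step_gap; rewrite ?g0 ?g1 ?roof_le.
Qed.

Lemma area_complement A B : measurable A -> measurable B -> B `<=` P -> A `<=` P `\` B ->
  area A <= area P - area B.
Proof.
move=> mA mB BP AB; rewrite -(areaD p0 mB mP BP PF).
by apply: (area_le p0 mA _ AB); [exact: measurableD|move=> z [/PF]].
Qed.

(** Preimages of the inner step sets bound the preimages of the box and of its complement from
    below; as their areas nearly add up to the total, both bounds are nearly sharp. *)
Lemma box_preserved x y (t : R) : 0 <= t -> area (vf t @^-1` box x y `&` P) = area (box x y).
Proof.
move=> t0; have mB := measurable_box a p q x y; have BP : box x y `<=` P by move=> z [].
apply/eqP; rewrite -subr_eq0 -normr_le0; apply/ler_addgt0Pl => e e0; rewrite addr0.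
have [N /(_ N (leqnn N))[al [be [al' [be' [fA fB AB BC [hd _]]]]]]] := box_approx x y e0.
set A := step r a N al be in AB hd; set B := step r a N al' be' in BC hd.
have mA : measurable A by exact: measurable_step_set.
have mB' : measurable B by exact: measurable_step_set.
have pA := step_preserved fA t0; have pB := step_preserved fB t0.
have h1 := area_le p0 mA mB AB (subset_trans BP PF).
have h2 := area_complement mB' mB BP BC.
have mV S : measurable S -> measurable (vf t @^-1` S `&` P).
  by move=> mS; apply: measurableI => //; exact: measurable_vflow_pre.
have h3 : area A <= area (vf t @^-1` box x y `&` P).
  rewrite -pA; apply: (area_le p0); [exact: mV|exact: mV| |by move=> z [_ /PF]].
  by move=> z [/AB].
have h4 : area B <= area P - area (vf t @^-1` box x y `&` P).
  rewrite -pB; apply: area_complement (mV _ mB') (mV _ mB) (@subIsetr _ _ _) _.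
  by move=> z [/BC[_ nz] zP]; split => // -[].
rewrite ler_norml; move: h1 h2 h3 h4 hd; clear -e0.
move: (area A) (area B) (area P) (area (box x y)) (area (_ `&` P)).
by move=> *; lra.
Qed.

Lemma vflow_preserves (t : R) S : 0 <= t -> measurable S -> S `<=` P ->
  area (vf t @^-1` S `&` P) = area S.
Proof.
(* The induction is run with extended-real measures, where countable additivity is available. *)
move=> t0 mS SP; rewrite !area_def; congr fine; move: S mS SP.
have mV S : measurable S -> measurable (vf t @^-1` S `&` P).
  by move=> mS; apply: measurableI => //; exact: measurable_vflow_pre.
have VF S : vf t @^-1` S `&` P `<=` frame p by move=> z [_ /PF].
apply: (polygon_induction q0 qp).
- move=> x y; have mB := measurable_box a p q x y.
  have BF : box x y `<=` frame p by move=> z [/PF].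
  by rewrite (areaE p0 (mV _ mB) (VF _)) (areaE p0 mB BF) box_preserved.
- move=> S mS SP; have SF := subset_trans SP PF.
  have mD : measurable (P `\` S) by exact: measurableD.
  have DF : P `\` S `<=` frame p by move=> z [/PF].
  rewrite (areaE p0 (mV _ mS) (VF _)) (areaE p0 mS SF).
  rewrite (areaE p0 (mV _ mD) (VF _)) (areaE p0 mD DF).
  move=> [e]; congr EFin; rewrite [RHS](areaD p0 mS mP SP PF) -e.
  rewrite -(areaD p0 (mV _ mS) mP (@subIsetr _ _ _) PF).
  congr area; apply/seteqP; split => z.
    by move=> [[_ nS] Pz]; split => // -[].
  move=> [Pz nz]; split => //; split; first exact: vflow_polygon.
  by move=> Sz; apply: nz.
- move=> F mF FP tF eF; rewrite preimage_bigcup setI_bigcupl.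
  rewrite (leb2_bigcup mF tF) leb2_bigcup; [|by move=> n; exact: mV|].
    by apply: eq_eseriesr => i _; exact: eF.
  apply/trivIsetP => i j _ _ ij; apply/seteqP; split=> // z [[zi _] [zj _]].
  by move/trivIsetP: tF => /(_ i j I I ij)/seteqP[hF _]; exact: (hF (vf t z) (conj zi zj)).
Qed.

End FlowPreservesArea.

(** * Extension of limits from boxes to Borel sets *)

Section LimitInduction.
Variables (R : realType) (a p q : R).
Hypotheses (q0 : 0 < q) (qp : q < p).
Notation P := (polygon a p q).
Implicit Type S : set (R * R).
Variables (phi : R -> set (R * R) -> R) (psi : set (R * R) -> R).

(** Finite additivity and domination by the area; the domination controls the tails of countable
    unions uniformly in [t]. *)
Definition subadditive_mass (f : set (R * R) -> R) :=
  (forall S S', measurable S -> measurable S' -> S `<=` P -> S' `<=` P ->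
     S `&` S' = set0 -> f (S `|` S') = f S + f S') /\
  (forall S, measurable S -> S `<=` P -> 0 <= f S <= area S).

Definition tends S := forall e, 0 < e -> exists t0, forall t, t0 <= t -> `|phi t S - psi S| <= e.

Hypothesis phi_mass : forall t, 0 <= t -> subadditive_mass (phi t).
Hypothesis psi_mass : subadditive_mass psi.

Let p0 : 0 < p. Proof. exact: lt_trans q0 qp. Qed.
Let PF : P `<=` frame p. Proof. exact: polygon_frame. Qed.
Let mP : measurable P. Proof. exact: measurable_polygon. Qed.

Lemma mass0 f : subadditive_mass f -> f set0 = 0.
Proof.
move=> [_ /(_ set0 measurable0)]; rewrite area0 => /(_ (@sub0set _ _)).
by rewrite -eq_le => /eqP.
Qed.

Lemma massD f S : subadditive_mass f -> measurable S -> S `<=` P ->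
  f (P `\` S) = f P - f S.
Proof.
move=> [fU _] mS SP; apply/esym/eqP; rewrite subr_eq addrC -fU//.
- by rewrite setDUK.
- exact: measurableD.
- by rewrite setDE setICA setICr setI0.
Qed.

Lemma tendsU S S' : measurable S -> measurable S' -> S `<=` P -> S' `<=` P ->
  S `&` S' = set0 -> tends S -> tends S' -> tends (S `|` S').
Proof.
move=> mS mS' SP SP' d h1 h2 e e0; have e2 : 0 < e / 2 by rewrite divr_gt0.
have [t1 k1] := h1 _ e2; have [t2 k2] := h2 _ e2.
exists (Num.max 0 (Num.max t1 t2)) => t; rewrite !ge_max => /and3P[t0 /k1 l1 /k2 l2].
have [-> // _] := phi_mass t0; have [-> // _] := psi_mass.
rewrite opprD addrACA [e]splitr; apply: le_trans (ler_normD _ _) _.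
exact: lerD.
Qed.

(** For a disjoint union, a finite part converges and the rest has small area, hence small mass for
    all nonnegative times at once. *)
Lemma tends_all : tends P -> (forall x y, tends (box a p q x y)) ->
  forall S, measurable S -> S `<=` P -> tends S.
Proof.
move=> tP tB; apply: (polygon_induction q0 qp) => //.
  move=> S mS SP h1 e e0; have e2 : 0 < e / 2 by rewrite divr_gt0.
  have [t1 k1] := h1 _ e2; have [t2 k2] := tP _ e2.
  exists (Num.max 0 (Num.max t1 t2)) => t; rewrite !ge_max => /and3P[t0 /k1 l1 /k2 l2].
  rewrite !massD//; last exact: phi_mass.
  rewrite (_ : _ - _ = (phi t P - psi P) - (phi t S - psi S)); last by ring.
  by rewrite [e]splitr; apply: le_trans (ler_normB _ _) _; apply: lerD.
move=> F mF FP tF hF.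
have mU n : measurable (\big[setU/set0]_(i < n) F i) by exact: bigsetU_measurable.
have UP n : \big[setU/set0]_(i < n) F i `<=` P.
  by rewrite -bigcup_mkord; apply: bigcup_sub => i _; exact: FP.
have tU n : tends (\big[setU/set0]_(i < n) F i).
  elim: n => [|n IHn].
    rewrite big_ord0 => e e0; exists 0 => t t0.
    by rewrite !mass0 ?subrr ?normr0 ?ltW//; exact: phi_mass.
  rewrite big_ord_recr/=; apply: (tendsU (mU n) (mF n) (UP n) (FP n) _ IHn (hF n)).
  apply/seteqP; split => // z [zU zn]; move: zU; rewrite -bigcup_mkord => -[i /= ilt zi].
  have ij : i <> n by move=> e; rewrite e ltnn in ilt.
  by have := (@trivIsetP _ _ _ _).1 tF i n I I; move=> /(_ (introN eqP ij))/seteqP[h1 _]; exact: (h1 z).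
move=> e e0; have e2 : 0 < e / 2 by rewrite divr_gt0.
have FF n : F n `<=` frame p by exact: subset_trans (FP n) PF.
have [n hn] := area_bigU_le p0 mF FF e2.
have [t1 k1] := tU n _ e2.
set S := \bigcup_k F k in hn *; set U := \big[setU/set0]_(i < n) F i in hn k1.
have mS : measurable S by exact: bigcupT_measurable.
have SP : S `<=` P by apply: bigcup_sub => i _; exact: FP.
have US : U `<=` S by rewrite /U -bigcup_mkord => z [i _ zi]; exists i.
have mD : measurable (S `\` U) by apply: measurableD => //; exact: mU.
have DP : S `\` U `<=` P by move=> z [/SP].
have UD : U `&` (S `\` U) = set0 by rewrite setDE setICA setICr setI0.
exists (Num.max 0 t1) => t; rewrite ge_max => /andP[t0 /k1 l1].
have SE : S = U `|` (S `\` U) by rewrite setDUK.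
have [a1 b1] := phi_mass t0; have [a2 b2] := psi_mass.
rewrite SE (a1 _ _ (mU n) mD (UP n) DP UD) (a2 _ _ (mU n) mD (UP n) DP UD).
have /andP[u1 u2] := b1 _ mD DP; have /andP[v1 v2] := b2 _ mD DP.
rewrite opprD addrACA [e]splitr; apply: le_trans (ler_normD _ _) _; apply: lerD => //.
rewrite ler_norml; apply/andP; split.
  by rewrite lerBrDr (le_trans _ u1)// addrC subr_le0 (le_trans v2).
by rewrite lerBlDr (le_trans u2)// (le_trans hn)// lerDl.
Qed.

End LimitInduction.

Section Estimate.
Variable R : realType.

(** In the use made of it, primes denote inner approximations within [d] and [u] is the total area.
    The ratios x' / u' and x / u are at most 1, and y <= 2 u' turns an error on the ratio into one
    on the product. *)
Lemma product_estimate (x x' y y' u u' d : R) : 0 < u' -> 0 <= x' -> 0 <= y' ->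
  x' <= x -> y' <= y -> u' <= u -> x <= u -> y <= u ->
  x <= x' + d -> y <= y' + d -> u <= u' + d -> x' <= u' -> u <= 2 * u' ->
  `|x' / u' * y' - x * y / u| <= 4 * d.
Proof.
move=> u0 x0 y0 xx yy uu xu yu xd yd ud xu' u2.
have uP : 0 < u by exact: lt_le_trans uu.
have x0' := le_trans x0 xx; have y0' := le_trans y0 yy.
have [c [c0 c1 cE]] : exists c, [/\ 0 <= c, c <= 1 & x' = c * u'].
  exists (x' / u'); split; [by rewrite divr_ge0// ltW| |by rewrite divfK// gt_eqF].
  by rewrite ler_pdivrMr// mul1r.
have [f [f0 f1 fE]] : exists f, [/\ 0 <= f, f <= 1 & x = f * u].
  exists (x / u); split; [by rewrite divr_ge0// ltW| |by rewrite divfK// gt_eqF].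
  by rewrite ler_pdivrMr// mul1r.
have -> : x' / u' * y' = c * y' by rewrite cE mulfK// gt_eqF.
have -> : x * y / u = f * y by rewrite fE mulrAC mulfK// gt_eqF.
have [g [g0 g1 gE]] : exists g, [/\ 0 <= g, g <= 2 & y = g * u'].
  exists (y / u'); split; [by rewrite divr_ge0// ltW| |by rewrite divfK// gt_eqF].
  by rewrite ler_pdivrMr// (le_trans yu).
have h1 : `|(c - f) * u'| <= d.
  have fd : f * u - f * u' <= d.
    rewrite -mulrBr; apply: le_trans (ler_piMl _ f1) _; lra.
  have fu : 0 <= f * u - f * u' by rewrite -mulrBr mulr_ge0// subr_ge0.
  have fu' : f * u' <= x by rewrite fE ler_wpM2l.
  rewrite mulrBl -cE ler_norml; apply/andP; split; lra.
have h2 : `|c * (y' - y)| <= d.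
  rewrite normrM ger0_norm//; apply: le_trans (ler_piMl _ c1) _ => //.
  rewrite ler_norml; lra.
have h3 : `|(c - f) * y| <= 2 * d.
  rewrite gE mulrCA normrM ger0_norm//.
  by apply: ler_pM.
rewrite (_ : c * y' - f * y = c * (y' - y) + (c - f) * y); last by ring.
apply: le_trans (ler_normD _ _) _; have d0 : 0 <= d by apply: le_trans h2.
lra.
Qed.

Lemma ratio_range (x u : R) : 0 <= x -> 0 < u -> x <= u -> 0 <= x / u <= 1.
Proof. by move=> x0 u0 xu; rewrite divr_ge0 ?(ltW u0)//= ler_pdivrMr// mul1r. Qed.

Lemma le_double (u v d : R) : u - v <= d -> d <= u / 2 -> u <= 2 * v.
Proof. by move=> *; lra. Qed.

Lemma le_of_sum (x x' z u d : R) : u - x' - z <= d -> z <= u - x -> x <= x' + d.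
Proof. by move=> *; lra. Qed.

Lemma correlation_estimate (f f' z1 z2 z3 x x' y y' d e : R) :
  `|f' - z1| <= d -> 0 <= f - f' <= x - x' + (y - y') -> x <= x' + d -> y <= y' + d ->
  d <= e / 8 -> `|z2 - z1| <= d -> `|z2 - z3| <= 4 * d -> `|f - z3| <= e.
Proof. by rewrite !ler_norml => *; lra. Qed.

End Estimate.

(** * Mixing of the flow *)

Section Mixing.
Variables (R : realType) (r : nat -> nat) (a p q : R).
Hypotheses (r0 : forall n, (0 < r n.+1)%N) (a0 : 0 < a) (a1 : a < 1).
Hypotheses (q0 : 0 < q) (qp : q < p).
Notation sp := (stair_spstart r a).
Notation P := (polygon a p q).
Notation W := (whole r a p q).
Notation vf := (vflow (stair_T_inv r a) a p q).
Hypothesis sp_cvg : sp n @[n --> \oo] --> (1 : R).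
Hypothesis mixT : mixing_map (stair_T r a).
Hypothesis incomm : forall m n : int, m%:~R * p + n%:~R * q = 0 -> m = 0 /\ n = 0.
Implicit Types A B S : set (R * R).

Let p0 : 0 < p. Proof. exact: lt_trans q0 qp. Qed.
Let PF : P `<=` frame p. Proof. exact: polygon_frame. Qed.
Let mP : measurable P. Proof. exact: measurable_polygon. Qed.
Let aP : 0 < area P. Proof. exact: area_polygon_gt0 r0 a0 q0 qp sp_cvg. Qed.

Let mV (t : R) A B : measurable A -> measurable B -> measurable (vf t @^-1` A `&` B).
Proof. by move=> mA mB; apply: measurableI => //; exact: measurable_vflow_pre. Qed.

Lemma flow_area_le (t : R) A B : 0 <= t -> measurable A -> measurable B -> A `<=` P -> B `<=` P ->
  area (vf t @^-1` A `&` B) <= area A /\ area (vf t @^-1` A `&` B) <= area B.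
Proof.
move=> t0 mA mB AP BP; split.
  rewrite -(vflow_preserves r0 a0 a1 q0 qp sp_cvg mixT t0 mA AP).
  apply: (area_le p0); [exact: mV|exact: mV| |by move=> z [_ /PF]].
  by move=> z [zA /BP].
by apply: (area_le p0 _ mB _ (subset_trans BP PF)); [exact: mV|move=> z []].
Qed.

Lemma flow_areaD (t : R) A A' B : 0 <= t -> measurable A -> measurable A' -> measurable B ->
  A `<=` P -> A' `<=` P -> B `<=` P -> A `&` A' = set0 ->
  area (vf t @^-1` (A `|` A') `&` B) = area (vf t @^-1` A `&` B) + area (vf t @^-1` A' `&` B).
Proof.
move=> t0 mA mA' mB AP AP' BP d; rewrite -(areaU p0); first last.
- by apply/seteqP; split => // z [[z1 _] [z2 _]]; move/seteqP: d => [h _]; exact: (h (vf t z)).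
- by move=> z [_ /BP /PF].
- by move=> z [_ /BP /PF].
- exact: mV.
- exact: mV.
by rewrite preimage_setU setIUl.
Qed.

Lemma flow_areaD2 (t : R) A B B' : measurable A -> measurable B -> measurable B' ->
  B `<=` P -> B' `<=` P -> B `&` B' = set0 ->
  area (vf t @^-1` A `&` (B `|` B')) = area (vf t @^-1` A `&` B) + area (vf t @^-1` A `&` B').
Proof.
move=> mA mB mB' BP BP' d; rewrite -(areaU p0); first last.
- by apply/seteqP; split => // z [[_ z1] [_ z2]]; move/seteqP: d => [h _]; exact: (h z).
- by move=> z [_ /BP' /PF].
- by move=> z [_ /BP /PF].
- exact: mV.
- exact: mV.
by rewrite setIUr.
Qed.

Lemma diff_le A A' : measurable A -> measurable A' -> A' `<=` A -> A `<=` P ->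
  exists D, [/\ measurable D, D `<=` P, A' `&` D = set0, A = A' `|` D & area D = area A - area A'].
Proof.
move=> mA mA' AA AP; exists (A `\` A'); split.
- exact: measurableD.
- by move=> z [/AP].
- by rewrite setDE setICA setICr setI0.
- by rewrite setDUK.
- by rewrite (areaD p0)//; exact: subset_trans PF.
Qed.

Lemma flow_area_approx (t : R) A A' B B' : 0 <= t -> measurable A -> measurable A' ->
  measurable B -> measurable B' -> A' `<=` A -> B' `<=` B -> A `<=` P -> B `<=` P ->
  0 <= area (vf t @^-1` A `&` B) - area (vf t @^-1` A' `&` B') <=
    (area A - area A') + (area B - area B').
Proof.
move=> t0 mA mA' mB mB' AA BB AP BP.
have AP' := subset_trans AA AP; have BP' := subset_trans BB BP.
have [D [mD DP d1 AE eD]] := diff_le mA mA' AA AP.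
have [E [mE EP d2 BE eE]] := diff_le mB mB' BB BP.
have -> : area (vf t @^-1` A `&` B) = area (vf t @^-1` A' `&` B') +
    area (vf t @^-1` A' `&` E) + area (vf t @^-1` D `&` B).
  by rewrite {1}AE flow_areaD// {1}BE flow_areaD2.
rewrite -eD -eE.
have [h1 _] := flow_area_le t0 mD mB DP BP; have [_ h2] := flow_area_le t0 mA' mE AP' EP.
have h3 := area_ge0 (vf t @^-1` D `&` B); have h4 := area_ge0 (vf t @^-1` A' `&` E).
move: h1 h2 h3 h4; clear.
move: (area D) (area E) (area (vf t @^-1` D `&` B)) (area (vf t @^-1` A' `&` E)).
move: (area (vf t @^-1` A' `&` B')) => x1 x2 x3 x4 x5 *; lra.
Qed.

Notation phi A B t := (area (vf t @^-1` A `&` B)).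

Lemma box_mixing x y x' y' (e : R) : 0 < e -> exists t0, forall t, t0 <= t ->
  `|phi (box a p q x y) (box a p q x' y') t -
    area (box a p q x y) * area (box a p q x' y') / area P| <= e.
Proof.
move=> e0; set A := box a p q x y; set B := box a p q x' y'.
have AP : A `<=` P by move=> z [].
have BP : B `<=` P by move=> z [].
have mA : measurable A by exact: measurable_box.
have mB : measurable B by exact: measurable_box.
have e8 : 0 < e / 8 by rewrite divr_gt0.
have aP2 : 0 < area P / 2 by rewrite divr_gt0.
(* Eight units of error: two for replacing the boxes by step sets, one for [step_mixing], one for
   the whole column against the polygon, four for the product. The second bound makes the polygon at
   most twice the column. *)
have [d [d0 d1 d2]] : exists d, [/\ 0 < d, d <= e / 8 & d <= area P / 2].
  by exists (Num.min (e / 8) (area P / 2)); split; rewrite ?lt_min ?e8 ?aP2// ge_min lexx ?orbT.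
have [N1 h1] := box_approx r0 a0 a1 q0 qp sp_cvg mixT x y d0.
have [N2 h2] := box_approx r0 a0 a1 q0 qp sp_cvg mixT x' y' d0.
pose n := maxn N1 N2.
have [al [be [al' [be' [fA fA' AA AC [hA hW]]]]]] := h1 n (leq_maxl _ _).
have [be1 [be2 [be3 [be4 [fB fB' BB BC [hB _]]]]]] := h2 n (leq_maxr _ _).
have [t1 ht1] := step_mixing r0 a0 a1 q0 qp sp_cvg mixT incomm fA fB d0.
set A' := step r a n al be in AA hA ht1; set B' := step r a n be1 be2 in BB hB ht1.
have mA' : measurable A' by exact: measurable_step_set.
have mB' : measurable B' by exact: measurable_step_set.
have mW : measurable (W n) by exact: measurable_step_set.
have WP : W n `<=` P by exact: whole_sub.
have mC := measurable_step_set r a n.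
have cA := area_complement q0 qp (mC _ _) mA AP AC.
have cB := area_complement q0 qp (mC _ _) mB BP BC.
exists (Num.max 0 t1) => t; rewrite ge_max => /andP[t0 /ht1 {}ht1].
have g1 := flow_area_approx t0 mA mA' mB mB' AA BB AP BP.
have BP' := subset_trans BB BP.
have g2 := flow_area_approx t0 mP mW mB' mB' WP (@subset_refl _ _) (@subset_refl _ _) BP'.
have e1 : phi P B' t = area B'.
  congr area; apply/seteqP; split => [z []//|z zB]; split => //.
  exact: (vflow_polygon r0 a0 q0 qp sp_cvg t0 (BP' _ zB)).
rewrite e1 subrr addr0 in g2.
have W0 : 0 < area (W n).
  by rewrite (area_whole r0 a0 q0 qp sp_cvg) mulr_gt0 ?width_gt0// total_col_gt0.
have sub1 := area_le p0 mA' mA AA (subset_trans AP PF).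
have sub2 := area_le p0 mB' mB BB (subset_trans BP PF).
have sub3 := area_le p0 mA mP AP PF.
have sub4 := area_le p0 mB mP BP PF.
have sub5 := area_le p0 mW mP WP PF.
have sub6 : area A' <= area (W n).
  apply: (area_le p0 mA' mW _ (subset_trans WP PF)).
  move=> [u v] zA; apply/(wholeE r0 a0 q0 qp sp_cvg); split; first exact: (AP _ (AA _ zA)).
  exact: (step_supported r0 a0 zA).
have pa := area_ge0 A'; have pb := area_ge0 B'.
have hA' := le_of_sum hA cA; have hB' := le_of_sum hB cB.
have hW' : area P <= area (W n) + d by rewrite -lerBlDl; exact: hW.
have uu := le_double hW d2.
have pe := product_estimate W0 pa pb sub1 sub2 sub5 sub3 sub4 hA' hB' hW' sub6 uu.
have c01 : 0 <= area A' / area (W n) <= 1 by exact: ratio_range.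
have hz : `|area A' / area (W n) * area B' - area A' / area (W n) * phi (W n) B' t| <= d.
  have /andP[c0 c1] := c01; have /andP[g3 g4] := g2.
  rewrite -mulrBr normrM ger0_norm//; apply: le_trans (ler_piMl _ c1) _ => //.
  by rewrite (ger0_norm g3); exact: le_trans g4 hW.
exact: correlation_estimate ht1 g1 hA' hB' d1 hz pe.
Qed.

(** One variable at a time: the second set is extended with the first a box, then the first with the
    second arbitrary. Invariance of the area supplies the case of the whole polygon. *)
Lemma measure_mixing A B (e : R) : measurable A -> measurable B -> A `<=` P -> B `<=` P ->
  0 < e -> exists t0, forall t, t0 <= t -> `|phi A B t - area A * area B / area P| <= e.
Proof.
have le1 S : measurable S -> S `<=` P -> 0 <= area S / area P <= 1.
  by move=> mS SP; apply: ratio_range => //; [exact: area_ge0|exact: (area_le p0)].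
have mass2 E (t : R) : measurable E -> E `<=` P -> 0 <= t ->
    subadditive_mass a p q (fun F => phi E F t).
  move=> mE EP t0; split; first by move=> S S' mS mS' SP SP' d; exact: flow_areaD2.
  move=> S mS SP; rewrite area_ge0/=.
  by have [] := flow_area_le t0 mE mS EP SP.
have mass1 F (t : R) : measurable F -> F `<=` P -> 0 <= t ->
    subadditive_mass a p q (fun E => phi E F t).
  move=> mF FP t0; split; first by move=> S S' mS mS' SP SP' d; exact: flow_areaD.
  move=> S mS SP; rewrite area_ge0/=.
  by have [] := flow_area_le t0 mS mF SP FP.
have massl E : measurable E -> E `<=` P ->
    subadditive_mass a p q (fun F => area E * area F / area P).
  move=> mE EP; split.
    move=> S S' mS mS' SP SP' d.
    rewrite (areaU p0 mS mS' (subset_trans SP PF) (subset_trans SP' PF) d).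
    by rewrite mulrDr mulrDl.
  move=> S mS SP; have /andP[c0 c1] := le1 _ mE EP; have s0 := area_ge0 S.
  by rewrite mulrAC mulr_ge0//= ler_piMl.
have massr F : measurable F -> F `<=` P ->
    subadditive_mass a p q (fun E => area E * area F / area P).
  move=> mF FP; have := massl F mF FP; congr subadditive_mass; apply/funext => E.
  by rewrite [area F * _]mulrC.
have step1 x y F : measurable F -> F `<=` P ->
    tends (fun t F => phi (box a p q x y) F t)
      (fun F => area (box a p q x y) * area F / area P) F.
  have mE := measurable_box a p q x y; have EP : box a p q x y `<=` P by move=> z [].
  move: F; apply: (tends_all q0 qp (fun t => mass2 _ t mE EP) (massl _ mE EP)).
    move=> d d0; exists 0 => t t0.
    rewrite (vflow_preserves r0 a0 a1 q0 qp sp_cvg mixT t0 mE EP) mulfK ?gt_eqF//.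
    by rewrite subrr normr0 ltW.
  by move=> x' y' d d0; exact: box_mixing.
move=> mA mB AP BP; move: e; move: A mA AP.
apply: (tends_all q0 qp (fun t => mass1 _ t mB BP) (massr _ mB BP)).
  move=> d d0; exists 0 => t t0; rewrite mulrAC divff ?gt_eqF// mul1r.
  rewrite (_ : phi P B t = area B) ?subrr ?normr0 ?ltW//; congr area.
  apply/seteqP; split => [z []//|z zB]; split => //.
  exact: (vflow_polygon r0 a0 q0 qp sp_cvg t0 (BP _ zB)).
by move=> x y d d0; exact: (step1 x y B mB BP d d0).
Qed.

End Mixing.

Unset Implicit Arguments.

Theorem theorem1p1 (R : realType) (r : nat -> nat) (x0 p q : R) :
  stair_admissible r x0 ->
  mixing_map (stair_T r x0) ->
  x0 < 1 -> 0 < q -> q < p ->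
  (forall m n : int, m%:~R * p + n%:~R * q = 0 -> m = 0 /\ n = 0) ->
  mixing_flow (vflow (stair_T_inv r x0) x0 p q) (polygon x0 p q).
Proof.
move=> [r0 [a0 sp_cvg]] mixT a1 q0 qp incomm nu A B mA mB AP BP.
have aP := area_polygon_gt0 r0 a0 q0 qp sp_cvg.
apply/cvgrPdist_le => e e0.
have [t0 ht0] := measure_mixing r0 a0 a1 q0 qp sp_cvg mixT incomm mA mB AP BP (mulr_gt0 e0 aP).
near=> t; have /ht0 ht : t0 <= t by near: t; apply: nbhs_pinfty_ge; exact: num_real.
have nuE E : nu E = area E / area (polygon x0 p q) by rewrite /nu !area_def.
rewrite !nuE.
set X := area (_ `&` B) in ht *; set U := area (polygon x0 p q) in ht aP *.
rewrite distrC (_ : X / U - _ = (X - area A * area B / U) / U); last first.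
  by field; rewrite gt_eqF.
by rewrite normrM [`|U^-1|]gtr0_norm ?invr_gt0// ler_pdivrMr.
Unshelve. all: by end_near. Qed.
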